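(* Let $\Gamma$ be a metric graph of genus $g$, neither a point nor a circle, and let $0\le d\le g$. Let $S^{(d)}:\mathrm{Div}^d_+(\Gamma)\to\mathrm{Pic}^d(\Gamma)$, $D\mapsto[D]$, and let $W_d=S^{(d)}(\mathrm{Div}^d_+(\Gamma))$. (a) $W_d$ is a purely $d$-dimensional polyhedral subset of $\mathrm{Pic}^d(\Gamma)$. (b) $S^{(d)}$ is ''birational'' onto its image: there exists an open dense subset $U_d\subseteq W_d$ such that the induced map $(S^{(d)})^{-1}(U_d)\to U_d$ is a homeomorphism. (c) There exists an open dense subset $U_d\subseteq W_d$ such that $r(D)=0$ whenever $[D]\in U_d$.
   Context: A metric graph is a compact connected metric space $\Gamma$ in which every point has a neighborhood isometric to a star-shaped set $\{te^{2\pi i k/n}\in\mathbb{C} : 0\le t<r,\ k\in\mathbb{Z}\}$ (finite valency $n$, radius $r>0$) with the path metric. Its genus is $g=\dim H_1(\Gamma;\mathbb{R})$. A divisor is an element $D=\sum_p D(p)\,(p)$ of the free abelian group on the points of $\Gamma$; $\deg D=\sum_p D(p)$; $D$ is effective if all $D(p)\ge 0$. $\mathrm{Div}^d(\Gamma)$ is the set of divisors of degree $d$ and $\mathrm{Div}^d_+(\Gamma)$ the subset of effective ones, the latter with the quotient topology from its identification with $\Gamma^d/\mathfrak{S}_d$. $R(\Gamma)$ is the group of continuous piecewise affine functions $\phi:\Gamma\to\mathbb{R}$ with integer slopes, and $\mathrm{div}(\phi)=\sum_p\sigma_p(\phi)(p)$, where $\sigma_p(\phi)$ is the sum of incoming slopes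 of $\phi$ at $p$. $D_1\sim D_2$ means $D_1-D_2=\mathrm{div}(\phi)$ for some $\phi\in R(\Gamma)$; $[D]$ is the class of $D$; $|D|$ is the set of effective divisors linearly equivalent to $D$; $\mathrm{Pic}^d(\Gamma)$ is the set of classes of degree $d$. Thus $W_d$ is the set of classes of degree $d$ containing an effective divisor. The rank $r(D)$ (depending only on $[D]$) is $-1$ if $|D|=\emptyset$, and for $s\ge0$, $r(D)\ge s$ iff $|D-E|\neq\emptyset$ for every effective $E$ of degree $s$. Topology and polyhedral structure on $\mathrm{Pic}^d(\Gamma)$: $\mathrm{Jac}(\Gamma)=H_1(\Gamma,\mathbb{R})/H_1(\Gamma,\mathbb{Z})$ is a $g$-dimensional real torus. Fix $q\in\Gamma$. The Abel–Jacobi map $\Phi_q:\Gamma\to\mathrm{Jac}(\Gamma)$ sends $p$ to the class of the orthogonal projection onto $H_1(\Gamma,\mathbb{R})$ of the 1-chain of any path from $q$ to $p$ (1-chains carry the inner product in which distinct edges are orthogonal and an oriented edge segment has squared norm equal to its length). Extending additively, $D\mapsto\sum_pD(p)\Phi_q(p)$ induces a bijection $\mathrm{Pic}^d(\Gamma)\to\mathrm{Jac}(\Gamma)$ (tropical Abel–Jacobi theorem), through which $\mathrm{Pic}^d(\Gamma)$ receives its topology. A polyhedral subset of $\mathrm{Pic}^d(\Gamma)\cong\mathrm{Jac}(\Gamma)$ is a finite union of images of polytopes in $H_1(\Gamma,\mathbb{R})$; it is purely $d$-dimensional if it is a finite union of images of $d$-dimensional polytopes. *)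

(* Defs.v *)
From HB Require Import structures.
From mathcomp Require Import all_boot all_order all_algebra.
From mathcomp Require Import all_classical all_reals all_analysis.
From mathcomp Require Import lra.
From mathcomp.multinomials Require Import freeg.

Set Implicit Arguments.
Unset Strict Implicit.
Unset Printing Implicit Defensive.

Import Order.TTheory GRing.Theory Num.Theory.
Import numFieldNormedType.Exports.

Local Open Scope classical_set_scope.
Local Open Scope ring_scope.

Section Topology.
Context {T U : topologicalType}.

Definition homeomorphism_on (f : T -> U) (A : set T) (B : set U) : Prop :=
  exists g : U -> T,
    [/\ (forall x, A x -> B (f x) /\ g (f x) = x),
        (forall y, B y -> A (g y) /\ f (g y) = y),
        {within A, continuous f} & {within B, continuous g}].

Definition open_dense_in (V W : set T) : Prop :=
  (exists2 O : set T, open O & V = W `&` O) /\ W `<=` closure V.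

End Topology.

Section MetricGraph.
Context {R : realType}.

(* The star of valency n and radius r in polar coordinates: (k, t) stands for
   t e^(2 pi i k / n), and the distance is the length of the shortest path
   through the centre.  Allowing n = 0 makes a single point a metric graph. *)
Definition star_chart (X : metricType R) (p : X) (n : nat) (r : R)
    (c : 'I_n -> R -> X) : Prop :=
  [/\ 0 < r,
      forall k, c k 0 = p,
      forall k l s t, 0 <= s < r -> 0 <= t < r ->
        mdist (c k s) (c l t) = if k == l then `|s - t| else s + t
    & nbhs p [set x | x = p \/ exists k t, 0 <= t < r /\ x = c k t]].

Definition metric_graph (X : metricType R) : Prop :=
  [/\ compact [set: X], connected [set: X]
    & forall p : X, exists n r (c : 'I_n -> R -> X), star_chart p r c].

Definition is_point (X : metricType R) : Prop :=
  exists p : X, [set: X] = [set p].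

Definition is_circle (X : metricType R) : Prop :=
  exists f : X -> R * R,
    homeomorphism_on f setT [set z | z.1 ^+ 2 + z.2 ^+ 2 = 1].

Section Divisors.
Context {X : metricType R}.
Implicit Types (D E : {freeg X}) (phi : X -> R).

(* [a] is sigma_p(phi), the sum of the incoming slopes at p; [m k] is the
   outgoing slope of phi along the k-th ray. *)
Definition slope_sum phi (p : X) (a : int) : Prop :=
  exists n r (c : 'I_n -> R -> X) (m : 'I_n -> int),
    [/\ star_chart p r c,
        forall k t, 0 <= t < r -> phi (c k t) = phi p + (m k)%:~R * t
      & a = - \sum_k m k].

(* Piecewise affinity is stated locally; on a compact graph this is the same
   as affinity on the pieces of a finite subdivision. *)
Definition rational_function phi : Prop :=
  continuous phi /\ forall p, exists a, slope_sum phi p a.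

Definition is_div phi D : Prop :=
  rational_function phi /\ forall p, slope_sum phi p (coeff p D).

Definition lin_equiv D1 D2 : Prop := exists phi, is_div phi (D1 - D2).

Definition effective D : bool := fgle 0 D.

Definition lin_system D : set {freeg X} :=
  [set D' | effective D' /\ lin_equiv D' D].

Definition rank_ge D (s : nat) : Prop :=
  forall E, effective E -> deg E = s%:Z -> lin_system (D - E) !=set0.

(* Principal divisors have degree 0, so rank_ge D s forces s <= deg D and the
   maximum below is over all s with rank_ge D s. *)
Definition div_rank D : int :=
  if `[< lin_system D !=set0 >]
  then (\max_(s < `|deg D|%N.+1 | `[< rank_ge D s >]) s)%N%:Z
  else - 1.

Variable d : nat.

Definition Div : Type := {D : {freeg X} | deg D == d%:Z}.

Definition EffDiv : Type := {D : Div | effective (val D)}.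
HB.instance Definition _ := Choice.on EffDiv.

Lemma deg_points (x : 'I_d -> X) : deg (\sum_i << x i >> : {freeg X}) == d%:Z.
Proof.
rewrite raddf_sum /=; under eq_bigr do rewrite degU.
by rewrite sumr_const card_ord natz.
Qed.

Lemma effective_points (x : 'I_d -> X) : effective (\sum_i << x i >>).
Proof.
apply/fgposP => z; rewrite raddf_sum /=; apply: sumr_ge0 => i _.
by rewrite coeffU mul1r ler0n.
Qed.

Definition points_div (x : 'I_d -> X) : EffDiv :=
  Sub (Sub (\sum_i << x i >>) (deg_points x) : Div) (effective_points x).

(* The fibres of points_div are the orbits of the symmetric group, so the
   final topology of points_div is the quotient topology of X^d / S_d. *)
Definition EffDiv_open (A : set EffDiv) : Prop :=
  open (points_div @^-1` A : set {ptws 'I_d -> X}).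

Let EffDiv_openT : EffDiv_open setT.
Proof. by rewrite /EffDiv_open preimage_setT; exact: openT. Qed.

Let EffDiv_openI (A B : set EffDiv) :
  EffDiv_open A -> EffDiv_open B -> EffDiv_open (A `&` B).
Proof. by move=> oA oB; rewrite /EffDiv_open preimage_setI; exact: openI. Qed.

Let EffDiv_open_bigU (I : Type) (f : I -> set EffDiv) :
  (forall i, EffDiv_open (f i)) -> EffDiv_open (\bigcup_i f i).
Proof.
by move=> of_; rewrite /EffDiv_open preimage_bigcup; apply: bigcup_open => i _;
  exact: of_.
Qed.

HB.instance Definition _ :=
  isOpenTopological.Build EffDiv EffDiv_openT EffDiv_openI EffDiv_open_bigU.

Definition lin_class D : set {freeg X} := [set D' | lin_equiv D' D].

Definition Pic : Type :=
  {C : set {freeg X} | `[< exists D : Div, C = lin_class (val D) >]}.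
HB.instance Definition _ := Choice.on Pic.

Lemma div_class_subproof (D : Div) :
  `[< exists D' : Div, lin_class (val D) = lin_class (val D') >].
Proof. by apply/asboolP; exists D. Qed.

Definition div_class (D : Div) : Pic :=
  Sub (lin_class (val D)) (div_class_subproof D).

End Divisors.

(* A finite graph with oriented edges whose geometric realization is X: the
   edge e is parametrized by arc length on [0, len e], and the points of X are
   the vertices together with the points of the disjoint open edges. *)
Record model (X : metricType R) := Model {
  nvert : nat;
  nedge : nat;
  vert : 'I_nvert -> X;
  src : 'I_nedge -> 'I_nvert;
  tgt : 'I_nedge -> 'I_nvert;
  len : 'I_nedge -> R;
  par : 'I_nedge -> R -> X;
  vert_inj : injective vert;
  len_gt0 : forall e, 0 < len e;
  par_src : forall e, par e 0 = vert (src e);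
  par_tgt : forall e, par e (len e) = vert (tgt e);
  par_isometry : forall e t, 0 <= t <= len e -> exists2 eps : R, 0 < eps &
    forall s s', 0 <= s <= len e -> 0 <= s' <= len e ->
      `|s - t| < eps -> `|s' - t| < eps ->
      mdist (par e s) (par e s') = `|s - s'|;
  par_vert : forall e t v, 0 < t < len e -> par e t <> vert v;
  par_inj : forall e e' t t', 0 < t < len e -> 0 < t' < len e' ->
    par e t = par e' t' -> e = e' /\ t = t';
  model_cover : forall p, (exists v, p = vert v) \/
    (exists e t, 0 < t < len e /\ p = par e t)
}.

(* Every metric graph has a model: the half-stars around finitely many points
   cover X; cutting their rays at all the centres and end points of rays leaves
   finitely many open segments, any two of which agree or are disjoint. *)
Section ModelExists.
Context {X : metricType R}.

Let seg := (R * (R -> X))%type.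
Implicit Types (s u : seg) (V : seq X).

Let inter s (x : X) : Prop := exists t, 0 < t < s.1 /\ x = s.2 t.

Let good V s : Prop :=
  [/\ 0 < s.1, s.2 0 \in V, s.2 s.1 \in V,
      forall a b, 0 <= a <= s.1 -> 0 <= b <= s.1 ->
        mdist (s.2 a) (s.2 b) = `|a - b|
    & forall t x, 0 < t < s.1 -> mdist (s.2 t) x < t ->
        mdist (s.2 t) x < s.1 - t -> inter s x].

Let clean V s : Prop := good V s /\ forall v, v \in V -> ~ inter s v.

Lemma seg_inj V s a b : good V s -> 0 <= a <= s.1 -> 0 <= b <= s.1 ->
  s.2 a = s.2 b -> a = b.
Proof.
case=> _ _ _ iso _ ha hb e; apply/eqP; rewrite -subr_eq0 -normr_eq0.
by rewrite -(iso _ _ ha hb) e mdistxx.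
Qed.

Lemma split_segment V n s : good V s ->
  (count (fun v => `[< inter s v >]) V <= n)%N ->
  exists l : seq seg, (forall u, u \in l -> clean V u) /\
    forall x, inter s x -> x \in V \/ exists2 u, u \in l & inter u x.
Proof.
elim: n s => [|n IHn] s gs hn.
- exists [:: s]; split=> [u|x sx]; last by right; exists s; rewrite ?mem_head.
  rewrite inE => /eqP->; split=> // v vV sv.
  move: hn; rewrite leqn0 -[_ == _]negbK -lt0n -has_count => /negP; apply.
  by apply/hasP; exists v => //; apply/asboolP.
have [/hasP[v vV /asboolP sv]|nos] :=
  boolP (has (fun v => `[< inter s v >]) V); last first.
  exists [:: s]; split=> [u|x sx]; last by right; exists s; rewrite ?mem_head.
  rewrite inE => /eqP->; split=> // v vV sv; move/negP: nos; apply.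
  by apply/hasP; exists v => //; apply/asboolP.
have [t [tI vE]] := sv.
have [s0 sl sr iso ball_s] := gs.
pose s1 : seg := (t, s.2); pose s2 : seg := (s.1 - t, fun a => s.2 (t + a)).
have small w : (forall x, inter w x -> inter s x) -> ~ inter w v ->
    (count (fun v => `[< inter w v >]) V <= n)%N.
  move=> ws wv; rewrite -ltnS; apply: leq_trans hn.
  elim: (V) vV => // y W IH; rewrite inE => /predU1P[<-|vW] /=.
    rewrite (asboolF wv) (asboolT sv) add0n ltnS.
    by apply: sub_count => z /asboolP/ws sz; apply/asboolP.
  rewrite -addnS; apply: leq_add; last exact: IH.
  case: (asboolP (inter w y)) => // /ws sy.
  by rewrite (asboolT sy).
have i1 x : inter s1 x -> inter s x.
  by case=> a [/= aI ->]; exists a; split=> //; lra.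
have i2 x : inter s2 x -> inter s x.
  by case=> a [/= aI ->]; exists (t + a); split=> //; lra.
have n1 : ~ inter s1 v.
  case=> a [/= aI]; rewrite vE => /(seg_inj gs) H.
  by have := H _ _; lra.
have n2 : ~ inter s2 v.
  case=> a [/= aI]; rewrite vE => /(seg_inj gs) H.
  by have := H _ _; lra.
have iso_lt a b (e : R) : 0 <= a <= s.1 -> 0 <= b <= s.1 ->
   mdist (s.2 a) (s.2 b) < e -> `|a - b| < e by move=> ? ?; rewrite iso.
have g1 : good V s1.
  split=> //=; [lra|by rewrite -vE|by move=> a b ? ?; apply: iso; lra|].
  move=> a x aI h1 h2.
  have [|||b [bI xE]] := ball_s a x; [lra|exact: h1|lra|].
  exists b; split=> //; move: h1 h2; rewrite xE iso; [|lra|lra].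
  by rewrite !ltr_norml /=; lra.
have g2 : good V s2.
  split=> //=; [lra|by rewrite addr0 -vE|by rewrite addrC subrK| |].
    by move=> a b ? ?; rewrite iso; [congr (`|_|); lra|lra|lra].
  move=> a x aI h1 h2.
  have [|||b [bI xE]] := ball_s (t + a) x; [lra|lra|lra|].
  exists (b - t); split=> /=; last by rewrite addrC subrK.
  move: h1 h2; rewrite xE iso; [|lra|lra].
  by rewrite !ltr_norml /=; lra.
have [l1 [c1 e1]] := IHn _ g1 (small _ i1 n1).
have [l2 [c2 e2]] := IHn _ g2 (small _ i2 n2).
exists (l1 ++ l2); split=> [u|x [a [aI xE]]].
  by rewrite mem_cat => /orP[]; [exact: c1|exact: c2].
have [at_|ta|at_] := ltgtP a t.
- have [|xV|[u ul ux]] := e1 x; [by exists a; split=> //=; lra|by left|].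
  by right; exists u => //; rewrite mem_cat ul.
- have [|xV|[u ul ux]] := e2 x; [|by left|].
    by exists (a - t); split=> /=; [lra|rewrite addrC subrK].
  by right; exists u => //; rewrite mem_cat ul orbT.
by left; rewrite xE at_ -vE.
Qed.

Lemma seg_closed V s : good V s ->
  closed [set x | exists t, 0 <= t <= s.1 /\ x = s.2 t].
Proof.
case=> s0 _ _ iso _.
have -> : [set x | exists t, 0 <= t <= s.1 /\ x = s.2 t] = s.2 @` `[0, s.1].
  apply/seteqP; split=> x /=.
    by case=> t [tI ->]; exists t => //; rewrite in_itv.
  by case=> t; rewrite in_itv /= => tI <-; exists t.
apply: compact_closed; first exact: metric_hausdorff.
apply: continuous_compact; last exact: segment_compact.
apply/subspace_continuousP => t; rewrite /= in_itv /= => tI.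
apply/cvg_ballP => e e0; rewrite near_withinE.
apply/nbhs_ballP; exists e => //= a ta; rewrite in_itv /= => aI.
by rewrite ballEmdist /= iso.
Qed.

Lemma clean_sub V s u x : clean V s -> clean V u -> inter s x -> inter u x ->
  forall y, inter s y -> inter u y.
Proof.
move=> [gs sV] [gu uV] [t0 [t0I xE]] ux.
have [s0 sl sr iso ball_s] := gs; have [u0 ul ur uiso ball_u] := gu.
pose A : set R := [set` `]0, s.1[].
pose B : set R := A `&` (fun t => inter u (s.2 t)).
have AE t : A t <-> 0 < t < s.1 by rewrite /A set_itvE.
have opB : open B.
  rewrite openE => t [/AE tI [w [wI e]]].
  rewrite /interior; apply/nbhs_ballP.
  exists (Num.min (Num.min t (s.1 - t)) (Num.min w (u.1 - w))).
    by rewrite /= !lt_min; lra.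
  move=> a; rewrite /ball /= !lt_min => /andP[/andP[h1 h2] /andP[h3 h4]].
  have aI : 0 < a < s.1 by move: h1 h2; rewrite !ltr_norml; lra.
  split; first exact/AE.
  have da : mdist (u.2 w) (s.2 a) = `|t - a| by rewrite -e iso //; lra.
  by apply: (ball_u w); rewrite ?da.
have AB : B = A.
  have cA : connected A.
    by apply/connected_intervalP; exact: interval_is_interval.
  apply: cA.
  - by exists t0; split; [exact/AE|rewrite -xE].
  - by exists B => //; rewrite /B setIA setIid.
  exists (closure B); first exact: closed_closure.
  apply/seteqP; split=> [t Bt|t [At clt]].
    by split; [case: Bt|exact: subset_closure].
  split=> //; have tI : 0 < t < s.1 by apply/AE.
  have : [set x | exists w, 0 <= w <= u.1 /\ x = u.2 w] (s.2 t).
    apply: (seg_closed gu) => N /nbhs_ballP[e /= e0 eN].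
    have [|a [[/AE aI [w [wI wE]]] ae]] := clt (ball t e).
      exact: nbhsx_ballx.
    exists (s.2 a); split; first by exists w; split=> //; lra.
    apply: eN; rewrite ballEmdist /=.
    by rewrite iso //; lra.
  case=> w [wI wE].
  have nV : s.2 t \notin V by apply/negP => /sV; apply; exists t.
  have [w0|w0|w0] := ltgtP w 0; first lra; last first.
    by move: nV; rewrite wE w0 ul.
  have [w1|w1|w1] := ltgtP w u.1; [|lra|].
    by exists w; split=> //; rewrite w0.
  by move: nV; rewrite wE w1 ur.
move=> y [t [tI ->]].
have : A t by apply/AE.
by rewrite -AB => -[].
Qed.

Lemma dedupe V (l : seq seg) : (forall u, u \in l -> clean V u) ->
  exists l' : seq seg, [/\ uniq l', (forall u, u \in l' -> clean V u),
    (forall u w x, u \in l' -> w \in l' -> inter u x -> inter w x -> u = w)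
  & forall u x, u \in l -> inter u x -> exists2 w, w \in l' & inter w x].
Proof.
elim: l => [|s l IH] cl; first by exists [::].
have [|l' [ul' cl' dis cov]] := IH.
  by move=> u ul; apply: cl; rewrite inE ul orbT.
have cs : clean V s by apply: cl; rewrite mem_head.
have [[w [x [wl sx wx]]]|no] :=
  pselect (exists w x, [/\ w \in l', inter s x & inter w x]).
  exists l'; split=> // u y; rewrite inE => /predU1P[->|]; last exact: cov.
  by move=> sy; exists w => //; apply: (clean_sub cs (cl' _ wl) sx wx).
exists (s :: l'); split.
- rewrite /= ul' andbT; apply/negP => sl; apply: no; exists s, (s.2 (s.1 / 2)).
  have [[s0 _ _ _ _] _] := cs.
  by split=> //; exists (s.1 / 2); split=> //; lra.
- by move=> u; rewrite inE => /predU1P[->|/cl'].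
- move=> u w x; rewrite !inE => /predU1P[->|ul] /predU1P[->|wl] // ux wx.
  + by case: no; exists w, x.
  + by case: no; exists u, x.
  + exact: dis ux wx.
move=> u x; rewrite inE => /predU1P[->|ul] ux.
  by exists s => //; rewrite mem_head.
by have [w wl wx] := cov _ _ ul ux; exists w => //; rewrite inE wl orbT.
Qed.

Lemma local_segments (p : X) :
  (exists n r (c : 'I_n -> R -> X), star_chart p r c) ->
  exists F : R * seq seg, [/\ 0 < F.1,
    (forall V, p \in V -> (forall s, s \in F.2 -> s.2 s.1 \in V) ->
       forall s, s \in F.2 -> good V s)
  & forall x, mdist p x < F.1 -> x = p \/ exists2 s, s \in F.2 & inter s x].
Proof.
case=> n [r [c [r0 c0 iso /nbhs_ballP[e /= e0]]]]; rewrite ballEmdist /= => sub.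
pose d := Num.min r e; have d0 : 0 < d by rewrite lt_min r0.
have dr : d <= r by rewrite ge_min lexx.
have de : d <= e by rewrite ge_min lexx orbT.
have near_p x : mdist p x < d -> x = p \/ exists k t, 0 < t < d /\ x = c k t.
  move=> px; have [|->|[k [t [tI xE]]]] := sub x;
    [by apply: lt_le_trans de|by left|].
  have tE : mdist p x = t.
    by rewrite xE -(c0 k) iso ?eqxx ?sub0r ?normrN ?ger0_norm //; lra.
  have [t0|t0|t0] := ltgtP t 0; [by exfalso; lra| |by left; rewrite xE t0 c0].
  by right; exists k, t; split=> //; rewrite t0 -tE.
pose S := [seq (d / 2, c k) : seg | k <- enum 'I_n].
exists (d / 2, S); split=> /= [|V pV rV s sS|x px]; first lra; last first.
  have [|->|[k [t [tI xE]]]] := near_p x; [lra|by left|right].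
  exists (d / 2, c k); first by apply: map_f; rewrite mem_enum.
  exists t; split=> //=; move: px.
  by rewrite xE -(c0 k) iso ?eqxx ?sub0r ?normrN ?ger0_norm; lra.
have := rV _ sS; case/mapP: sS => k _ -> /= rk.
split=> //=; [lra|by rewrite c0| |].
  by move=> a b ? ?; rewrite iso ?eqxx //; lra.
move=> t x tI h1 h2.
have pt : mdist p (c k t) = t.
  by rewrite -(c0 k) iso ?eqxx ?sub0r ?normrN ?ger0_norm //; lra.
have := metric_triangle p (c k t) x; rewrite pt => tri.
have [|xp|[k' [a [aI xE]]]] := near_p x; first lra.
  by move: h1; rewrite xp metric_sym pt; lra.
move: h1 h2; rewrite xE iso; [|lra|lra].
have [<-|_] := eqVneq k k'; last lra.
by rewrite !ltr_norml => ? ?; exists a; split=> //=; lra.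
Qed.

Lemma finite_segments : metric_graph X -> exists V (l : seq seg),
  (forall s, s \in l -> good V s) /\
  forall x, x \in V \/ exists2 s, s \in l & inter s x.
Proof.
case=> cX _ /(_ _)/local_segments star.
have [F FP] := choice star.
have [ps cov] : exists ps : seq X,
    forall x, exists2 p, p \in ps & mdist p x < (F p).1.
  pose Fil : set_system (seq X) :=
    [set P | exists l0 : seq X, forall l : seq X, {subset l0 <= l} -> P l].
  have FilF : Filter Fil.
    split; first by exists [::].
    - move=> P Q [l1 h1] [l2 h2]; exists (l1 ++ l2) => l sl; split.
        by apply: h1 => x xl; apply: sl; rewrite mem_cat xl.
      by apply: h2 => x xl; apply: sl; rewrite mem_cat xl orbT.
    by move=> P Q PQ [l0 h]; exists l0 => l sl; apply: PQ; exact: h.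
  move/compact_near_coveringP: cX.
  move=> /(_ _ Fil (fun l x => exists2 p, p \in l & mdist p x < (F p).1) FilF).
  case=> [x _|l0 h].
    exists (ball x (F x).1, [set l | x \in l]) => /=.
      split; first by apply: nbhsx_ballx; have [] := FP x.
      by exists [:: x] => l; apply; rewrite mem_head.
    by case=> y l /=; rewrite ballEmdist => -[xy xl]; exists x.
  by exists l0 => x; apply: (h l0).
pose l := flatten [seq (F p).2 | p <- ps].
pose V := ps ++ [seq s.2 s.1 | s <- l].
exists V, l; split.
- move=> s /flatten_mapP[p pps sF]; have [_ + _] := FP p; apply=> //.
    by rewrite mem_cat pps.
  move=> u uF; rewrite mem_cat; apply/orP; right; apply/mapP; exists u => //.
  by apply/flatten_mapP; exists p.
move=> x; have [p pps px] := cov x; have [_ _ /(_ _ px)] := FP p.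
case=> [->|[s sF sx]]; first by left; rewrite mem_cat pps.
by right; exists s => //; apply/flatten_mapP; exists p.
Qed.

Lemma metric_graph_has_model : metric_graph X -> inhabited (model X).
Proof.
move=> /finite_segments[V [l [gl cl]]].
have [l1 [c1 e1]] : exists l1 : seq seg, (forall u, u \in l1 -> clean V u) /\
    forall x, x \in V \/ exists2 u, u \in l1 & inter u x.
  have : forall s, exists l' : seq seg, s \in l ->
      (forall u, u \in l' -> clean V u) /\
      forall x, inter s x -> x \in V \/ exists2 u, u \in l' & inter u x.
    move=> s; have [sl|sl] := boolP (s \in l); last by exists [::].
    by have [l' ?] := split_segment (gl _ sl) (leqnn _); exists l'.
  move=> /choice[f fP]; exists (flatten [seq f s | s <- l]); split.
    by move=> u /flatten_mapP[s /fP[+ _]]; apply.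
  move=> x; have [|[s sl sx]] := cl x; first by left.
  have [_ /(_ _ sx)[|[u uf ux]]] := fP _ sl; first by left.
  by right; exists u => //; apply/flatten_mapP; exists s.
have [L [uL cL dis cov]] := dedupe c1.
pose W := undup V.
have WV x : (x \in W) = (x \in V) by rewrite mem_undup.
pose E (e : 'I_(size L)) : seg := tnth (in_tuple L) e.
have EL e : E e \in L by exact: mem_tnth.
pose vt (v : 'I_(size W)) : X := tnth (in_tuple W) v.
have ix x : x \in V -> exists v, vt v = x.
  rewrite -WV => xW; have := xW; rewrite -index_mem => h.
  by exists (Ordinal h); rewrite /vt (tnth_nth x) nth_index.
have [sr srP] : exists sr : 'I_(size L) -> 'I_(size W),
    forall e, vt (sr e) = (E e).2 0.
  have : forall e, exists v, vt v = (E e).2 0.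
    by move=> e; apply: ix; have [[]] := cL _ (EL e).
  by move=> /choice[f fP]; exists f.
have [tg tgP] : exists tg : 'I_(size L) -> 'I_(size W),
    forall e, vt (tg e) = (E e).2 (E e).1.
  have : forall e, exists v, vt v = (E e).2 (E e).1.
    by move=> e; apply: ix; have [[]] := cL _ (EL e).
  by move=> /choice[f fP]; exists f.
constructor; apply: (@Model X (size W) (size L) vt sr tg
  (fun e => (E e).1) (fun e => (E e).2)) => //.
- by apply/(tuple_uniqP (in_tuple W)); exact: undup_uniq.
- by move=> e; have [[]] := cL _ (EL e).
- move=> e t tI; have [[_ _ _ iso _] _] := cL _ (EL e).
  by exists 1 => // a b aI bI _ _; exact: iso.
- move=> e t v tI eqv; have [_ +] := cL _ (EL e); apply.
    by rewrite -WV; exact: (mem_tnth v (in_tuple W)).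
  by exists t; split.
- move=> e e' t t' tI tI' eqt.
  have eE : E e = E e'.
    by apply: (dis _ _ ((E e).2 t)) => //; [exists t|exists t'].
  have ee' : e = e' by apply: (tuple_uniqP (in_tuple L) uL).
  split=> //; rewrite -ee' in tI' eqt.
  by have [g _] := cL _ (EL e); apply: (seg_inj g); rewrite ?eqt //; lra.
move=> p; have [pV|[u ul up]] := e1 p.
  by left; have [v <-] := ix _ pV; exists v.
right; have [w wL [t [tI pE]]] := cov _ _ ul up.
have := wL; rewrite -index_mem => h; exists (Ordinal h), t.
by have -> : E (Ordinal h) = w by rewrite /E (tnth_nth w) /= nth_index.
Qed.

End ModelExists.

Section Jacobian.
Context {X : metricType R} (G : model X).

Local Notation chain := 'rV[R]_(nedge G).

Definition boundary_mx : 'M[R]_(nedge G, nvert G) :=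
  \matrix_(e, v) ((v == tgt e)%:R - (v == src e)%:R).

Definition genus : nat := \rank (kermx boundary_mx).

Definition cycle_chain : {pred chain} := fun x => x *m boundary_mx == 0.

Lemma cycle_submod : submod_closed cycle_chain.
Proof.
split=> [|a x y]; first by rewrite unfold_in mul0mx.
rewrite !unfold_in => /eqP x0 /eqP y0.
by rewrite mulmxDl -scalemxAl x0 y0 scaler0 addr0.
Qed.

HB.instance Definition _ :=
  GRing.isSubmodClosed.Build R chain cycle_chain cycle_submod.

Record H1 := MkH1 { h1val :> chain; h1valP : h1val \in cycle_chain }.

HB.instance Definition _ := [isSub for h1val].
HB.instance Definition _ := [Choice of H1 by <:].
HB.instance Definition _ := [SubChoice_isSubLmodule of H1 by <:].
HB.instance Definition _ := Topological.copy H1 (initial_topology h1val).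

Definition H1Z : {pred H1} := fun z => (z : chain) \is a mxOver Num.int.

Lemma H1Z_zmod : zmod_closed H1Z.
Proof.
split=> [|x y /mxOverP xZ /mxOverP yZ]; apply/mxOverP => i j.
  by rewrite mxE rpred0.
by rewrite !mxE rpredB.
Qed.

HB.instance Definition _ := GRing.isZmodClosed.Build H1 H1Z H1Z_zmod.

Definition Jac : Type := quotient_topology (Quotient.quot H1Z).
HB.instance Definition _ := Topological.on Jac.
HB.instance Definition _ := GRing.Zmodule.copy Jac (Quotient.quot H1Z).

Definition pi_Jac (h : H1) : Jac := (\pi_(Quotient.quot H1Z) h)%qT.

(* Consecutive oriented segments from x to y; (e, a, b) runs along the edge e
   from par e a to par e b, backwards if b < a. *)
Fixpoint edge_path (x : X) (s : seq ('I_(nedge G) * R * R)) (y : X) : Prop :=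
  if s is (e, a, b) :: s' then
    [/\ 0 <= a <= len e, 0 <= b <= len e, par e a = x
      & edge_path (par e b) s' y]
  else x = y.

(* Inner products of 1-chains.  A whole edge e has squared norm [len e], and
   the segment (e, a, b) has inner product b - a with e, since it is orthogonal
   to the rest of e. *)
Definition chain_dot (x y : chain) : R := \sum_e len e * x 0 e * y 0 e.

Definition path_dot (s : seq ('I_(nedge G) * R * R)) (y : chain) : R :=
  \sum_(u <- s) (u.2 - u.1.2) * y 0 u.1.1.

Definition is_projection (s : seq ('I_(nedge G) * R * R)) (h : H1) : Prop :=
  forall z : H1, chain_dot h z = path_dot s z.

(* The chosen lift is unique up to H1Z, by the choice of the path. *)
Definition AJ_point (q p : X) : Jac :=
  pi_Jac (xget 0 [set h | exists2 s, edge_path q s p & is_projection s h]).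

Definition AJ_div (q : X) (D : {freeg X}) : Jac :=
  \sum_(p <- dom D) AJ_point q p *~ coeff p D.

(* AJ_div is constant on linear equivalence classes, so the choice of the
   representative is immaterial. *)
Definition AJ (q : X) (d : nat) (C : @Pic X d) : Jac :=
  AJ_div q (xget 0 [set D | deg D = d%:Z /\ val C = lin_class D]).

(* Pic^d with the topology transported from Jac along the bijection AJ. *)
Definition PicTop (q : X) (d : nat) : Type := initial_topology (@AJ q d).
HB.instance Definition _ q d := Topological.on (PicTop q d).

Definition S_map (q : X) (d : nat) (D : @EffDiv X d) : PicTop q d :=
  div_class (val D).

Definition Wd (q : X) (d : nat) : set (PicTop q d) := range (@S_map q d).

Definition convex_hull (k : nat) (v : 'I_k -> H1) : set H1 :=
  [set x | exists a : 'I_k -> R,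
     [/\ forall i, 0 <= a i, \sum_i a i = 1 & x = \sum_i a i *: v i]].

Definition affine_dim (k : nat) (v : 'I_k.+1 -> H1) : nat :=
  \rank (\matrix_(i < k.+1) (v i - v ord0 : chain)).

Definition polytope (d : nat) (P : set H1) : Prop :=
  exists k (v : 'I_k.+1 -> H1), P = convex_hull v /\ affine_dim v = d.

Definition purely_polyhedral (d : nat) (A : set Jac) : Prop :=
  exists N (P : 'I_N -> set H1),
    (forall j, polytope d (P j)) /\ A = \bigcup_j (pi_Jac @` P j).

End Jacobian.
End MetricGraph.

Arguments AJ {R X} G q d C.
Arguments PicTop {R X} G q d.
Arguments S_map {R X} G q d D.
Arguments Wd {R X} G q d.

(* Main.v *)
(* Call an effective divisor of degree d semibreak if it has one chip on each of
   d distinct closed edges whose removal leaves the graph connected, and generic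
   if moreover the chips lie in the interiors of these edges.

   Every effective class of degree d <= g contains a semibreak divisor.  By
   induction on d one adds a chip on an edge f to a semibreak divisor.  If f
   separates the rest of the graph, fire the side without a distinguished
   non-bridge: all chips on the cut move simultaneously towards the other side
   until one of them reaches a vertex there; moving it to another edge at that
   vertex reconnects the graph or shrinks the side of the non-bridge.  The move
   does not change the Abel-Jacobi image, because the displaced chain is a
   coboundary, hence orthogonal to all cycles.

   A generic divisor is alone in its linear system: if D' = D + div(phi) is
   effective, all slopes of phi vanish at the vertices where phi is maximal, and
   phi can only drop along edges carrying a chip of D, whose removal does not
   disconnect the graph; so phi is constant.  Thus generic classes have rank 0
   and a unique effective representative.

   Since the Abel-Jacobi map is well defined and injective on classes, and X^d is
   compact and Jac Hausdorff, the complement of the generic classes in W_d is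
   closed (the image of a compact set) and S^(d) is a closed map, which gives
   openness and the homeomorphism; pushing the chips of a semibreak divisor into
   the interiors of their edges gives density.  Finally W_d is the union of the
   images of the cubes of semibreak divisors, and these have dimension d since
   the projections to H_1 of edges with connected complement are independent. *)

From HB Require Import structures.
Require Import Defs.
From mathcomp Require Import all_boot all_order all_algebra.
From mathcomp Require Import all_classical all_reals all_analysis.
From mathcomp Require Import lra perm.
From mathcomp.multinomials Require Import freeg.
Set Implicit Arguments.
Unset Strict Implicit.
Unset Printing Implicit Defensive.
Import Order.TTheory GRing.Theory Num.Theory.
Import numFieldNormedType.Exports.
Local Open Scope classical_set_scope.
Local Open Scope ring_scope.

(** * Stars and germs of edges *)

Section Germs.
Context {R : realType} {X : metricType R}.

(** A model controls distances only along its edges. So, unlike in [star_chart], nothing is asked of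
    the distance between points of different rays, except that distinct rays differ at equal
    positive parameters. *)
Definition germs (T : finType) (p : X) (g : T -> R -> X) (r : R) : Prop :=
  [/\ 0 < r, forall i, g i 0 = p,
      forall i s s', 0 <= s < r -> 0 <= s' < r ->
        mdist (g i s) (g i s') = `|s - s'|,
      forall i j s, 0 < s < r -> g i s = g j s -> i = j
    & nbhs p [set x | x = p \/ exists i s, 0 <= s < r /\ x = g i s]].

Lemma star_chart_germs (p : X) n r (c : 'I_n -> R -> X) :
  star_chart p r c -> germs p c r.
Proof.
case=> r0 c0 iso nb; split=> // [k s s' hs hs'|k l s hs].
  by rewrite iso // eqxx.
have hs' : 0 <= s < r by lra.
move=> e; have [//|/negPf kl] := eqVneq k l.
by exfalso; have := iso k l s s hs' hs'; rewrite e mdistxx kl; lra.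
Qed.

Lemma germs_dist (T : finType) (p : X) (g : T -> R -> X) r i s :
  germs p g r -> 0 <= s < r -> mdist p (g i s) = s.
Proof.
by case=> r0 g0 iso _ _ hs; rewrite -(g0 i) iso ?sub0r ?normrN ?ger0_norm //; lra.
Qed.

Lemma germs_le (T : finType) (p : X) (g : T -> R -> X) r r' :
  germs p g r -> 0 < r' -> r' <= r -> germs p g r'.
Proof.
move=> G r'0 r'r; have [r0 g0 iso sep nb] := G; split=> //.
- by move=> *; apply: iso; lra.
- by move=> i j s hs; apply: sep; lra.
near=> x.
have : mdist p x < r'.
  near: x; apply/nbhs_ballP; exists r' => //= x.
  by rewrite ballEmdist.
have : x = p \/ exists i s, 0 <= s < r /\ x = g i s by near: x.
case=> [->|[i [s [hs ->]]]]; first by left.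
by rewrite (germs_dist _ G hs) => sr; right; exists i, s; split=> //; lra.
Unshelve. all: by end_near. Qed.

(* The distances within a star determine on which ray a point lies, so the
   rays of a star are determined up to a permutation near the centre. *)
Lemma germs_star (T : finType) (p : X) (g : T -> R -> X) r n r' c :
  germs p g r -> @star_chart _ X p n r' c ->
  exists (f : T -> 'I_n) (e : R),
    [/\ bijective f, 0 < e, e <= r, e <= r'
      & forall i s, 0 <= s < e -> g i s = c (f i) s].
Proof.
move=> G C; have C' := star_chart_germs C.
have [r0 g0 iso sep nbg] := G; have [r'0 c0 isoc sepc nbc] := C'.
have isoC : forall k l s t, 0 <= s < r' -> 0 <= t < r' ->
    mdist (c k s) (c l t) = if k == l then `|s - t| else s + t by case: C.
have [e1 e10 [sub1 sub2]] : exists2 e1 : R, 0 < e1 &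
    (forall x, mdist p x < e1 -> x = p \/ exists i s, 0 <= s < r /\ x = g i s) /\
    (forall x, mdist p x < e1 -> x = p \/ exists k s, 0 <= s < r' /\ x = c k s).
  have /nbhs_ballP[e1 /= e10] := nbg; have /nbhs_ballP[e2 /= e20] := nbc.
  rewrite !ballEmdist => s2 s1; exists (Num.min e1 e2); first by rewrite lt_min e10.
  by split=> x; rewrite lt_min => /andP[? ?]; [exact: s1|exact: s2].
pose e := Num.min e1 (Num.min r r').
have e0 : 0 < e by rewrite !lt_min e10 r0.
have ee1 : e <= e1 by rewrite ge_min lexx.
have er : e <= r by rewrite !ge_min lexx orbT.
have er' : e <= r' by rewrite !ge_min lexx !orbT.
have on_c i s : 0 < s < e -> exists k, g i s = c k s.
  move=> hs; have d : mdist p (g i s) = s by apply: (germs_dist _ G); lra.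
  have [|gp|[k [t [ht gt]]]] := sub2 (g i s); first by rewrite d; lra.
    by move: d; rewrite gp mdistxx; lra.
  exists k; rewrite gt; congr c.
  by rewrite -d gt (germs_dist _ C').
have on_g k s : 0 < s < e -> exists i, c k s = g i s.
  move=> hs; have d : mdist p (c k s) = s by apply: (germs_dist _ C'); lra.
  have [|gp|[i [t [ht gt]]]] := sub1 (c k s); first by rewrite d; lra.
    by move: d; rewrite gp mdistxx; lra.
  exists i; rewrite gt; congr g.
  by rewrite -d gt (germs_dist _ G).
have [f fP] := choice (fun i => on_c i (e / 2) ltac:(lra)).
have fE i s : 0 <= s < e -> g i s = c (f i) s.
  move=> hs; have [->|s0] := eqVneq s 0; first by rewrite g0 c0.
  have [|k gk] := on_c i s; first lra.
  (* If [g i] switched from [c (f i)] to another ray [c k], its points at [s] and [e / 2] would be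
     [s + e / 2] apart in the star, while their distance along [g i] is smaller. *)
  rewrite gk; have [<-//|/negPf kf] := eqVneq k (f i).
  have hs1 : 0 <= s < r' by lra.
  have he1 : 0 <= e / 2 < r' by lra.
  have hs2 : 0 <= s < r by lra.
  have he2 : 0 <= e / 2 < r by lra.
  have lt : `|s - e / 2| < s + e / 2 by rewrite ltr_norml; lra.
  by exfalso; have := isoC k (f i) s (e / 2) hs1 he1; rewrite kf -gk -fP iso //; lra.
exists f, e; split=> //.
have [h hP] := choice (fun k => on_g k (e / 2) ltac:(lra)).
exists h => [i|k].
  by apply: (sep _ _ (e / 2)); [lra|rewrite -hP -fE //; lra].
by apply: (sepc _ _ (e / 2)); [lra|rewrite -fE ?hP //; lra].
Qed.

(** By [germs_star] the rays of any star chart are, near [p], those of [g] up to a bijection, and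
    the sum of slopes is invariant under reindexing. Slopes can thus be read on the edges of a
    model. *)
Lemma slope_sum_germs (T : finType) (p : X) (g : T -> R -> X) r phi a :
  germs p g r -> (exists n r (c : 'I_n -> R -> X), star_chart p r c) ->
  slope_sum phi p a <->
  exists (m : T -> int) (e : R), [/\ 0 < e,
    forall i s, 0 <= s < e -> phi (g i s) = phi p + (m i)%:~R * s
    & a = - \sum_i m i].
Proof.
move=> G ex; split=> [[n [r' [c [m [C phiE ->]]]]]|[m [e1 [e10 phiE ->]]]].
  have [f [e [bf e0 er er' fE]]] := germs_star G C.
  exists (m \o f), e; split=> // [i s hs|].
    by rewrite fE // phiE //; lra.
  by congr (- _); rewrite (reindex f) //=; exact: onW_bij.
case: ex => n [r' [c C]].
have [f [e [bf e0 er er' fE]]] := germs_star G C.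
have [h fK hK] := bf.
pose e2 := Num.min e e1.
have e20 : 0 < e2 by rewrite lt_min e0.
have e2e : e2 <= e by rewrite ge_min lexx.
have e2e1 : e2 <= e1 by rewrite ge_min lexx orbT.
exists n, e2, c, (m \o h); split=> [|k t ht|].
- case: C (star_chart_germs C) => r'0 c0 iso nb C'; split=> //.
    by move=> *; apply: iso; lra.
  by have [] := germs_le C' e20 ltac:(lra).
- by have := phiE (h k) t; rewrite fE ?hK //= => [->//|]; lra.
- by congr (- _); rewrite (reindex h) //=; apply: onW_bij; exists f.
Qed.

Lemma slope_sum_continuous phi (p : X) a :
  slope_sum phi p a -> {for p, continuous phi}.
Proof.
move=> [n [r [c [m [C phiE _]]]]]; have G := star_chart_germs C.
have [r0 c0 iso sep nb] := G.
(* A Lipschitz constant at [p]; the summand 1 keeps it positive when all slopes vanish. *)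
pose M : R := 1 + \sum_k `|m k|%:~R.
have M0 : 0 < M.
  by rewrite ltr_pwDl // sumr_ge0 // => k _; rewrite ler0z.
have mM k : `|(m k)%:~R : R| <= M.
  rewrite /M (bigD1 k) //= intr_norm -[leLHS]add0r lerD ?ler01 //.
  by rewrite lerDl sumr_ge0 // => l _; rewrite ler0z.
apply/cvg_ballP => e e0; near=> x.
have d : mdist p x < e / M.
  near: x; apply/nbhs_ballP; exists (e / M); first by rewrite /= divr_gt0.
  by move=> x; rewrite ballEmdist.
have : x = p \/ exists k s, 0 <= s < r /\ x = c k s by near: x.
case=> [->|[k [s [hs xE]]]]; first exact: ballxx.
rewrite /ball /= xE phiE // opprD addrA subrr add0r normrN normrM.
have [s0 sr] := andP hs.
rewrite (ger0_norm s0); move: d; rewrite xE (germs_dist _ G) //.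
rewrite ltr_pdivlMr // mulrC; apply: le_lt_trans.
by apply: ler_wpM2r.
Unshelve. all: by end_near. Qed.

End Germs.

(** * Neighbourhoods and connectedness in a model *)

Section ModelTopology.
Context {R : realType} {X : metricType R} (G : model X).
Local Notation E := 'I_(nedge G).
Local Notation V := 'I_(nvert G).
Implicit Types (e : E) (v w : V) (t s : R).

Lemma par_continuous e : {within `[0, len e], continuous (par e)}.
Proof.
apply/subspace_continuousP => t; rewrite /= in_itv /= => tI.
have [d d0 iso] := par_isometry tI.
apply/cvg_ballP => r r0; rewrite near_withinE.
apply/nbhs_ballP; exists (Num.min d r); first by rewrite /= lt_min d0.
move=> s ts; rewrite /= in_itv /= => sI.
have /andP[sd sr] : (`|t - s| < d) && (`|t - s| < r) by rewrite -lt_min.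
by rewrite ballEmdist /= iso ?subrr ?normr0 // distrC.
Qed.

Lemma compact_par e (K : set R) :
  compact K -> K `<=` `[0, len e] -> compact (par e @` K).
Proof.
move=> cK sK; apply: continuous_compact => //.
by apply: continuous_subspaceW (@par_continuous e).
Qed.

Lemma closed_par e a b : 0 <= a -> b <= len e ->
  closed [set x | exists t, a <= t <= b /\ x = par e t].
Proof.
move=> a0 bl.
have -> : [set x | exists t, a <= t <= b /\ x = par e t] = par e @` `[a, b].
  apply/seteqP; split=> x /=.
    by case=> t [tI ->]; exists t => //; rewrite in_itv.
  by case=> t; rewrite in_itv /= => tI <-; exists t.
apply: compact_closed; first exact: metric_hausdorff.
apply: compact_par; first exact: segment_compact.
by move=> t; rewrite /= !in_itv /=; lra.
Qed.

Lemma near_notin_par (p : X) e a b : 0 <= a -> b <= len e ->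
  (forall t, a <= t <= b -> p <> par e t) ->
  \forall x \near p, forall t, a <= t <= b -> x <> par e t.
Proof.
move=> a0 bl np.
have : nbhs p (~` [set x | exists t, a <= t <= b /\ x = par e t]).
  apply: open_nbhs_nbhs; split; first exact: closed_openC (closed_par a0 bl).
  by case=> t [tI /np]; apply.
by apply: filterS => x nx t tI xE; apply: nx; exists t.
Qed.

Lemma near_neq (p q : X) : p <> q -> \forall x \near p, x <> q.
Proof.
move=> pq; apply: (@open_nbhs_nbhs _ p (~` [set q])); split=> //.
apply: closed_openC; apply: accessible_closed_set1; apply: hausdorff_accessible.
exact: metric_hausdorff.
Qed.

(** A pair in [E * bool] is a half-edge, [true] marking the end at the source; a loop has two
    half-edges at its vertex. The corresponding [ray] runs inward from that end. *)
Definition base (x : E * bool) : V := if x.2 then src x.1 else tgt x.1.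

Definition ray (x : E * bool) (s : R) : X :=
  if x.2 then par x.1 s else par x.1 (len x.1 - s).

Lemma ray0 x : ray x 0 = vert (base x).
Proof. by case: x => e []; rewrite /ray /base /= ?subr0 ?par_src ?par_tgt. Qed.

Lemma ray_isometry x : exists2 r, 0 < r & r <= len x.1 /\
  forall s s', 0 <= s < r -> 0 <= s' < r -> mdist (ray x s) (ray x s') = `|s - s'|.
Proof.
case: x => e b /=; have l0 := len_gt0 e.
have [|d d0 iso] := @par_isometry _ _ G e (if b then 0 else len e).
  by case: b; lra.
exists (Num.min d (len e)); first by rewrite lt_min d0.
split; first by rewrite ge_min lexx orbT.
move=> s s'; rewrite !lt_min => hs hs'; rewrite /ray /=.
case: b iso => iso; rewrite iso; rewrite ?ltr_norml; try lra.
rewrite -[LHS]normrN; congr (`|_|); lra.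
Qed.

Lemma ray_inj x y s : 0 < s -> s < len x.1 / 2 -> s < len y.1 / 2 ->
  ray x s = ray y s -> x = y.
Proof.
case: x y => [e b] [e' b'] /= s0 h h'; rewrite /ray /=.
case: b b' => [] [] /par_inj H.
- by have [||-> _] := H _ _; [lra|lra|].
- by have [||? ?] := H _ _; [lra|lra|subst e'; exfalso; lra].
- by have [||? ?] := H _ _; [lra|lra|subst e'; exfalso; lra].
- by have [||-> _] := H _ _; [lra|lra|].
Qed.

Lemma min_len (I : finType) (f : I -> R) : (forall i, 0 < f i) ->
  exists2 r, 0 < r & forall i, r <= f i.
Proof.
move=> f0; exists (\big[Num.min/1]_i f i).
  by elim/big_ind: _ => // x y x0 y0; rewrite lt_min x0.
by move=> i; exact: bigmin_le_cond.
Qed.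

(** A neighbourhood of [vert v] avoids finitely many closed sets: the other vertices ([n1]), the
    middle parts of edges ([n2]) and the end parts at other vertices ([n3], [n4]). What remains lies
    on the rays at [v]. *)
Lemma vert_germs v : exists r,
  (forall e, r <= len e / 2) /\
  germs (vert v) (fun (x : {x | base x == v}) => ray (val x)) r.
Proof.
have [r1 r10 r1P] : exists2 r, 0 < r & forall x, r <= len x.1 /\
    forall s s', 0 <= s < r -> 0 <= s' < r -> mdist (ray x s) (ray x s') = `|s - s'|.
  have [f fP] := choice (fun x => let: ex_intro2 r a b := @ray_isometry x in
    ex_intro _ r (conj a b)).
  have [r r0 rP] := min_len (fun x => (fP x).1).
  exists r => // x; have [_ [fl iso]] := fP x; split; first exact: le_trans fl.
  by move=> s s' hs hs'; have rx := rP x; apply: iso; lra.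
have [r2 r20 r2P] := min_len (fun e : E => divr_gt0 (len_gt0 e) (ltr0Sn R 1)).
pose r := Num.min r1 r2; exists r.
have r0 : 0 < r by rewrite lt_min r10.
have rr1 : r <= r1 by rewrite ge_min lexx.
have rr2 : r <= r2 by rewrite ge_min lexx orbT.
split=> [e|]; first exact: le_trans (r2P e).
split=> // [[x /= /eqP<-]|[x xv] s s' /= hs hs'|x y s hs /ray_inj e|].
- exact: ray0.
- by have [_ ] := r1P x; apply; lra.
- by apply: val_inj; apply: e; have := r2P (val x).1; have := r2P (val y).1; lra.
have n1 : \forall x \near vert v, forall w, w != v -> x <> vert w.
  apply: filter_forall => w; have [wv|wv] := eqVneq w v.
    by apply: nearW.
  have /near_neq : vert v <> vert w by move=> /vert_inj e; rewrite e eqxx in wv.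
  by apply: filterS => x.
have n2 : \forall x \near vert v, forall e t, r / 2 <= t <= len e - r / 2 -> x <> par e t.
  apply: filter_forall => e; apply: near_notin_par; [lra|have := r2P e; lra|].
  by move=> t tI eq; apply: (@par_vert _ _ G e t v) => //; lra.
have n3 : \forall x \near vert v, forall e, src e != v ->
    forall t, 0 <= t <= r / 2 -> x <> par e t.
  apply: filter_forall => e; have [ev|ev] := eqVneq (src e) v.
    by apply: nearW.
  have re := r2P e.
  have := @near_notin_par (vert v) e 0 (r / 2).
  move=> sub; apply: filterS (sub _ _ _); [by move=> x h _|lra|lra|].
  move=> t tI eq; have [t0|t0] := eqVneq t 0.
    by move: eq; rewrite t0 par_src => /vert_inj e0; rewrite e0 eqxx in ev.
  by apply: (@par_vert _ _ G e t v) => //; move/eqP: t0; lra.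
have n4 : \forall x \near vert v, forall e, tgt e != v ->
    forall t, len e - r / 2 <= t <= len e -> x <> par e t.
  apply: filter_forall => e; have [ev|ev] := eqVneq (tgt e) v.
    by apply: nearW.
  have re := r2P e.
  have := @near_notin_par (vert v) e (len e - r / 2) (len e).
  move=> sub; apply: filterS (sub _ _ _); [by move=> x h _|lra|lra|].
  move=> t tI eq; have [t0|t0] := eqVneq t (len e).
    by move: eq; rewrite t0 par_tgt => /vert_inj e0; rewrite e0 eqxx in ev.
  by apply: (@par_vert _ _ G e t v) => //; move/eqP: t0; lra.
near=> x.
have m1 : forall w, w != v -> x <> vert w by near: x.
have m2 : forall e t, r / 2 <= t <= len e - r / 2 -> x <> par e t by near: x.
have m3 : forall e, src e != v -> forall t, 0 <= t <= r / 2 -> x <> par e t by near: x.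
have m4 : forall e, tgt e != v -> forall t, len e - r / 2 <= t <= len e -> x <> par e t by near: x.
have [[w xw]|[e [t [tI xE]]]] := model_cover G x.
  by left; rewrite xw; have [->//|/m1/(_ xw)] := eqVneq w v.
right; have re := r2P e.
have [tr|tr] := lerP t (r / 2).
  have sv : src e == v by apply/negP => /negP /m3 /(_ t _ xE); apply; lra.
  by exists (Sub (e, true) sv), t; rewrite /=; split; [lra|].
have [lr|lr] := lerP t (len e - r / 2).
  by case: (m2 e t _ xE); rewrite lr ltW.
have sv : tgt e == v by apply/negP => /negP /m4 /(_ t _ xE); apply; lra.
exists (Sub (e, false) sv), (len e - t); rewrite /ray /=; split; first lra.
by rewrite subKr.
Unshelve. all: by end_near. Qed.

Lemma edge_germs e t : 0 < t < len e -> exists r, [/\ r <= t, r <= len e - t &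
  germs (par e t) (fun (b : bool) s => par e (if b then t + s else t - s)) r].
Proof.
move=> tI; have [|d d0 iso] := @par_isometry _ _ G e t; first lra.
pose r := Num.min d (Num.min t (len e - t)).
have r0 : 0 < r by rewrite !lt_min d0; lra.
have rd : r <= d by rewrite ge_min lexx.
have rt : r <= t by rewrite !ge_min lexx orbT.
have rl : r <= len e - t by rewrite !ge_min lexx !orbT.
exists r; split=> //; split=> // [b|b s s' hs hs'|b c s hs|].
- by case: b; rewrite ?addr0 ?subr0.
- rewrite iso; case: b; rewrite ?ltr_norml; try lra.
    by congr (`|_|); lra.
  by rewrite -[RHS]normrN; congr (`|_|); lra.
- have [//|bc] := eqVneq b c.
  by case: b c bc => [] [] // _ /par_inj[]; try lra; move=> _; lra.
have n1 : \forall x \near par e t, forall w, x <> vert w.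
  apply: filter_forall => w.
  by apply: near_neq; exact: par_vert.
have n2 : \forall x \near par e t, forall e', e' != e ->
    forall s, 0 <= s <= len e' -> x <> par e' s.
  apply: filter_forall => e'; have [ee|ee] := eqVneq e' e.
    by apply: nearW.
  have := @near_notin_par (par e t) e' 0 (len e').
  move=> sub; apply: filterS (sub _ _ _); [by move=> x h _|lra|lra|].
  move=> s sI eq; have [s0|s0] := eqVneq s 0.
    by move: eq; rewrite s0 par_src; exact: par_vert.
  have [s1|s1] := eqVneq s (len e').
    by move: eq; rewrite s1 par_tgt; exact: par_vert.
  have [|e0 _] := par_inj tI _ eq; first by move/eqP: s0; move/eqP: s1; lra.
  by rewrite e0 eqxx in ee.
have n3 : \forall x \near par e t, forall s, 0 <= s <= t - r / 2 -> x <> par e s.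
  apply: near_notin_par; [lra|lra|] => s sI eq.
  have [s0|s0] := eqVneq s 0.
    by move: eq; rewrite s0 par_src; exact: par_vert.
  by have [|_ ?] := par_inj tI _ eq; move/eqP: s0; lra.
have n4 : \forall x \near par e t, forall s, t + r / 2 <= s <= len e -> x <> par e s.
  apply: near_notin_par; [lra|lra|] => s sI eq.
  have [s0|s0] := eqVneq s (len e).
    by move: eq; rewrite s0 par_tgt; exact: par_vert.
  by have [|_ ?] := par_inj tI _ eq; move/eqP: s0; lra.
near=> x.
have m1 : forall w, x <> vert w by near: x.
have m2 : forall e', e' != e -> forall s, 0 <= s <= len e' -> x <> par e' s by near: x.
have m3 : forall s, 0 <= s <= t - r / 2 -> x <> par e s by near: x.
have m4 : forall s, t + r / 2 <= s <= len e -> x <> par e s by near: x.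
have [[w /m1//]|[e' [s [sI xE]]]] := model_cover G x; right.
have [ee|/m2/(_ s _ xE)] := eqVneq e' e; last by case; lra.
subst e'.
have s1 : t - r / 2 < s by rewrite ltNge; apply/negP => h; apply: (m3 s) => //; lra.
have s2 : s < t + r / 2 by rewrite ltNge; apply/negP => h; apply: (m4 s) => //; lra.
have [st|ts] := lerP t s.
  by exists true, (s - t); split; [lra|rewrite addrC subrK].
by exists false, (t - s); split; [lra|rewrite subKr].
Unshelve. all: by end_near. Qed.

Lemma open_edge_interior e : open [set x | exists t, 0 < t < len e /\ x = par e t].
Proof.
rewrite openE => x [t [tI ->]]; have [r [rt rl [r0 _ _ _ nb]]] := edge_germs tI.
apply: filterS nb => y [->|[b [s [sI ->]]]]; first by exists t.
by exists (if b then t + s else t - s); split=> //; case: b; lra.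
Qed.

(** [Y B] collects the vertices of [B] and the closed edges starting in [B]. When no edge leaves
    [B], its complement is [Y (~: B)], so [Y B] is both closed and open. *)
Lemma model_connected : connected [set: X] -> forall B : {set V},
  (forall e, (src e \in B) = (tgt e \in B)) -> B = finset.set0 \/ B = [set: V]%SET.
Proof.
move=> cX B0 cl0.
pose Y (B : {set V}) : set X := [set x | (exists2 v, v \in B & x = vert v) \/
   exists2 e, src e \in B & exists t, 0 <= t <= len e /\ x = par e t].
have clY (B : {set V}) : closed (Y B).
  have -> : Y B = (\bigcup_(v in [set` B]) [set vert v]) `|`
      \bigcup_(e in [set` [set e | src e \in B]%SET])
         [set x | exists t, 0 <= t <= len e /\ x = par e t].
    apply/seteqP; split=> x.
      case=> [[v vB ->]|[e eB xe]]; [by left; exists v|right].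
      by exists e => //=; rewrite inE.
    case=> [[v /= vB ->]|[e /= eB xe]]; [by left; exists v|right].
    by exists e => //; rewrite inE in eB.
  apply: closedU; apply: closed_bigcup => //.
    move=> v _; apply: accessible_closed_set1; apply: hausdorff_accessible.
    exact: metric_hausdorff.
  by move=> e _; apply: closed_par.
have vY (B : {set V}) v : (forall e, (src e \in B) = (tgt e \in B)) -> Y B (vert v) -> v \in B.
  move=> cl [[w wB /vert_inj->//]|[e eB [t [tI ve]]]].
  have [t0|t0] := eqVneq t 0.
    by move: ve; rewrite t0 par_src => /vert_inj ->.
  have [t1|t1] := eqVneq t (len e).
    by move: ve; rewrite t1 par_tgt => /vert_inj ->; rewrite -cl.
  exfalso; apply: (@par_vert _ _ G e t v) => //.
  by move/eqP: t0; move/eqP: t1; lra.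
have eY (B : {set V}) e t : (forall e, (src e \in B) = (tgt e \in B)) ->
    0 < t < len e -> Y B (par e t) -> src e \in B.
  move=> cl tI [[w wB]|[e' eB [s [sI xe]]]].
    by move=> h; exfalso; apply: (@par_vert _ _ G e t w).
  have [s0|s0] := eqVneq s 0.
    by exfalso; move: xe; rewrite s0 par_src; apply: par_vert.
  have [s1|s1] := eqVneq s (len e').
    by exfalso; move: xe; rewrite s1 par_tgt; apply: par_vert.
  have [|-> _ //] := par_inj tI _ xe; by move/eqP: s0; move/eqP: s1; lra.
have clC (B : {set V}) : (forall e, (src e \in B) = (tgt e \in B)) ->
    forall e, (src e \in ~: B) = (tgt e \in ~: B).
  by move=> cl e; rewrite !inE cl.
have compl : Y B0 = ~` Y (~: B0).
  apply/seteqP; split=> x.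
    have [[v ->]|[e [t [tI ->]]]] := model_cover G x.
      by move=> /(vY _ _ cl0) vB /(vY _ _ (clC _ cl0)); rewrite inE vB.
    by move=> /(eY _ _ _ cl0 tI) vB /(eY _ _ _ (clC _ cl0) tI); rewrite inE vB.
  have [[v ->]|[e [t [tI ->]]]] := model_cover G x => nY.
    left; exists v => //; rewrite -[_ \in _]negbK; apply/negP => h.
    by apply: nY; left; exists v => //; rewrite inE.
  right; exists e; last by exists t; split=> //; lra.
  rewrite -[_ \in _]negbK; apply/negP => h.
  apply: nY; right; exists e; first by rewrite inE.
  by exists t; split=> //; lra.
have [->|/set0Pn[v vB]] := eqVneq B0 finset.set0; [by left|right].
have YT : Y B0 = [set: X].
  apply: cX.
  - by exists (vert v); left; exists v.
  - by exists (Y B0); rewrite ?setTI // compl; exact/closed_openC.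
  - by exists (Y B0); rewrite ?setTI.
apply/setP => w; rewrite inE; apply: (vY _ _ cl0).
by rewrite YT.
Qed.

End ModelTopology.

(** * Sums over divisors and piecewise affine functions *)

Section FreegSum.
Context {K : choiceType} {M : zmodType}.
Implicit Types (f g : K -> M) (D : {freeg K}).

Definition fsum f D : M := \sum_(p <- dom D) f p *~ coeff p D.

Lemma fsum_widen f D (s : seq K) : uniq s -> {subset dom D <= s} ->
  fsum f D = \sum_(p <- s) f p *~ coeff p D.
Proof.
move=> us sub; rewrite (bigID (fun p => p \in dom D)) /=.
rewrite [X in _ = _ + X]big1 ?addr0 => [|p np]; last by rewrite coeff_outdom ?mulr0z.
rewrite -big_filter; apply: perm_big; apply: uniq_perm; rewrite ?filter_uniq ?uniq_dom //.
by move=> p; rewrite mem_filter; case: (boolP (p \in dom D)) => // /sub ->.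
Qed.

Lemma fsumD f D1 D2 : fsum f (D1 + D2) = fsum f D1 + fsum f D2.
Proof.
pose s := undup (dom D1 ++ dom D2).
rewrite !(@fsum_widen f _ s) ?undup_uniq //; first last.
- by move=> p /domD_subset; rewrite mem_undup.
- by move=> p pD; rewrite mem_undup mem_cat pD.
- by move=> p pD; rewrite mem_undup mem_cat pD orbT.
by rewrite -big_split; apply: eq_bigr => p _; rewrite coeffD mulrzDr.
Qed.

Lemma fsum0 f : fsum f 0 = 0.
Proof. by apply: (@addrI _ (fsum f 0)); rewrite -fsumD !addr0. Qed.

Lemma fsumN f D : fsum f (- D) = - fsum f D.
Proof. by apply: (@addrI _ (fsum f D)); rewrite -fsumD !subrr fsum0. Qed.

Lemma fsumB f D1 D2 : fsum f (D1 - D2) = fsum f D1 - fsum f D2.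
Proof. by rewrite fsumD fsumN. Qed.

Lemma fsumU f p : fsum f << p >> = f p.
Proof. by rewrite /fsum domU1 big_seq1 coeffU eqxx mulr1. Qed.

Lemma fsum_bigU f (I : finType) (P : pred I) (x : I -> K) :
  fsum f (\sum_(i | P i) << x i >>) = \sum_(i | P i) f (x i).
Proof.
by elim/big_rec2: _ => [|i a D _ <-]; rewrite ?fsum0 // fsumD fsumU.
Qed.

Lemma eq_fsum f g D : (forall p, p \in dom D -> f p = g p) -> fsum f D = fsum g D.
Proof. by move=> fg; apply: eq_big_seq => p /fg ->. Qed.

Lemma fsum_split f g D : fsum (fun p => f p + g p) D = fsum f D + fsum g D.
Proof. by rewrite -big_split; apply: eq_bigr => p _; rewrite mulrzDl. Qed.

Lemma fsum_opp f D : fsum (fun p => - f p) D = - fsum f D.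
Proof. by rewrite -sumrN; apply: eq_bigr => p _; rewrite mulNrz. Qed.

Lemma fsum_big (I : finType) (P : pred I) (h : I -> K -> M) D :
  fsum (fun p => \sum_(i | P i) h i p) D = \sum_(i | P i) fsum (h i) D.
Proof. by rewrite exchange_big; apply: eq_bigr => p _; rewrite mulrz_suml. Qed.

End FreegSum.

Lemma fsum_morph {K : choiceType} {M N : zmodType} (h : {additive M -> N})
  (f : K -> M) (D : {freeg K}) : h (fsum f D) = fsum (h \o f) D.
Proof. by rewrite raddf_sum; apply: eq_bigr => p _; rewrite raddfMz. Qed.

Lemma coeff_fsum {K : choiceType} (p : K) (D : {freeg K}) :
  coeff p D = fsum (fun x => (x == p)%:R) D.
Proof.
have [pD|pD] := boolP (p \in dom D); last first.
  rewrite coeff_outdom // /fsum big1_seq // => x /andP[_ xD].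
  by case: eqVneq => [xp|]; rewrite ?mul0rz //; rewrite -xp xD in pD.
rewrite /fsum (bigD1_seq p) ?uniq_dom //= eqxx intz big1 ?addr0 // => x.
by move/negPf->; rewrite mul0rz.
Qed.

Lemma fsum_intr {K : choiceType} {S : pzRingType} (f : K -> int) (D : {freeg K}) :
  (fsum f D)%:~R = fsum (fun p => (f p)%:~R) D :> S.
Proof. by rewrite raddf_sum; apply: eq_bigr => p _; rewrite !raddfMz. Qed.

Lemma fsum_deg {K : choiceType} (D : {freeg K}) : deg D = fsum (fun=> 1) D.
Proof.
rewrite -[in LHS](freeg_sumE D) raddf_sum.
by apply: eq_bigr => p _ /=; rewrite degU intz.
Qed.

(** * From local to global affinity on an interval *)

Section PiecewiseAffine.
Context {R : realType}.

Lemma uniform_radius (T : eqType) (l : seq T) (P : T -> R -> Prop) :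
  (forall p, exists2 r, 0 < r & forall s, 0 <= s < r -> P p s) ->
  exists2 r, 0 < r & forall s, 0 <= s < r -> forall p, p \in l -> P p s.
Proof.
move=> H; elim: l => [|p l [r r0 rP]]; first by exists 1.
have [r' r'0 r'P] := H p; exists (Num.min r r'); first by rewrite lt_min r0.
move=> s; rewrite lt_min => hs q; rewrite inE => /predU1P[->|ql].
  by apply: r'P; lra.
by apply: rP ql; lra.
Qed.

(** Continuous induction: let [b] be the supremum of the points up to which the formula holds. The
    germ to the left of [b] must have slope [r0], which fixes the value at [b]; an interior germ has
    the same slope on both sides, so the formula would extend beyond any [b < L]. *)
Lemma affine_of_germs (g : R -> R) L r0 : 0 < L ->
  (exists2 e, 0 < e & forall s, 0 <= s < e -> g s = g 0 + r0 * s) ->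
  (forall t, 0 < t < L -> exists m, exists2 e, 0 < e & forall s, 0 <= s < e ->
     g (t + s) = g t + m * s /\ g (t - s) = g t - m * s) ->
  (exists m, exists2 e, 0 < e & forall s, 0 <= s < e -> g (L - s) = g L - m * s) ->
  forall t, 0 <= t <= L -> g t = g 0 + r0 * t.
Proof.
move=> L0 [e0 e00 g0] gt [mL [eL eL0 gL]].
pose B : set R := [set b | 0 <= b <= L /\ forall s, 0 <= s <= b -> g s = g 0 + r0 * s].
have hB : has_sup B.
  split; last by exists L => b [/andP[_ ]].
  exists 0; split=> [|s s0]; first by rewrite lexx ltW.
  have -> : s = 0 by lra.
  by rewrite mulr0 addr0.
pose b := sup B.
have ub x : B x -> x <= b by move=> Bx; apply: sup_upper_bound.
have b0 : 0 < b.
  pose e := Num.min (e0 / 2) L.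
  have ep : 0 < e by rewrite lt_min; lra.
  have e1 : e <= e0 / 2 by rewrite ge_min lexx.
  have e2 : e <= L by rewrite ge_min lexx orbT.
  suff /ub : B e by lra.
  split; first by rewrite (ltW ep) e2.
  move=> s /andP[s0 se]; apply: g0; rewrite s0 /=.
  by apply: le_lt_trans (le_trans se e1) _; lra.
have bL : b <= L by apply: sup_le_ub => [|x [/andP[_ ]]//]; case: hB.
have below s : 0 <= s < b -> g s = g 0 + r0 * s.
  move=> /andP[s0 sb]; have d0 : 0 < b - s by lra.
  have [c [cI cP] hc] := sup_adherent d0 hB.
  by apply: cP; rewrite s0 /=; rewrite /b in hc *; lra.
have left_b m e : 0 < e -> (forall s, 0 <= s < e -> g (b - s) = g b - m * s) ->
    m = r0 /\ g b = g 0 + r0 * b.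
  move=> ep gb; pose s := Num.min (e / 2) b.
  have s0 : 0 < s by rewrite lt_min; lra.
  have s1 : s <= e / 2 by rewrite ge_min lexx.
  have s2 : s <= b by rewrite ge_min lexx orbT.
  have bl u : 0 < u <= s -> g b - m * u = g 0 + r0 * (b - u).
    by move=> uI; rewrite -gb; [apply: below|]; lra.
  (* Comparing the two affine formulas at [s] and at [s / 2] separates the slope from the value at
     [b]. *)
  have h1 := bl s; have h2 := bl (s / 2).
  have h3 : (m - r0) * s = 0 by move: (h1 ltac:(lra)) (h2 ltac:(lra)); lra.
  have mr : m = r0.
    by apply/eqP; rewrite -subr_eq0; move/eqP: h3; rewrite mulf_eq0 (gt_eqF s0) orbF.
  by split=> //; move: (h1 ltac:(lra)); rewrite mr; lra.
have [bL'|bL'] := ltrP b L.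
  have [|m [e ep geb]] := gt b; first lra.
  have [|mr gb] := left_b m e ep; first by move=> s /geb[].
  pose c := Num.min (b + e / 2) L.
  have c1 : c <= b + e / 2 by rewrite ge_min lexx.
  have c2 : c <= L by rewrite ge_min lexx orbT.
  have c3 : b < c by rewrite lt_min; lra.
  suff : B c by move/ub; lra.
  split=> [|s hs]; first lra.
  have [sb|bs] := ltrP s b; first by apply: below; lra.
  have [|+ _] := geb (s - b); first lra.
  by rewrite [b + _]addrC subrK gb mr => ->; lra.
have bE : b = L by lra.
have [|_ gLE] := left_b mL eL eL0; first by rewrite bE.
move=> t tI; have [tb|bt] := ltrP t b; first by apply: below; lra.
have -> // : t = b by lra.
Qed.

End PiecewiseAffine.

(** * Principal divisors on the edges of a model *)

Section EdgeData.
Context {R : realType} {X : metricType R} (G : model X).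
Local Notation E := 'I_(nedge G).
Local Notation V := 'I_(nvert G).
Implicit Types (e : E) (v w : V) (t s : R) (D : {freeg X}) (p : X).

Definition inner e p : bool := `[< exists t, 0 < t < len e /\ p = par e t >].

(** The default 0 off the open edge lets [tsum] run over the whole support of a divisor. *)
Definition pos e p : R := xget 0 [set t | 0 < t < len e /\ p = par e t].

Lemma innerP e p : inner e p -> 0 < pos e p < len e /\ p = par e (pos e p).
Proof. by move=> /asboolP[t ht]; rewrite /pos; case: xgetP => [y _ //|/(_ t)[]]. Qed.

Lemma inner_par e e' t : 0 < t < len e -> inner e' (par e t) = (e' == e).
Proof.
move=> tI; apply/asboolP/eqP => [[s [sI /par_inj]]|->]; last by exists t.
by case/(_ tI sI).
Qed.

Lemma pos_par e t : 0 < t < len e -> pos e (par e t) = t.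
Proof.
move=> tI; have [|tI' /par_inj] := @innerP e (par e t); first by rewrite inner_par.
by case/(_ tI tI') => _ <-.
Qed.

Lemma pos_out e p : ~~ inner e p -> pos e p = 0.
Proof.
move=> /asboolP np; rewrite /pos; case: xgetP => // y _ hy.
by case: np; exists y.
Qed.

Lemma inner_vert e v : inner e (vert v) = false.
Proof. by apply/asboolP => -[t [tI /esym]]; exact: par_vert. Qed.

Definition nsum e D : int := fsum (fun p => (inner e p)%:R) D.

Definition tsum e D : R := fsum (pos e) D.

(** At an interior point of an edge, a function with divisor [D] loses as much slope as the
    coefficient of [D]. A [kink] gains slope 1 at [p], so adding [kinks e D] makes the function
    affine on [e]. *)
Definition kink e t p : R := if inner e p then Num.max (t - pos e p) 0 else 0.

Definition kinks e D t : R := fsum (kink e t) D.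

(* The divisor of a function with values [chi] at the vertices whose restriction
   to the edge e has initial slope [m e] and no kinks but those forced by D. *)
Definition edge_data D (chi : V -> R) (m : E -> int) : Prop :=
  (forall e, chi (tgt e) = chi (src e) + (m e - nsum e D)%:~R * len e + tsum e D) /\
  (forall v, coeff (vert v) D =
     \sum_(e | tgt e == v) (m e - nsum e D) - \sum_(e | src e == v) m e).

Lemma kinks_germ e D t : exists2 r, 0 < r & forall s, 0 <= s < r ->
  kinks e D (t + s) = kinks e D t +
    (fsum (fun p => (inner e p && (pos e p <= t))%:R) D)%:~R * s /\
  kinks e D (t - s) = kinks e D t -
    (fsum (fun p => (inner e p && (pos e p < t))%:R) D)%:~R * s.
Proof.
have [p|r r0 rP] := @uniform_radius R _ (dom D) (fun p s =>
    kink e (t + s) p = kink e t p + (inner e p && (pos e p <= t))%:R * s /\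
    kink e (t - s) p = kink e t p - (inner e p && (pos e p < t))%:R * s).
  rewrite /kink; case: (inner e p); last by exists 1 => // s _; rewrite !mul0r addr0 subr0.
  case: (ltgtP (pos e p) t) => [pt|tp|->] /=.
  - exists (t - pos e p); first lra.
    by move=> s hs; rewrite !max_l; lra.
  - exists (pos e p - t); first lra.
    by move=> s hs; rewrite !max_r; lra.
  - by exists 1 => // s hs; rewrite subrr max_l ?[Num.max (t - s - t) _]max_r ?maxxx; lra.
exists r => // s /rP H; rewrite !fsum_intr /kinks /fsum !mulr_suml -sumrN -!big_split.
split; apply: eq_big_seq => p /H[h1 h2] /=.
  by rewrite h1 mulrzDl mulrzAl; congr (_ + _ * _ *~ _); case: (_ && _).
by rewrite h2 mulrzBl mulrzAl; congr (_ - _ * _ *~ _); case: (_ && _).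
Qed.

Lemma kinks0 e D : kinks e D 0 = 0.
Proof.
rewrite /kinks /fsum big1 // => p _; rewrite /kink.
case: ifP => [/innerP[pI _]|]; last by rewrite mul0rz.
by rewrite max_r ?mul0rz //; lra.
Qed.

Lemma kinks_len e D : kinks e D (len e) = (nsum e D)%:~R * len e - tsum e D.
Proof.
rewrite /kinks /nsum /tsum fsum_intr -fsum_opp.
have -> : fsum (fun p => ((inner e p)%:R : int)%:~R) D * len e =
    fsum (fun p => ((inner e p)%:R : R) * len e) D.
  by rewrite /fsum mulr_suml; apply: eq_bigr => p _; rewrite mulrzAl; case: inner.
rewrite -fsum_split; apply: eq_fsum => p _; rewrite /kink.
case: (boolP (inner e p)) => [/innerP[pI _]|/pos_out->]; last by rewrite mul0r subr0.
by rewrite mul1r max_l; lra.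
Qed.

Lemma fsum_pos_eq e D t : 0 < t < len e ->
  fsum (fun p => (inner e p && (pos e p <= t))%:R : int) D =
  fsum (fun p => (inner e p && (pos e p < t))%:R) D + coeff (par e t) D.
Proof.
move=> tI; rewrite coeff_fsum -fsum_split; apply: eq_fsum => p _.
have [->|pt] := eqVneq p (par e t).
  by rewrite inner_par // eqxx pos_par // lexx ltxx.
case: (boolP (inner e p)) => //= ip; have [_ pE] := innerP ip.
have pn : pos e p != t by apply: contraNneq pt => <-; rewrite -pE.
by rewrite le_eqVlt (negPf pn) addr0.
Qed.

Lemma fsum_pos_le0 e D : fsum (fun p => (inner e p && (pos e p <= 0))%:R : int) D = 0.
Proof.
rewrite /fsum big1 // => p _; case: (boolP (inner e p)) => [/innerP[pI _]|_] /=.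
  by rewrite leNgt; case/andP: pI => ->; rewrite mul0rz.
by rewrite mul0rz.
Qed.

Lemma fsum_pos_lt_len e D :
  fsum (fun p => (inner e p && (pos e p < len e))%:R : int) D = nsum e D.
Proof.
apply: eq_fsum => p _; case: (boolP (inner e p)) => // /innerP[pI _] /=.
by case/andP: pI => _ ->.
Qed.

Hypothesis stars : forall p : X, exists n r (c : 'I_n -> R -> X), star_chart p r c.

Lemma sum_base v (f : E * bool -> int) : \sum_(x | base x == v) f x =
  \sum_(e | src e == v) f (e, true) + \sum_(e | tgt e == v) f (e, false).
Proof.
rewrite (bigID (fun x : E * bool => x.2)) /=; congr (_ + _).
  rewrite (reindex_onto (fun e => (e, true)) fst) /= => [|[e []] /andP[]//].
  by apply: eq_bigl => e; rewrite /base /= andbT eqxx andbT.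
rewrite (reindex_onto (fun e => (e, false)) fst) /= => [|[e []] /andP[]//].
by apply: eq_bigl => e; rewrite /base /= andbT eqxx andbT.
Qed.

Lemma slope_sum_vert phi v a : slope_sum phi (vert v) a <->
  exists (m : E * bool -> int) (r : R), [/\ 0 < r,
    forall x, base x = v -> forall s, 0 <= s < r ->
      phi (ray x s) = phi (vert v) + (m x)%:~R * s
    & a = - \sum_(x | base x == v) m x].
Proof.
have [r0 [_ germ]] := vert_germs v.
split=> [/(slope_sum_germs _ _ germ (stars _))[m [r [rp mP ->]]]|[m [r [rp mP ->]]]].
  exists (fun x => if insub x is Some y then m y else 0), r; split=> //.
    by move=> x /eqP bx s hs; rewrite (insubT (fun x => base x == v) bx) -mP.
  congr (- _); rewrite (big_sub [pred x | base x == v]) /=.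
  by apply: eq_bigr => x _; rewrite valK.
apply/(slope_sum_germs _ _ germ (stars _)).
exists (fun x => m (val x)), r; split=> // [[x xv] s hs /=|].
  by apply: mP => //; exact/eqP.
by rewrite (big_sub [pred x | base x == v]).
Qed.

Lemma slope_sum_inner phi e t a : 0 < t < len e -> slope_sum phi (par e t) a <->
  exists (l m : int) (r : R), [/\ 0 < r,
    forall s, 0 <= s < r -> phi (par e (t + s)) = phi (par e t) + m%:~R * s /\
                            phi (par e (t - s)) = phi (par e t) - l%:~R * s
    & a = l - m].
Proof.
move=> tI; have [r0 [_ _ germ]] := edge_germs tI.
split=> [/(slope_sum_germs _ _ germ (stars _))[m [r [rp mP ->]]]|[l [m [r [rp mP ->]]]]].
  exists (- m false), (m true), r; split=> // [s hs|].
    by rewrite (mP true s hs) (mP false s hs) rmorphN mulNr opprK.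
  by rewrite big_bool opprD addrC.
apply/(slope_sum_germs _ _ germ (stars _)).
exists (fun b => if b then m else - l), r; split=> // [[] s /mP[h1 h2] //|].
  by rewrite h2 rmorphN mulNr.
by rewrite big_bool opprD opprK addrC.
Qed.

(** The sum [g] of [phi] and its kinks has equal slopes on both sides of every interior point, so it
    is affine on each edge by [affine_of_germs]. Its increment gives the equation for [chi], and the
    slopes at a vertex give the coefficient there. *)
Lemma principal_edge_data D : (exists phi, is_div phi D) ->
  exists chi m, edge_data D chi m.
Proof.
case=> phi [[_ _] divP].
have [k kP] := choice (fun v => (slope_sum_vert phi v _).1 (divP (vert v))).
(* [k] records outgoing slopes, so the slope of [phi] along [e] on arrival at the target is minus
   the one on the half-edge there. *)
pose m e := k (src e) (e, true); pose l e := - k (tgt e) (e, false).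
pose g e t := phi (par e t) + kinks e D t.
have g_right e : exists2 r, 0 < r & forall s, 0 <= s < r ->
    g e s = g e 0 + (m e)%:~R * s.
  have [r1 [r10 r1P _]] := kP (src e); have [r2 r20 r2P] := kinks_germ e D 0.
  exists (Num.min r1 r2); first by rewrite lt_min r10.
  move=> s; rewrite lt_min => hs; have [|+ _] := r2P s; first lra.
  have := r1P (e, true) erefl s; rewrite /ray /= -/(m e) -par_src => h1.
  by rewrite /g add0r fsum_pos_le0 mul0r addr0 => ->; rewrite h1; lra.
have g_left e : exists2 r, 0 < r & forall s, 0 <= s < r ->
    g e (len e - s) = g e (len e) - (l e + nsum e D)%:~R * s.
  have [r1 [r10 r1P _]] := kP (tgt e); have [r2 r20 r2P] := kinks_germ e D (len e).
  exists (Num.min r1 r2); first by rewrite lt_min r10.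
  move=> s; rewrite lt_min => hs; have [|_ +] := r2P s; first lra.
  have := r1P (e, false) erefl s; rewrite /ray /= -par_tgt => h1.
  rewrite /g fsum_pos_lt_len => ->; rewrite h1 /l; last lra.
  by rewrite rmorphD rmorphN /=; lra.
have g_mid e t : 0 < t < len e -> exists m', exists2 r, 0 < r &
    forall s, 0 <= s < r -> g e (t + s) = g e t + m' * s /\
                            g e (t - s) = g e t - m' * s.
  move=> tI; have /(slope_sum_inner phi _ tI)[l' [m' [r1 [r10 r1P cE]]]] := divP (par e t).
  have [r2 r20 r2P] := kinks_germ e D t.
  exists (l' + fsum (fun p => (inner e p && (pos e p < t))%:R) D)%:~R.
  exists (Num.min r1 r2); first by rewrite lt_min r10.
  move=> s; rewrite lt_min => hs; have [|h3 h4] := r2P s; first lra.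
  have [|h1 h2] := r1P s; first lra.
  rewrite /g h3 h4 h1 h2 fsum_pos_eq // cE !rmorphD rmorphN /=.
  by split; lra.
have gE e : forall t, 0 <= t <= len e -> g e t = g e 0 + (m e)%:~R * t.
  by apply: affine_of_germs; rewrite ?len_gt0 //; [exact: g_mid|exists (l e + nsum e D)%:~R].
(* The affine formula and the germ at the target both give the value at [len e - s]; as [s > 0],
   their slopes agree. *)
have lE e : l e = m e - nsum e D.
  have [r r0 rP] := g_left e; have l0 := len_gt0 e.
  pose s := Num.min (r / 2) (len e).
  have s0 : 0 < s by rewrite lt_min; lra.
  have s1 : s <= r / 2 by rewrite ge_min lexx.
  have s2 : s <= len e by rewrite ge_min lexx orbT.
  have h1 := rP s ltac:(lra); have h2 := gE e (len e - s) ltac:(lra).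
  have h3 := gE e (len e) ltac:(lra).
  have h : (l e + nsum e D - m e)%:~R * s = 0 :> R by rewrite rmorphB /=; lra.
  move/eqP: h; rewrite mulf_eq0 (gt_eqF s0) orbF intr_eq0 subr_eq0 => /eqP <-.
  by rewrite addrK.
exists (fun v => phi (vert v)), m; split=> [e|v].
  have := gE e (len e); rewrite /g kinks0 kinks_len -par_tgt -par_src rmorphB /=.
  by have := len_gt0 e; move=> l0 /(_ ltac:(lra)); lra.
have [r [_ _ ->]] := kP v; rewrite sum_base opprD addrC; congr (_ - _).
  rewrite -sumrN; apply: eq_bigr => e /eqP te.
  by rewrite -lE /l te.
by apply: eq_bigr => e /eqP se; rewrite /m se.
Qed.

Lemma edge_data_principal D chi m : edge_data D chi m -> exists phi, is_div phi D.
Proof.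
case=> chiE mE.
pose f e t := chi (src e) + (m e)%:~R * t - kinks e D t.
(* Every point is one vertex or lies in one open edge, so exactly one summand is present. *)
pose phi p := \sum_(v | p == vert v) chi v + \sum_(e | inner e p) f e (pos e p).
have phi_v v : phi (vert v) = chi v.
  rewrite /phi (big_pred1 v) => [|w]; last by rewrite (inj_eq (@vert_inj _ _ G)) eq_sym.
  by rewrite big_pred0 ?addr0 // => e; rewrite inner_vert.
have phi_e e t : 0 <= t <= len e -> phi (par e t) = f e t.
  move=> tI; have [->|t0] := eqVneq t 0.
    by rewrite par_src phi_v /f kinks0 mulr0 addr0 subr0.
  have [->|t1] := eqVneq t (len e).
    by rewrite par_tgt phi_v /f kinks_len chiE rmorphB /=; lra.
  have tI' : 0 < t < len e by move/eqP: t0; move/eqP: t1; lra.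
  rewrite /phi big_pred0 => [|v]; last by apply/eqP; exact: par_vert.
  by rewrite (big_pred1 e) => [|e']; rewrite ?inner_par // pos_par ?add0r.
have divP p : slope_sum phi p (coeff p D).
  have [[v ->]|[e [t [tI ->]]]] := model_cover G p; last first.
    apply/(slope_sum_inner phi _ tI).
    have [r r0 rP] := kinks_germ e D t.
    set A := fsum _ D in rP; set B := fsum _ D in rP.
    exists (m e - B), (m e - A), (Num.min r (Num.min t (len e - t))).
    split; first by rewrite !lt_min r0; lra.
      move=> s; rewrite !lt_min => hs; have [|h1 h2] := rP s; first lra.
      by rewrite !phi_e ?/f ?h1 ?h2 ?rmorphB /=; try lra; split; lra.
    have : A = B + coeff (par e t) D by exact: fsum_pos_eq.
    by move->; lra.
  apply/slope_sum_vert.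
  pose o (x : E * bool) := if x.2 then m x.1 else - (m x.1 - nsum x.1 D).
  have [x|r r0 rP] := @uniform_radius R _ (enum {: E * bool}) (fun x s =>
      phi (ray x s) = phi (vert (base x)) + (o x)%:~R * s).
    case: x => e b; have l0 := len_gt0 e.
    have [r1 r10 r1P] := kinks_germ e D 0; have [r2 r20 r2P] := kinks_germ e D (len e).
    exists (Num.min (len e) (Num.min r1 r2)); first by rewrite !lt_min r10 r20 l0.
    move=> s; rewrite !lt_min => hs; rewrite -ray0 /ray /o /= subr0.
    case: b; rewrite !phi_e /f; try lra.
      have [|+ _] := r1P s; first lra.
      by rewrite fsum_pos_le0 add0r => ->; lra.
    have [|_ +] := r2P s; first lra.
    by rewrite fsum_pos_lt_len => ->; rewrite rmorphN rmorphB /=; lra.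
  exists o, r; split=> // [x <- s hs|].
    by apply: (rP s hs); rewrite mem_enum.
  rewrite mE sum_base /o /= sumrN opprD opprK addrC.
  by congr (_ + _).
exists phi; split=> //; split=> [p|p]; last by exists (coeff p D).
exact: slope_sum_continuous (divP p).
Qed.

Lemma lin_equivP D1 D2 : lin_equiv D1 D2 <-> exists chi m, edge_data (D1 - D2) chi m.
Proof.
split=> [|[chi [m]]]; first exact: principal_edge_data.
exact: edge_data_principal.
Qed.

End EdgeData.

(** * Chains and the Jacobian *)

Section Projection.
Context {R : realType} {X : metricType R} (G : model X).
Local Notation E := 'I_(nedge G).
Local Notation V := 'I_(nvert G).
Local Notation chain := 'rV[R]_(nedge G).
Local Notation bd := (boundary_mx G).
Implicit Types (e : E) (v w : V) (x y z : chain).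

Lemma bdE x v : (x *m bd) 0 v =
  \sum_(e | tgt e == v) x 0 e - \sum_(e | src e == v) x 0 e.
Proof.
rewrite mxE (eq_bigr (fun e => x 0 e * (tgt e == v)%:R - x 0 e * (src e == v)%:R)).
  by rewrite sumrB; congr (_ - _); rewrite [RHS]big_mkcond; apply: eq_bigr => e _;
    case: ifP => _; rewrite ?mulr1 ?mulr0.
by move=> e _; rewrite mxE mulrBr eq_sym [in X in _ - X]eq_sym.
Qed.

Definition len_mx : 'M[R]_(nedge G) := diag_mx (\row_e len e).

Lemma chain_dotE x y : chain_dot x y = (x *m len_mx *m y^T) 0 0.
Proof.
rewrite mxE; apply: eq_bigr => e _.
by rewrite mul_mx_diag !mxE [_ * len e]mulrC.
Qed.

Lemma chain_dotDl x y z : chain_dot (x + y) z = chain_dot x z + chain_dot y z.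
Proof. by rewrite !chain_dotE !mulmxDl mxE. Qed.

Lemma chain_dotBl x y z : chain_dot (x - y) z = chain_dot x z - chain_dot y z.
Proof. by rewrite !chain_dotE !mulmxBl !mxE. Qed.

Lemma chain_dot_eq0 x : chain_dot x x = 0 -> x = 0.
Proof.
move=> /eqP; rewrite psumr_eq0 => [/allP h|e _]; last first.
  by rewrite -mulrA -expr2 mulr_ge0 ?sqr_ge0 // ltW ?len_gt0.
apply/rowP => e; rewrite mxE; have /implyP/(_ isT) := h e (mem_index_enum _).
by rewrite -mulrA mulf_eq0 gt_eqF ?len_gt0 //= mulf_eq0 orbb => /eqP.
Qed.

Definition cycles : 'M[R]_(genus G, nedge G) := row_base (kermx bd).

Lemma cyclesP x : reflect (exists u, x = u *m cycles) (x *m bd == 0).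
Proof.
apply: (iffP idP) => [/eqP x0|[u ->]].
  have : (x <= kermx bd)%MS by apply/sub_kermxP.
  by rewrite -(eq_row_base (kermx bd)) => /submxP.
have : (u *m cycles <= kermx bd)%MS.
  by rewrite -(eq_row_base (kermx bd)) submxMl.
by move/sub_kermxP->.
Qed.

Definition gram : 'M[R]_(genus G) := cycles *m len_mx *m cycles^T.

(** A vector killed by the Gram matrix gives a cycle of norm zero, and the inner product is positive
    definite. *)
Lemma gram_unit : gram \in unitmx.
Proof.
rewrite -row_free_unit -kermx_eq0; apply/rowV0P => u /sub_kermxP u0.
have : chain_dot (u *m cycles) (u *m cycles) = 0.
  have -> : chain_dot (u *m cycles) (u *m cycles) = (u *m gram *m u^T) 0 0.
    by rewrite chain_dotE /gram trmx_mul !mulmxA.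
  by rewrite u0 mul0mx mxE.
move/chain_dot_eq0 => uc; apply: (row_free_inj (row_base_free (kermx bd))).
by rewrite mul0mx.
Qed.

Definition proj_mx : 'M[R]_(nedge G) :=
  len_mx *m cycles^T *m invmx gram *m cycles.

Lemma proj_cycle x : x *m proj_mx \in cycle_chain (G := G).
Proof. by apply/cyclesP; exists (x *m (len_mx *m cycles^T *m invmx gram)); rewrite !mulmxA. Qed.

Definition proj x : H1 G := MkH1 (proj_cycle x).

Lemma proj_dot x z : z *m bd = 0 -> chain_dot (proj x) z = chain_dot x z.
Proof.
move=> /eqP/cyclesP[u ->]; rewrite !chain_dotE /= trmx_mul.
congr (fun_of_matrix _ 0 0); have := gram_unit; rewrite /proj_mx /gram.
move: cycles => C Cu; rewrite !mulmxA; congr (_ *m _).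
rewrite -[x *m len_mx *m C^T in LHS]mulmxA -!mulmxA (mulmxA C) mulVmx //.
by rewrite mulmx1.
Qed.

Lemma proj_uniq x (h : H1 G) :
  (forall z : H1 G, chain_dot h z = chain_dot x z) -> h = proj x.
Proof.
move=> hx; apply: val_inj; apply/eqP; rewrite -subr_eq0; apply/eqP.
apply: chain_dot_eq0; pose w := h - proj x.
have wE : h1val w = h1val h - h1val (proj x) by [].
have /eqP w0 := h1valP w.
by rewrite -wE {1}wE chain_dotBl proj_dot // hx subrr.
Qed.

Lemma projB x y : proj (x - y) = proj x - proj y.
Proof. by apply: val_inj; rewrite /= mulmxBl. Qed.

HB.instance Definition _ := GRing.isZmodMorphism.Build chain (H1 G) proj projB.

Lemma projZ (a : R) x : proj (a *: x) = a *: proj x.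
Proof. by apply: val_inj; rewrite /= -scalemxAl. Qed.

Lemma proj_id (h : H1 G) : proj (h : chain) = h.
Proof. by apply/esym/proj_uniq. Qed.

(** The kernel of the projection is the orthogonal complement of the cycles. Since the cycles are
    the kernel of the boundary map, this complement consists of the coboundaries, up to the lengths
    in the inner product. *)
Lemma proj_eq0 x : proj x = 0 <->
  exists chi : V -> R, forall e, len e * x 0 e = chi (tgt e) - chi (src e).
Proof.
split=> [px|[chi xE]].
  have orth y : y *m bd = 0 -> chain_dot x y = 0.
    by move=> y0; rewrite -proj_dot // px chain_dotE !mul0mx mxE.
  have : (x *m len_mx <= bd^T)%MS.
    (* The transposed columns of the cokernel of [bd^T] are cycles, and orthogonality to all of them
       is the criterion for lying in the row space of [bd^T]. *)
    rewrite submxE; apply/eqP/rowP => j; rewrite [RHS]mxE.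
    have := @orth (col j (cokermx bd^T))^T; rewrite chain_dotE trmxK => <-.
      by rewrite [LHS]mxE [RHS]mxE; apply: eq_bigr => k _; rewrite [col _ _ _ _]mxE.
    apply: trmx_inj; rewrite trmx_mul trmxK colE mulmxA mulmx_coker.
    by rewrite mul0mx trmx0.
  case/submxP => chi xE; exists (fun v => chi 0 v) => e.
  have := congr1 (fun A : chain => A 0 e) xE; rewrite mul_mx_diag !mxE mulrC => ->.
  rewrite (eq_bigr (fun v => chi 0 v * (v == tgt e)%:R - chi 0 v * (v == src e)%:R)).
    rewrite sumrB (bigD1 (tgt e)) //= [X in _ - X](bigD1 (src e)) //= !eqxx !mulr1.
    by rewrite !big1 ?addr0 // => v /negPf->; rewrite mulr0.
  by move=> v _; rewrite !mxE mulrBr.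
apply/esym/proj_uniq => z; have /eqP z0 := h1valP z.
rewrite [LHS]chain_dotE !mul0mx mxE.
have -> : chain_dot x z = \sum_v chi v * (h1val z *m bd) 0 v.
  rewrite (eq_bigr (fun v => \sum_e chi v * (z 0 e * bd e v))); last first.
    by move=> v _; rewrite mxE mulr_sumr.
  rewrite exchange_big; apply: eq_bigr => e _.
  rewrite xE (eq_bigr (fun v => chi v * z 0 e * (v == tgt e)%:R - chi v * z 0 e * (v == src e)%:R)).
    rewrite sumrB (bigD1 (tgt e)) //= [X in _ = _ - X](bigD1 (src e)) //= !eqxx !mulr1.
    by rewrite !big1 ?addr0 ?mulrBl // => v /negPf->; rewrite mulr0.
  by move=> v _; rewrite mxE !mulrBr !mulrA.
by rewrite z0 big1 // => v _; rewrite mxE mulr0.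
Qed.

Lemma pi_JacB (h k : H1 G) : pi_Jac (h - k) = pi_Jac h - pi_Jac k.
Proof.
apply: etrans (Quotient.pi_add (H1Z (G := G)) h (- k)) _.
by congr (_ + _); exact: (Quotient.pi_opp (H1Z (G := G)) k).
Qed.

HB.instance Definition _ := GRing.isZmodMorphism.Build (H1 G) (Jac G) (@pi_Jac R X G) pi_JacB.

Lemma pi_Jac_eq0 (h : H1 G) : pi_Jac h = 0 <-> h \in H1Z (G := G).
Proof.
rewrite -[X in X \in _]subr0 Quotient.idealrBE.
have -> : 0 = pi_Jac (0 : H1 G) by rewrite raddf0.
by split=> [e|/eqP//]; apply/eqP.
Qed.

Lemma pi_Jac_surj (a : Jac G) : exists h, a = pi_Jac h.
Proof. by exists (repr a); rewrite /pi_Jac reprK. Qed.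

Definition chain_Jac x : Jac G := pi_Jac (proj x).

Lemma chain_JacB x y : chain_Jac (x - y) = chain_Jac x - chain_Jac y.
Proof. by rewrite /chain_Jac !raddfB. Qed.

HB.instance Definition _ := GRing.isZmodMorphism.Build chain (Jac G) chain_Jac chain_JacB.

Lemma chain_JacD x y : chain_Jac (x + y) = chain_Jac x + chain_Jac y.
Proof. exact: raddfD. Qed.

Definition int_cycle z := z \is a mxOver Num.int /\ z *m bd = 0.

(** If the projection of [x] is integral it serves as [z]; then [x - z] projects to zero, and
    [proj_eq0] provides the potential [chi]. *)
Lemma chain_Jac_eq0 x : chain_Jac x = 0 <-> exists z (chi : V -> R),
  int_cycle z /\ forall e, len e * (x 0 e - z 0 e) = chi (tgt e) - chi (src e).
Proof.
rewrite /chain_Jac pi_Jac_eq0; split=> [pZ|[z [chi [[zZ z0] xE]]]].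
  have /proj_eq0[chi chiE] : proj (x - h1val (proj x)) = 0.
    by rewrite projB proj_id subrr.
  exists (h1val (proj x)), chi; split=> [|e].
    by split=> //; exact/eqP/h1valP.
  by rewrite -chiE !mxE.
have zH : z \in cycle_chain (G := G) by exact/eqP.
have : proj (x - z) = 0 by apply/proj_eq0; exists chi => e; rewrite -xE !mxE.
rewrite projB -[z]/(h1val (MkH1 zH)) proj_id => /eqP; rewrite subr_eq0 => /eqP ->.
exact: zZ.
Qed.

Lemma chain_Jac_int_cycle z : int_cycle z -> chain_Jac z = 0.
Proof.
move=> zI; apply/chain_Jac_eq0; exists z, (fun=> 0); split=> // e.
by rewrite !subrr mulr0.
Qed.

End Projection.

(** * The Abel-Jacobi map on chains and the tropical Abel theorem *)

Section AbelJacobi.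
Context {R : realType} {X : metricType R} (G : model X).
Local Notation E := 'I_(nedge G).
Local Notation V := 'I_(nvert G).
Local Notation chain := 'rV[R]_(nedge G).
Local Notation bd := (boundary_mx G).
Implicit Types (e : E) (v w : V) (x y z : chain) (p q : X) (D : {freeg X}).

Definition cut_connected : Prop := forall B : {set V},
  (forall e, (src e \in B) = (tgt e \in B)) -> B = finset.set0 \/ B = [set: V]%SET.

Hypothesis conn : cut_connected.

Lemma bd_delta e : (delta_mx 0 e : chain) *m bd =
  delta_mx 0 (tgt e) - delta_mx 0 (src e).
Proof. by rewrite -rowE; apply/rowP => v; rewrite !mxE !eqxx. Qed.

Lemma delta_int e : (delta_mx 0 e : chain) \is a mxOver Num.int.
Proof. by apply/mxOverP => i j; rewrite mxE; exact: intr_nat. Qed.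

Lemma int0 : (0 : chain) \is a mxOver Num.int.
Proof. by apply/mxOverP => i j; rewrite mxE rpred0. Qed.

Lemma intB x y : x \is a mxOver Num.int -> y \is a mxOver Num.int ->
  x - y \is a mxOver Num.int.
Proof. by move=> /mxOverP xZ /mxOverP yZ; apply/mxOverP => i j; rewrite !mxE rpredB. Qed.

Lemma intD x y : x \is a mxOver Num.int -> y \is a mxOver Num.int ->
  x + y \is a mxOver Num.int.
Proof. by move=> /mxOverP xZ /mxOverP yZ; apply/mxOverP => i j; rewrite !mxE rpredD. Qed.

Lemma int_cycle0 : int_cycle (G := G) 0.
Proof. by split; [exact: int0|rewrite mul0mx]. Qed.

Lemma edge_closed_set (P : set V) : (exists v, P v) ->
  (forall e, P (src e) <-> P (tgt e)) -> forall v, P v.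
Proof.
move=> [v0 Pv0] clP v; pose B : {set V} := [set v | `[< P v >]]%SET.
have [e|B0|BT] := @conn B.
- by rewrite !inE; apply/asboolP/asboolP => /clP.
- by have := finset.in_set0 v0; rewrite -B0 inE => /asboolP.
- by have := finset.in_setT v; rewrite -BT inE => /asboolP.
Qed.

Lemma vertex_exists p : exists v : V, True.
Proof. by have [[v _]|[e _]] := model_cover G p; [exists v|exists (src e)]. Qed.

(** [c v] is the chain of a path to [v] from a base vertex, whose indicator row is [b]. Keeping [b]
    abstract also covers a model without vertices. *)
Lemma base_chains : exists (c : V -> chain) (b : 'rV[R]_(nvert G)), forall v,
  c v \is a mxOver Num.int /\ c v *m bd = delta_mx 0 v - b.
Proof.
have [[v0 _]|nov] := pselect (exists v : V, True); last first.
  by exists (fun=> 0), 0 => v; case: nov; exists v.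
have [v|c cP] := @choice _ _ (fun v (c : chain) =>
    c \is a mxOver Num.int /\ c *m bd = delta_mx 0 v - delta_mx 0 v0); last by exists c, (delta_mx 0 v0).
move: v; apply: edge_closed_set => [|e].
  by exists v0, 0; rewrite int0 mul0mx subrr.
split=> -[c [cZ cE]].
  exists (c + delta_mx 0 e); rewrite intD ?delta_int //; split=> //.
  by rewrite mulmxDl cE bd_delta addrC addrA subrK.
exists (c - delta_mx 0 e); rewrite intB ?delta_int //; split=> //.
by rewrite mulmxBl cE bd_delta opprB addrC addrA subrK.
Qed.

Variables (c : V -> chain) (b : 'rV[R]_(nvert G)).
Hypothesis cP : forall v, c v \is a mxOver Num.int /\ c v *m bd = delta_mx 0 v - b.

(* A chain representing the 1-chain of a path to p from a base point, up to
   integral cycles; the base point is encoded by [b]. *)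
Definition kappa p : chain :=
  \sum_v (((p == vert v)%:R : int)%:~R : R) *: c v +
  \sum_e (((inner e p)%:R : int)%:~R : R) *: c (src e) + \row_e (pos e p / len e).

Lemma kappa_vert v : kappa (vert v) = c v.
Proof.
rewrite /kappa (bigD1 v) //= eqxx scale1r !big1 => [|e _|w wv].
- rewrite !addr0 -[RHS]addr0; congr (_ + _); apply/rowP => e.
  by rewrite !mxE pos_out ?mul0r // inner_vert.
- by rewrite inner_vert scale0r.
- by rewrite (inj_eq (@vert_inj _ _ G)) eq_sym (negPf wv) scale0r.
Qed.

Definition edge_chain e t : chain := c (src e) + (t / len e) *: delta_mx 0 e.

(** [kappa] treats vertices and open edges separately. The only discrepancy is at [t = len e], where
    the path to the target and the path along [e] differ by an integral cycle. *)
Lemma kappa_par e t : 0 <= t <= len e ->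
  exists2 z, int_cycle z & kappa (par e t) = edge_chain e t + z.
Proof.
move=> tI; have [->|t0] := eqVneq t 0.
  exists 0; first exact: int_cycle0.
  by rewrite par_src kappa_vert /edge_chain mul0r scale0r !addr0.
have [->|t1] := eqVneq t (len e).
  exists (c (tgt e) - c (src e) - delta_mx 0 e).
    have [sZ sE] := cP (src e); have [tZ tE] := cP (tgt e).
    split; first by rewrite !intB ?delta_int.
    by rewrite !mulmxBl sE tE bd_delta opprB addrA subrK subrr.
  rewrite par_tgt kappa_vert /edge_chain divff ?gt_eqF ?len_gt0 // scale1r.
  by rewrite -[c (tgt e) - _ - _]addrA -opprD addrCA subrr addr0.
have tI' : 0 < t < len e by move/eqP: t0; move/eqP: t1; lra.
exists 0; first exact: int_cycle0.
rewrite addr0 /kappa big1 ?add0r => [|v _]; last first.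
  by have /eqP/negPf-> := @par_vert _ _ G e t v tI'; rewrite scale0r.
rewrite (bigD1 e) //= inner_par // eqxx scale1r big1 ?addr0 => [|e' /negPf ee]; last first.
  by rewrite inner_par // ee scale0r.
congr (_ + _); apply/rowP => e'; rewrite !mxE eqxx /=.
have [->|ee] := eqVneq e' e; first by rewrite pos_par // mulr1.
by rewrite pos_out ?inner_par // mul0r mulr0.
Qed.

Lemma chain_Jac_kappa_par e t : 0 <= t <= len e ->
  chain_Jac (kappa (par e t)) = chain_Jac (edge_chain e t).
Proof.
by move=> /kappa_par[z zI ->]; rewrite chain_JacD (chain_Jac_int_cycle zI) addr0.
Qed.

Definition seg_chain (s : seq (E * R * R)) : chain :=
  \sum_(u <- s) ((u.2 - u.1.2) / len u.1.1) *: delta_mx 0 u.1.1.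

Lemma path_dotE s y : path_dot s y = chain_dot (seg_chain s) y.
Proof.
rewrite /path_dot /seg_chain; elim: s => [|u s IH].
  by rewrite !big_nil chain_dotE !mul0mx mxE.
rewrite !big_cons chain_dotDl -IH; congr (_ + _).
rewrite /chain_dot (bigD1 u.1.1) //= big1 => [|e /negPf eu]; last first.
  by rewrite !mxE eu andbF !mulr0 mul0r.
by rewrite addr0 !mxE !eqxx mulr1 mulrC [len _ * _]mulrC divfK ?gt_eqF ?len_gt0 // mulrC.
Qed.

Lemma edge_path_kappa s (x y : X) : edge_path (G := G) x s y ->
  exists2 z, int_cycle z & kappa y - kappa x = seg_chain s + z.
Proof.
elim: s x => [|[[e t] t'] s IH] x /=.
  move->; exists 0; first exact: int_cycle0.
  by rewrite subrr /seg_chain big_nil addr0.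
case=> tI t'I <- /IH[z [zZ z0] zE].
have [z1 [z1Z z10] z1E] := kappa_par tI; have [z2 [z2Z z20] z2E] := kappa_par t'I.
exists (z + z2 - z1).
  by split; rewrite ?intB ?intD // mulmxBl mulmxDl z0 z10 z20 addr0 subr0.
rewrite -(subrK (kappa (par e t')) (kappa y)) -addrA zE z1E z2E /seg_chain big_cons /=.
rewrite mulrBl scalerBl /edge_chain.
set S := \sum_(_ <- _) _; set A := _ *: _; set B := _ *: _.
apply/rowP => i; rewrite !mxE; lra.
Qed.

Lemma edge_path_cat (x y z : X) s1 s2 : edge_path (G := G) x s1 y -> edge_path y s2 z ->
  edge_path x (s1 ++ s2) z.
Proof.
elim: s1 x => [|[[e t] t'] s IH] x /=; first by move->.
by case=> tI t'I <- /IH h /h.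
Qed.

Lemma edge_path_exists p q : exists s, edge_path (G := G) p s q.
Proof.
pose reach (x y : X) := exists s, edge_path (G := G) x s y.
have trans (x y z : X) : reach x y -> reach y z -> reach x z.
  by move=> [s1 h1] [s2 h2]; exists (s1 ++ s2); exact: edge_path_cat h1 h2.
have refl (x : X) : reach x x by exists [::].
have step e t t' : 0 <= t <= len e -> 0 <= t' <= len e -> reach (par e t) (par e t').
  by move=> tI t'I; exists [:: (e, t, t')].
have to_vert (x : X) : exists v, reach x (vert v) /\ reach (vert v) x.
  have [[v ->]|[e [t [tI ->]]]] := model_cover G x; first by exists v.
  have l0 := len_gt0 e.
  by exists (src e); rewrite -par_src; split; apply: step; lra.
have [v [pv _]] := to_vert p; have [w [_ wq]] := to_vert q.
suff vw : reach (vert v) (vert w) by exact: (trans _ _ _ pv (trans _ _ _ vw wq)).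
move: w {wq}; apply: edge_closed_set => [|e]; first by exists v.
have l0 := len_gt0 e; split=> h; apply: (trans _ _ _ h); rewrite -par_src -par_tgt.
  by apply: step; lra.
by apply: step; lra.
Qed.

(** Along any path the difference of [kappa] at the two ends is the chain of the path up to an
    integral cycle, so the choice of the path disappears in [Jac]. *)
Lemma AJ_pointE q p : AJ_point G q p = chain_Jac (kappa p) - chain_Jac (kappa q).
Proof.
rewrite /AJ_point -chain_JacB.
have projP s h : is_projection s h <-> h = proj (seg_chain s).
  split=> [hs|->].
    by apply: proj_uniq => z; rewrite hs path_dotE.
  move=> z; rewrite path_dotE proj_dot //; exact/eqP/(h1valP z).
case: xgetP => [h _ [s sP /projP ->]|none]; last first.
  have [s sP] := edge_path_exists q p.
  by case: (none (proj (seg_chain s))); exists s => //; apply/projP.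
have [z zI ->] := edge_path_kappa sP.
by rewrite chain_JacD (chain_Jac_int_cycle zI) addr0.
Qed.

Lemma fsum_scale (k : X -> int) x D :
  fsum (fun p => ((k p)%:~R : R) *: x) D = (fsum k D)%:~R *: x.
Proof.
rewrite fsum_intr /fsum scaler_suml; apply: eq_bigr => p _.
by rewrite -[LHS]scaler_int scalerA mulrzl.
Qed.

Lemma fsum_kappa D : fsum kappa D =
  \sum_v ((coeff (vert v) D)%:~R : R) *: c v +
  \sum_e ((nsum e D)%:~R : R) *: c (src e) + \row_e (tsum e D / len e).
Proof.
pose f1 p : chain := \sum_v (((p == vert v)%:R : int)%:~R : R) *: c v.
pose f2 p : chain := \sum_e (((inner e p)%:R : int)%:~R : R) *: c (src e).
rewrite (fsum_split (fun p => f1 p + f2 p)) (fsum_split f1 f2) !fsum_big.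
congr (_ + _ + _).
- by apply: eq_bigr => v _; rewrite fsum_scale coeff_fsum.
- by apply: eq_bigr => e _; rewrite fsum_scale.
apply/rowP => e; rewrite mxE /fsum summxE /tsum mulr_suml; apply: eq_bigr => p _.
by rewrite -[in LHS]scaler_int !mxE mulrA mulrzl.
Qed.

Lemma deg_fsum D : deg D = \sum_(v : V) coeff (vert v) D + \sum_(e : E) nsum e D.
Proof.
under eq_bigr do rewrite coeff_fsum.
rewrite fsum_deg -!fsum_big -fsum_split; apply: eq_fsum => p _.
have [[v ->]|[e [t [tI ->]]]] := model_cover G p.
  rewrite (bigD1 v) //= eqxx !big1 ?addr0 // => [e _|w wv]; first by rewrite inner_vert.
  by rewrite (inj_eq (@vert_inj _ _ G)) eq_sym (negPf wv).
rewrite big1 ?add0r => [|v _]; last first.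
  by have /eqP/negPf-> := @par_vert _ _ G e t v tI.
by rewrite (bigD1 e) //= inner_par // eqxx big1 ?addr0 // => e' /negPf; rewrite inner_par // => ->.
Qed.

Lemma edge_data_deg D chi m : edge_data (G := G) D chi m -> deg D = 0.
Proof.
case=> _ mE; rewrite deg_fsum.
under eq_bigr do rewrite mE.
rewrite sumrB (exchange_big_dep xpredT) //= [X in _ - X + _](exchange_big_dep xpredT) //=.
rewrite (eq_bigr (fun e => m e - nsum e D)) => [|e _]; last first.
  by rewrite (big_pred1 (tgt e)) // => v; rewrite eq_sym.
rewrite [X in _ - X + _](eq_bigr m) => [|e _]; last first.
  by rewrite (big_pred1 (src e)) // => v; rewrite eq_sym.
by rewrite sumrB; lra.
Qed.

(** The integral part counts every interior chip at the source of its edge. The multiples of the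
    base row [b] add up to the degree times [b] and cancel. *)
Lemma bd_int_part D : deg D = 0 ->
  (\sum_v ((coeff (vert v) D)%:~R : R) *: c v +
   \sum_e ((nsum e D)%:~R : R) *: c (src e)) *m bd =
  \row_v (coeff (vert v) D + \sum_(e | src e == v) nsum e D)%:~R.
Proof.
move=> D0; rewrite mulmxDl !mulmx_suml.
under eq_bigr do rewrite -scalemxAl (cP _).2 scalerBr.
under [X in _ + X]eq_bigr do rewrite -scalemxAl (cP _).2 scalerBr.
rewrite !sumrB addrACA -opprD -!scaler_suml -scalerDl.
have := congr1 (fun k : int => k%:~R : R) D0; rewrite deg_fsum rmorphD /= !raddf_sum /= => ->.
rewrite scale0r subr0; apply/rowP => v; rewrite !mxE !summxE rmorphD raddf_sum /=.
congr (_ + _).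
  rewrite (bigD1 v) //= !mxE !eqxx mulr1 big1 ?addr0 // => w wv.
  by rewrite !mxE [v == w]eq_sym (negPf wv) andbF mulr0.
rewrite [RHS]big_mkcond; apply: eq_bigr => e _.
by rewrite !mxE /= [v == _]eq_sym; case: eqP; rewrite ?mulr1 ?mulr0.
Qed.

(** Tropical Abel theorem. The class vanishes iff the integral part [y] plus the offsets on the
    edges, minus an integral cycle [z], is the coboundary of some [chi]. Then [chi] gives the
    function at the vertices, and the integral chain [y - z] gives its slopes at the targets. *)
Lemma abel D : deg D = 0 ->
  chain_Jac (fsum kappa D) = 0 <-> exists chi m, edge_data (G := G) D chi m.
Proof.
move=> D0; rewrite chain_Jac_eq0 fsum_kappa.
set y := _ + \sum_e _; have yb : y *m bd = _ := bd_int_part D0.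
have yZ : y \is a mxOver Num.int.
  apply/mxOverP => i e; rewrite mxE !summxE rpredD //; apply: rpred_sum => j _.
    by rewrite mxE rpredM ?intr_int //; apply/mxOverP/(cP _).1.
  by rewrite mxE rpredM ?intr_int //; apply/mxOverP/(cP _).1.
have dotE e (z : chain) : len e * ((y + \row_e (tsum e D / len e)) 0 e - z 0 e) =
    len e * (y 0 e - z 0 e) + tsum e D.
  rewrite mxE [X in _ + X - _]mxE addrAC mulrDr; congr (_ + _).
  by rewrite mulrC divfK // gt_eqF // len_gt0.
split=> [[z [chi [[zZ z0] xE]]]|[chi [m [chiE mE]]]].
  have yz_int e : exists k : int, y 0 e - z 0 e = k%:~R.
    by apply/intrP; rewrite rpredB //; [exact: (mxOverP yZ)|exact: (mxOverP zZ)].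
  have [k kE] := choice yz_int.
  have kb v : \sum_(e | tgt e == v) k e - \sum_(e | src e == v) k e =
      coeff (vert v) D + \sum_(e | src e == v) nsum e D.
    apply: (@intr_inj R); rewrite rmorphB !raddf_sum /=.
    have := congr1 (fun A : 'rV[R]_(nvert G) => A 0 v) yb; rewrite [RHS]mxE => <-.
    have -> : y *m bd = (y - z) *m bd by rewrite mulmxBl z0 subr0.
    rewrite bdE -[X in _ = _ + X]sumrN; congr (_ + _); apply: eq_bigr => e _.
      by rewrite [(y - z) 0 e]mxE [(- z) 0 e]mxE kE.
    by rewrite [(y - z) 0 e]mxE [(- z) 0 e]mxE kE.
  (* [k e] is the slope at the target; adding the drops at the interior chips recovers the initial
     slope. *)
  exists chi, (fun e => k e + nsum e D); split=> [e|v].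
    by have := xE e; rewrite dotE kE addrK; lra.
  under eq_bigr do rewrite addrK.
  by rewrite big_split opprD addrA kb addrK.
pose k e := m e - nsum e D.
exists (y - \row_e (k e)%:~R), chi; split; last first.
  by move=> e; rewrite dotE !mxE chiE -/(k e); lra.
split.
  apply/mxOverP => i e; rewrite !mxE rpredB ?intr_int //.
  by have /mxOverP/(_ i e) := yZ; rewrite mxE.
rewrite mulmxBl yb; apply/eqP; rewrite subr_eq0; apply/eqP/rowP => v.
rewrite bdE mxE mE !rmorphD rmorphN /= !rmorph_sum /= -addrA; congr (_ + _).
  by apply: eq_bigr => e _; rewrite mxE.
rewrite addrC -sumrN -sumrN -big_split /=; apply: eq_bigr => e _.
by rewrite mxE /k rmorphB opprB.
Qed.

Lemma AJ_divE q D :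
  AJ_div G q D = chain_Jac (fsum kappa D) - chain_Jac (kappa q) *~ deg D.
Proof.
rewrite /AJ_div -/(fsum _ D) (eq_fsum (g := fun p => chain_Jac (kappa p) + - chain_Jac (kappa q))).
  rewrite fsum_split -fsum_morph; congr (_ + _).
  rewrite /fsum -mulrz_sumr mulNrz; congr (- (_ *~ _)).
  by rewrite fsum_deg; apply: eq_bigr => p _; rewrite intz.
by move=> p _; exact: AJ_pointE.
Qed.

Lemma AJ_divD q D1 D2 : AJ_div G q (D1 + D2) = AJ_div G q D1 + AJ_div G q D2.
Proof. exact: (@fsumD _ _ (AJ_point G q)). Qed.

Lemma AJ_divB q D1 D2 : AJ_div G q (D1 - D2) = AJ_div G q D1 - AJ_div G q D2.
Proof. exact: (@fsumB _ _ (AJ_point G q)). Qed.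

End AbelJacobi.

(** * Linear equivalence through the Abel-Jacobi map *)

Section LinEquiv.
Context {R : realType} {X : metricType R} (X_graph : metric_graph X) (G : model X).

Lemma graph_cut_connected : cut_connected G.
Proof. by case: X_graph => _ cX _; exact: model_connected. Qed.

(** [abel] applies to the difference of the divisors, whose degree is zero, so that the contribution
    of [q] cancels. *)
Lemma lin_equiv_AJ q (D1 D2 : {freeg X}) :
  lin_equiv D1 D2 <-> deg D1 = deg D2 /\ AJ_div G q D1 = AJ_div G q D2.
Proof.
have stars : forall p : X, exists n r (c : 'I_n -> R -> X), star_chart p r c by case: X_graph.
have conn := graph_cut_connected; have [c [b cP]] := base_chains conn.
rewrite (lin_equivP G stars).
have key : deg (D1 - D2) = 0 -> AJ_div G q D1 = AJ_div G q D2 <->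
    exists chi m, edge_data (G := G) (D1 - D2) chi m.
  move=> d0; rewrite -(abel cP d0).
  have -> : chain_Jac (fsum (kappa c) (D1 - D2)) = AJ_div G q (D1 - D2).
    by rewrite (AJ_divE conn cP) d0 subr0.
  rewrite AJ_divB; split=> [->|e0]; first exact: subrr.
  exact: subr0_eq.
split=> [ed|[degE /key]]; last by apply; rewrite degB degE subrr.
have d0 : deg (D1 - D2) = 0 by have [chi [m /edge_data_deg]] := ed.
split; first by apply/eqP; rewrite -subr_eq0 -degB d0.
exact/key.
Qed.

End LinEquiv.

(** * Cuts *)

Section Cuts.
Context {V E : finType} (src tgt : E -> V).
Implicit Types (A B : {set V}) (S : {set E}) (e f : E) (v w : V).

Definition crosses B e : bool := (src e \in B) != (tgt e \in B).

Definition off_cut S B : Prop := forall e, crosses B e -> e \in S.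

(* S can be deleted without disconnecting the graph. *)
Definition cut_free S : Prop := forall B, off_cut S B ->
  B = finset.set0 \/ B = [set: V]%SET.

(** Over the field with two elements, taking the cut of a vertex set is linear ([crosses_symdiff]).
    Two cuts through an edge [f] therefore combine into one that avoids [f]. *)
Definition symdiff A B : {set V} := (A :\: B) :|: (B :\: A).

Lemma in_symdiff A B v : (v \in symdiff A B) = (v \in A) (+) (v \in B).
Proof. by rewrite !inE; case: (v \in A); case: (v \in B). Qed.

Lemma crosses_symdiff A B e : crosses (symdiff A B) e = crosses A e (+) crosses B e.
Proof.
rewrite /crosses !in_symdiff.
by case: (src e \in A); case: (tgt e \in A); case: (src e \in B); case: (tgt e \in B).
Qed.

Lemma symdiff_eq0 A B : symdiff A B = finset.set0 -> A = B.
Proof.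
move=> AB; apply/setP => v; have := in_symdiff A B v; rewrite AB finset.in_set0.
by case: (v \in A); case: (v \in B).
Qed.

Lemma crossesC A e : crosses (~: A) e = crosses A e.
Proof. by rewrite /crosses !inE; case: (src e \in A); case: (tgt e \in A). Qed.

Lemma off_cutC S A : off_cut S (~: A) <-> off_cut S A.
Proof. by split=> h e; have := h e; rewrite crossesC. Qed.

Lemma cut_free_crossing B : cut_free finset.set0 -> B != finset.set0 ->
  B != [set: V]%SET -> exists e, crosses B e.
Proof.
move=> conn B0 BT; apply: contrapT => no.
have [e|/eqP|/eqP] := conn B; [|exact/negP|exact/negP].
by move=> Be; case: no; exists e.
Qed.

(* The edges of S cut the graph into the two sides of A, and the side A still
   has a cycle: the edge b of A is not a bridge. *)
Definition split_state S A (b : E) : Prop :=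
  [/\ off_cut S A, A != finset.set0 /\ A != [set: V]%SET,
      forall B, off_cut S B ->
        [\/ B = finset.set0, B = [set: V]%SET, B = A | B = ~: A],
      [/\ b \notin S, src b \in A & tgt b \in A]
    & forall B, off_cut (b |: S) B -> ~~ crosses B b].

(* A chip sits on the edge e of S at its end w in A; moving it to another edge
   f at w reconnects the graph, or leaves a smaller side with a cycle. *)
Lemma split_step S A b e w : split_state S A b -> e \in S -> crosses A e ->
  w \in A -> (src e == w) || (tgt e == w) ->
  exists f, [/\ f \notin S, (src f == w) || (tgt f == w)
    & cut_free (f |: (S :\ e)) \/ exists B, (#|B| < #|A|)%N /\ split_state (f |: (S :\ e)) B b].
Proof.
move=> [offA [A0 AT] only [bS sbA tbA] nb] eS eA wA ew.
pose S' f := f |: (S :\ e).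
have [u [uA eB]] : exists u, u \notin A /\
    forall B, crosses B e = ((w \in B) != (u \in B)).
  case/orP: ew => /eqP we; rewrite -?we in wA *.
    by exists (tgt e); split=> //; move: eA; rewrite /crosses wA; case: (_ \in _).
  exists (src e); split; first by move: eA; rewrite /crosses wA; case: (_ \in _).
  by move=> B; rewrite /crosses eq_sym.
have eS' f : f \notin S -> e \notin S' f.
  by move=> fS; rewrite !inE eqxx /= orbF; apply: contraNneq fS => <-.
have A_e : crosses A e by [].
have Ac_e : crosses (~: A) e by rewrite crossesC.
have offS f B : off_cut (S' f) B -> ~~ crosses B f -> off_cut S B.
  move=> oB nf g gB; have := oB g gB; rewrite !inE => /orP[/eqP gf|/andP[]//].
  by move: gB; rewrite gf (negPf nf).
(* The only nontrivial cut inside [S] is that of [A], and [e] crosses it. *)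
have triv B : off_cut S B -> ~~ crosses B e -> B = finset.set0 \/ B = [set: V]%SET.
  move=> /only[] ->; [by left|by right|by rewrite A_e|by rewrite Ac_e].
apply: contrapT => none.
(* Suppose no replacement works. Then every candidate [f] at [w] leaves a nontrivial cut, and its
   side [B] can be taken away from [w] by passing to the complement. *)
have bad f : f \notin S -> (src f == w) || (tgt f == w) ->
    exists B, [/\ off_cut (S' f) B, B != finset.set0 & w \notin B].
  move=> fS fw; apply: contrapT => noB; apply: none; exists f; split=> //; left=> B oB.
  have [->|B0] := eqVneq B finset.set0; first by left.
  have [->|BT] := eqVneq B [set: V]%SET; first by right.
  case: noB; have [wB|wB] := boolP (w \in B); last by exists B.
  exists (~: B); split; [exact/off_cutC| |by rewrite inE wB].
  by apply: contraNneq BT => BC0; rewrite -[B]finset.setCK BC0 finset.setC0.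
have badP f B : f \notin S -> (src f == w) || (tgt f == w) -> off_cut (S' f) B ->
    B != finset.set0 -> w \notin B -> [/\ crosses B f, ~~ crosses B e & B \subset A].
  move=> fS fw oB B0 wB.
  have nBe : ~~ crosses B e by apply/negP => /oB; apply/negP/eS'.
  have BT : B != [set: V]%SET by apply: contraNneq wB => ->; rewrite finset.in_setT.
  have Bf : crosses B f.
    apply: contrapT => /negP nf; have [h|h] := triv _ (offS _ _ oB nf) nBe.
      by rewrite h eqxx in B0.
    by rewrite h eqxx in BT.
  split=> //; rewrite -finset.setD_eq0; apply/eqP.
  have uB : u \notin B by move: nBe; rewrite eB (negPf wB); case: (u \in B).
  have fA : (src f \in A) = (tgt f \in A).
    by apply/eqP; apply: contraNT fS => /offA.
  have fAA : (src f \in A) && (tgt f \in A).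
    by case/orP: fw => /eqP we; rewrite we wA in fA *; rewrite -?fA // fA.
  (* The cut of [B :\: A] lies in [S] and avoids [e], so this set is trivial; it misses [w], so it
     is empty. *)
  have [||//|h] := triv (B :\: A).
  - move=> g; have [->|gf] := eqVneq g f.
      by rewrite /crosses !inE; case/andP: fAA => -> ->.
    have [gA _|gA] := boolP (crosses A g); first exact: offA.
    move=> gBA; have : crosses B g.
      move: gBA gA; rewrite /crosses !inE negbK => h /eqP hA; move: h; rewrite hA.
      by case: (tgt g \in A).
    by move/oB; rewrite !inE (negPf gf) => /andP[].
  - by rewrite eB !inE (negPf wB) (negPf uB) !andbF.
  by have := finset.in_setT w; rewrite -h !inE (negPf wB) andbF.
have bad' f : exists B, f \notin S -> (src f == w) || (tgt f == w) ->
    [/\ off_cut (S' f) B, B != finset.set0 & w \notin B].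
  have [fS|fS] := boolP (f \in S); first by exists finset.set0.
  have [fw|fw] := boolP ((src f == w) || (tgt f == w)); last by exists finset.set0.
  by have [B ?] := bad f fS fw; exists B.
have [F FP] := choice bad'.
(* If [b] met [w], it would itself be a candidate, and the resulting cut would contradict that [b]
   is not a bridge. *)
have bw : ~~ ((src b == w) || (tgt b == w)).
  apply/negP => bw; have [oB B0 wB] := FP b bS bw.
  have [bB _ _] := badP b _ bS bw oB B0 wB.
  suff /nb/negP : off_cut (b |: S) (F b) by apply.
  by move=> g /oB; rewrite !inE => /orP[->//|/andP[_ ->]]; rewrite orbT.
(* [Y] is what remains of [A] without [w] and the sides cut off by the candidates. Its cut lies in
   [S] and avoids [e], so [Y] is empty, and the source of [b] lies in one of these sides. *)
pose Y := A :\: [set v | (v == w) ||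
  [exists f, [&& f \notin S, (src f == w) || (tgt f == w) & v \in F f]]]%SET.
have inY v : (v \in Y) = [&& v \in A, v != w &
    ~~ [exists f, [&& f \notin S, (src f == w) || (tgt f == w) & v \in F f]]].
  by rewrite !inE negb_or andbC.
have outY v : v \in A -> v \notin Y -> v = w \/ exists f,
    [/\ f \notin S, (src f == w) || (tgt f == w) & v \in F f].
  move=> vA; rewrite inY vA /= negb_and !negbK => /orP[/eqP->|/existsP[f /and3P[]]].
    by left.
  by right; exists f.
have offY : off_cut S Y.
  move=> g gY; apply: contrapT => /negP gS.
  have gA : (src g \in A) = (tgt g \in A) by apply/eqP; apply: contraNT gS => /offA.
  have key y x : y \in Y -> x \notin Y -> x \in A ->
      (forall B, crosses B g = ((x \in B) != (y \in B))) ->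
      (src g == x) || (tgt g == x) -> ((src g == w) || (tgt g == w) -> x = w \/ y = w) -> False.
    move=> yY xY xA gE gx gw; move: yY; rewrite inY => /and3P[yA yw /existsP nyF].
    have [xw|[f [fS fw xF]]] := outY x xA xY.
      rewrite xw in gx gE; have [oB B0 wB] := FP g gS gx.
      have [gB _ _] := badP g _ gS gx oB B0 wB.
      apply: nyF; exists g; rewrite gS gx /=; move: gB; rewrite gE (negPf wB).
      by case: (y \in _).
    have [oB B0 wB] := FP f fS fw.
    have yF : y \notin F f.
      by apply/negP => yF; apply: nyF; exists f; rewrite fS fw.
    have /oB : crosses (F f) g by rewrite gE xF (negPf yF).
    rewrite !inE (negPf gS) andbF orbF => /eqP gf; rewrite -gf in fw.
    case: (gw fw) => h; last by rewrite h eqxx in yw.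
    by rewrite h (negPf wB) in xF.
  have gY' := gY; move: gY'; rewrite /crosses.
  have [sY|sY] := boolP (src g \in Y); have [tY|tY] := boolP (tgt g \in Y) => // _.
    apply: (key (src g) (tgt g)) => //.
    - by rewrite -gA; move: sY; rewrite inY => /and3P[].
    - by move=> B; rewrite /crosses eq_sym.
    - by rewrite eqxx orbT.
    - by case/orP => /eqP; [right|left].
  apply: (key (tgt g) (src g)) => //.
  - by rewrite gA; move: tY; rewrite inY => /and3P[].
  - by rewrite eqxx.
  - by case/orP => /eqP; [left|right].
have Y0 : Y = finset.set0.
  have wY : w \notin Y by rewrite inY eqxx andbF.
  have uY : u \notin Y by rewrite inY (negPf uA).
  have [|//|h] := triv _ offY; first by rewrite eB (negPf wY) (negPf uY).
  by have := finset.in_setT w; rewrite -h (negPf wY).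
have [|sw|[f [fS fw sF]]] := outY (src b) sbA; first by rewrite Y0 finset.in_set0.
  by rewrite sw eqxx in bw.
have [oB B0 wB] := FP f fS fw; have [Bf Be BA] := badP f _ fS fw oB B0 wB.
have bf : b != f by apply: contraNneq bw => ->.
have bS' : b \notin S' f by rewrite !inE (negPf bf) (negPf bS) andbF.
have bB : ~~ crosses (F f) b by apply/negP => /oB; apply/negP.
(* The side [F f] contains both ends of [b] and lies in [A] without [w], so it is a smaller side as
   required. *)
apply: none; exists f; split=> //; right; exists (F f); split.
  apply: proper_card; rewrite properE BA /=.
  by apply/negP => /fintype.subsetP/(_ w wA); apply/negP.
(* Both sides are crossed by [f], so the cut of their symmetric difference lies in [S] and avoids
   [e]. *)
have uniqB B2 : off_cut (S' f) B2 -> B2 != finset.set0 -> w \notin B2 -> B2 = F f.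
  move=> o2 n2 w2; have [f2 e2 _] := badP f _ fS fw o2 n2 w2.
  apply: symdiff_eq0; have [||//|h] := triv (symdiff B2 (F f)).
  - move=> g; rewrite crosses_symdiff => gg.
    have gf : g != f by apply: contraTneq gg => ->; rewrite f2 Bf.
    have : g \in S' f.
      by move: gg; case: (boolP (crosses B2 g)) => [/o2//|_ /oB].
    by rewrite !inE (negPf gf) => /andP[].
  - by rewrite crosses_symdiff (negPf e2) (negPf Be).
  by have := finset.in_setT w; rewrite -h in_symdiff (negPf wB) (negPf w2).
split=> //.
- split=> //; apply: contraNneq wB => ->; exact: finset.in_setT.
- move=> B2 o2; have [->|n2] := eqVneq B2 finset.set0; first by constructor 1.
  have [->|t2] := eqVneq B2 [set: V]%SET; first by constructor 2.
  have [w2|w2] := boolP (w \in B2); last by constructor 3; exact: uniqB.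
  constructor 4; rewrite -[LHS]finset.setCK; congr (~: _); apply: uniqB.
  + exact/off_cutC.
  + by apply: contraNneq t2 => BC0; rewrite -[B2]finset.setCK BC0 finset.setC0.
  + by rewrite inE w2.
- split=> //; by move: bB; rewrite /crosses sF; case: (tgt b \in _).
move=> B2 o2; apply/negP => b2.
have [f2|f2] := boolP (crosses B2 f); last first.
  suff /nb/negP : off_cut (b |: S) B2 by apply.
  move=> g g2; have := o2 g g2; rewrite !inE.
  case/or3P => [->//|/eqP gf|/andP[_ ->]]; last by rewrite orbT.
  by move: g2; rewrite gf (negPf f2).
(* Adding the cut of [F f], which does not contain [b], removes [f] from a cut through both [b] and
   [f]. *)
suff /nb/negP : off_cut (b |: S) (symdiff B2 (F f)).
  by apply; rewrite crosses_symdiff b2 (negPf bB).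
move=> g; rewrite crosses_symdiff => gg.
have gf : g != f by apply: contraTneq gg => ->; rewrite f2 Bf.
have : g \in b |: S' f.
  by move: gg; case: (boolP (crosses B2 g)) => [/o2//|_ /oB gS']; rewrite inE gS' orbT.
by rewrite !inE (negPf gf) /= => /orP[->//|/andP[_ ->]]; rewrite orbT.
Qed.

End Cuts.

(** * Semibreak divisors *)

Section Semibreak.
Context {R : realType} {X : metricType R} (G : model X).
Local Notation E := 'I_(nedge G).
Local Notation V := 'I_(nvert G).
Local Notation chain := 'rV[R]_(nedge G).
Local Notation bd := (boundary_mx G).
Local Notation srcG := (@src R X G).
Local Notation tgtG := (@tgt R X G).
Implicit Types (e f : E) (v w : V) (S : {set E}) (A B : {set V}) (a : E -> R) (z : chain).

Lemma cycle_cut z B : z *m bd = 0 ->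
  \sum_(e | tgt e \in B) z 0 e = \sum_(e | src e \in B) z 0 e.
Proof.
move=> z0; apply/eqP; rewrite -subr_eq0; apply/eqP.
have : \sum_(v in B) (z *m bd) 0 v = 0 by rewrite z0 big1 // => v _; rewrite mxE.
under eq_bigr do rewrite bdE.
rewrite sumrB (exchange_big_dep (fun e => tgt e \in B)) /=; last by move=> v e vB /eqP->.
rewrite [X in _ - X](exchange_big_dep (fun e => src e \in B)) /=; last by move=> v e vB /eqP->.
move=> e0; apply: etrans e0; congr (_ - _); apply: eq_bigr => e eB.
  by rewrite (big_pred1 (tgt e)) // => v; rewrite /= eq_sym; case: eqP => [->|]; rewrite ?eB ?andbF.
by rewrite (big_pred1 (src e)) // => v; rewrite /= eq_sym; case: eqP => [->|]; rewrite ?eB ?andbF.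
Qed.

(** The net flow of a cycle through a cut is zero, so it cannot be carried by a single edge. *)
Lemma cycle_cross z B b : z *m bd = 0 -> (forall e, crosses srcG tgtG B e -> e != b -> z 0 e = 0) ->
  crosses srcG tgtG B b -> z 0 b = 0.
Proof.
move=> /(@cycle_cut z B) zB zcr bB.
have : \sum_e (z 0 e * (tgt e \in B)%:R - z 0 e * (src e \in B)%:R) = 0.
  rewrite sumrB; apply/eqP; rewrite subr_eq0; apply/eqP; move: zB.
  rewrite big_mkcond [in RHS]big_mkcond /= => zB.
  transitivity (\sum_e if tgt e \in B then z 0 e else 0).
    by apply: eq_bigr => e _; case: (_ \in B); rewrite ?mulr1 ?mulr0.
  by rewrite zB; apply: eq_bigr => e _; case: (_ \in B); rewrite ?mulr1 ?mulr0.
rewrite (bigD1 b) //= big1 ?addr0 => [|e eb]; last first.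
  have [/zcr/(_ eb)->|] := boolP (crosses srcG tgtG B e); first by rewrite !mul0r subrr.
  by rewrite /crosses negbK => /eqP->; rewrite subrr.
by move: bB; rewrite /crosses; case: (src b \in B); case: (tgt b \in B) => // _;
  rewrite mulr0 mulr1 ?subr0 // sub0r => /eqP; rewrite oppr_eq0 => /eqP.
Qed.

(** Vanishing on [S] amounts to [#|S|] linear conditions on the cycle space, of dimension [genus G].
    An edge [b] in the support of the cycle is not a bridge once [S] is deleted. *)
Lemma cycle_avoiding S : (#|S| < genus G)%N ->
  exists z b, [/\ z *m bd = 0, forall e, e \in S -> z 0 e = 0 & z 0 b != 0].
Proof.
move=> Sg; pose sel : 'M[R]_(nedge G, #|S|) := \matrix_(e, i) (e == enum_val i)%:R.
have : (0 < \rank (kermx bd :&: kermx sel)%MS)%N.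
  have := mxrank_mul_ker (kermx bd) sel; rewrite -/(genus G) => rk.
  have := rank_leq_col (kermx bd *m sel) => le.
  rewrite lt0n; apply: contraTneq Sg => r0.
  by rewrite -leqNgt -rk r0 addn0.
rewrite lt0n mxrank_eq0 => /rowV0Pn[z].
rewrite sub_capmx => /andP[/sub_kermxP z0 /sub_kermxP zS] /eqP zn.
have [b zb] : exists b, z 0 b != 0.
  apply: contrapT => no; apply: zn; apply/rowP => e; rewrite mxE.
  by apply/eqP; apply: contrapT => /negP h; apply: no; exists e.
exists z, b; split=> // e eS.
have := congr1 (fun A : 'rV_#|S| => A 0 (enum_rank_in eS e)) zS; rewrite !mxE => <-.
rewrite (bigD1 e) //= !mxE enum_rankK_in // eqxx mulr1 big1 ?addr0 // => f fe.
by rewrite !mxE enum_rankK_in // (negPf fe) mulr0.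
Qed.

Hypothesis conn : cut_connected G.
Variables (c : V -> chain) (b0 : 'rV[R]_(nvert G)).
Hypothesis cP : forall v, c v \is a mxOver Num.int /\ c v *m bd = delta_mx 0 v - b0.

Definition point_Jac (p : X) : Jac G := chain_Jac (kappa c p).

Definition chips_Jac S a : Jac G := \sum_(e in S) point_Jac (par e (a e)).

Definition chip_positions S a : Prop := forall e, e \in S -> 0 <= a e <= len e.

Lemma cut_free0 : cut_free srcG tgtG finset.set0.
Proof.
move=> B oB; apply: conn => e; apply/eqP; rewrite -[_ == _]negbK.
by apply/negP => /oB; rewrite finset.in_set0.
Qed.

(** The chain of the displacements is a coboundary up to lengths, hence zero in [Jac] by
    [chain_Jac_eq0] with the zero cycle. *)
Lemma chips_Jac_move S a a' (chi : V -> R) : chip_positions S a -> chip_positions S a' ->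
  (forall e, (if e \in S then a' e - a e else 0) = chi (tgt e) - chi (src e)) ->
  chips_Jac S a' = chips_Jac S a.
Proof.
move=> va va' chiE; apply: subr0_eq; rewrite /chips_Jac -sumrB.
rewrite (eq_bigr (fun e => chain_Jac (((a' e - a e) / len e) *: delta_mx 0 e))); last first.
  move=> e eS; rewrite /point_Jac !(chain_Jac_kappa_par cP) ?va ?va' // -chain_JacB.
  by congr chain_Jac; rewrite /edge_chain opprD addrACA subrr add0r -scalerBl mulrBl.
rewrite -raddf_sum; apply/chain_Jac_eq0; exists 0, chi; split; first exact: int_cycle0.
move=> e; rewrite mxE subr0 summxE -chiE; have [eS|eS] := boolP (e \in S).
  rewrite (bigD1 e) //= big1 => [|f /andP[_ /negPf fe]].
    by rewrite !mxE !eqxx mulr1 addr0 mulrC divfK // gt_eqF // len_gt0.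
  by rewrite !mxE [e == f]eq_sym fe andbF mulr0.
rewrite big1 ?mulr0 // => f fS; rewrite !mxE; have [ef|_] := eqVneq e f.
  by rewrite ef fS in eS.
by rewrite mulr0.
Qed.

Lemma chips_Jac_swap S a e f t : e \in S -> f \notin S -> par e (a e) = par f t ->
  chips_Jac (f |: (S :\ e)) (fun g => if g == f then t else a g) = chips_Jac S a.
Proof.
move=> eS fS ef; rewrite /chips_Jac big_setU1 /=; last by rewrite !inE (negPf fS) andbF.
rewrite eqxx -ef [RHS](big_setD1 e) //=; congr (_ + _); apply: eq_bigr => g.
rewrite !inE => /andP[_ gS]; case: eqP => // gf.
by rewrite gf (negPf fS) in gS.
Qed.

Lemma par_end a e w : (src e == w) || (tgt e == w) ->
  exists2 t, 0 <= t <= len e & par e t = vert w.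
Proof.
have l0 := len_gt0 e.
case/orP => /eqP <-; [exists 0; rewrite ?par_src|exists (len e); rewrite ?par_tgt] => //.
  by rewrite lexx ltW.
by rewrite lexx ltW.
Qed.

(** Induction on the size of the side [A] containing [b]. Firing the complement brings a chip of the
    cut to a vertex [w] of [A], and [split_step] hands it to another edge at [w]. *)
Lemma split_semibreak S A a b : split_state srcG tgtG S A b -> chip_positions S a ->
  exists S' a', [/\ #|S'| = #|S|, cut_free srcG tgtG S', chip_positions S' a' &
    chips_Jac S' a' = chips_Jac S a].
Proof.
have [n] := ubnP #|A|; elim: n A S a => // n IH A S a An st va.
have [offA [A0 AT] only _ _] := st.
have [e0 A_e0] := cut_free_crossing cut_free0 A0 AT.
(* The distance of a chip on the cut from its end in [A]; the minimum over the cut is how far all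
   these chips can move together. *)
pose dist e := if src e \in A then a e else len e - a e.
case: (@Order.TotalTheory.arg_minP _ R _ e0 (fun e => crosses srcG tgtG A e) dist A_e0) => e A_e e_min.
have eS := offA e A_e; have vae := va e eS.
pose a1 g := if crosses srcG tgtG A g then
  (if src g \in A then a g - dist e else a g + dist e) else a g.
have d0 : 0 <= dist e by rewrite /dist; case: ifP => _; lra.
have va1 : chip_positions S a1.
  move=> g gS; have := va g gS; rewrite /a1; have [A_g|//] := boolP (crosses srcG tgtG A g).
  have := e_min g A_g; rewrite [dist g]/dist.
  by case: (src g \in A) => /= h1 h2; lra.
have J1 : chips_Jac S a1 = chips_Jac S a.
  (* The potential is constant on each side, so only the edges of the cut see a displacement. *)
  apply: (@chips_Jac_move _ _ _ (fun v => if v \in A then dist e else 0)) => // g.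
  rewrite /a1; have [A_g|nA_g] := boolP (crosses srcG tgtG A g).
    rewrite (offA g A_g); move: A_g; rewrite /crosses.
    by case: (src g \in A); case: (tgt g \in A) => // _; lra.
  rewrite !subrr; move: nA_g; rewrite /crosses negbK => /eqP ->.
  by rewrite subrr; case: ifP.
pose w := if src e \in A then src e else tgt e.
have wA : w \in A.
  rewrite /w; move: A_e; rewrite /crosses.
  by case sA: (src e \in A) => //=; case: (tgt e \in A).
have ew : (src e == w) || (tgt e == w) by rewrite /w; case: ifP => _; rewrite eqxx ?orbT.
have parw : par e (a1 e) = vert w.
  rewrite /a1 A_e /w /dist; case: (src e \in A); first by rewrite subrr par_src.
  by rewrite addrC subrK par_tgt.
have [f [fS fw next]] := split_step st eS A_e wA ew.
have [t tI parf] := par_end a fw.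
pose S2 := f |: (S :\ e); pose a2 g := if g == f then t else a1 g.
have va2 : chip_positions S2 a2.
  move=> g; rewrite !inE /a2; case: eqP => [->//|_ /= /andP[_]]; exact: va1.
have J2 : chips_Jac S2 a2 = chips_Jac S a.
  by rewrite -J1; apply: chips_Jac_swap => //; rewrite parw parf.
have card2 : #|S2| = #|S|.
  by rewrite cardsU1 !inE (negPf fS) andbF [in RHS](cardsD1 e) eS.
case: next => [cf|[B [BA stB]]]; first by exists S2, a2.
have [|S3 [a3 [card3 cf3 va3 J3]]] := IH B S2 a2 _ stB va2.
  by rewrite -ltnS; apply: leq_trans BA _.
by exists S3, a3; rewrite card3 J3 J2.
Qed.

(** The new chip goes to an edge outside [S], after being moved to a vertex if it lies inside an
    edge of [S]. If the enlarged set separates the graph, a cycle avoiding [S] supplies the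
    non-bridge for [split_semibreak]. *)
Lemma semibreak_add S a (p : X) : (#|S| < genus G)%N -> cut_free srcG tgtG S ->
  chip_positions S a ->
  exists S' a', [/\ #|S'| = #|S|.+1, cut_free srcG tgtG S', chip_positions S' a' &
    chips_Jac S' a' = chips_Jac S a + point_Jac p].
Proof.
move=> Sg cf va; have [z [b [z0 zS zb]]] := cycle_avoiding Sg.
have bS : b \notin S by apply: contraNN zb => /zS ->.
have add_edge f t a1 : f \notin S -> 0 <= t <= len f -> chip_positions S a1 ->
    exists S' a', [/\ #|S'| = #|S|.+1, cut_free srcG tgtG S', chip_positions S' a' &
      chips_Jac S' a' = chips_Jac S a1 + point_Jac (par f t)].
  move=> fS tI va1; pose S1 := f |: S; pose a2 g := if g == f then t else a1 g.
  have card1 : #|S1| = #|S|.+1 by rewrite cardsU1 fS.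
  have va2 : chip_positions S1 a2.
    move=> g; rewrite !inE /a2; case: eqP => [->//|_ /=]; exact: va1.
  have J1 : chips_Jac S1 a2 = chips_Jac S a1 + point_Jac (par f t).
    rewrite /chips_Jac big_setU1 //= /a2 eqxx addrC; congr (_ + _).
    by apply: eq_bigr => g gS; case: eqP => // gf; rewrite -gf gS in fS.
  have [cf1|ncf1] := pselect (cut_free srcG tgtG S1); first by exists S1, a2.
  have [A [oA A0 AT]] : exists A, [/\ off_cut srcG tgtG S1 A, A != finset.set0 & A != [set: V]%SET].
    apply: contrapT => no; apply: ncf1 => B oB.
    have [->|B0] := eqVneq B finset.set0; first by left.
    have [->|BT] := eqVneq B [set: V]%SET; first by right.
    by case: no; exists B.
  have crf B : off_cut srcG tgtG S1 B -> ~~ crosses srcG tgtG B f ->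
      B = finset.set0 \/ B = [set: V]%SET.
    move=> oB nf; apply: cf => g gB; have := oB g gB; rewrite !inE => /orP[/eqP gf|//].
    by move: gB; rewrite gf (negPf nf).
  have A_f : crosses srcG tgtG A f.
    apply: contrapT => /negP /(crf _ oA)[] h; first by rewrite h eqxx in A0.
    by rewrite h eqxx in AT.
  (* On the cut of [A] the cycle could only flow through [f], so it avoids [f] too; hence [b] is not
     a bridge after deleting [S1]. *)
  have zf : z 0 f = 0.
    apply: (@cycle_cross z A f) => // g /oA; rewrite !inE => /orP[->//|gS _].
    exact: zS.
  have zS1 e : e \in S1 -> z 0 e = 0 by rewrite !inE => /orP[/eqP->|/zS].
  have bS1 : b \notin S1 by apply: contraNN zb => /zS1 ->.
  have nb B : off_cut srcG tgtG (b |: S1) B -> ~~ crosses srcG tgtG B b.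
    move=> oB; apply: contraNN zb => B_b; apply/eqP; apply: (@cycle_cross z B b) => // g /oB.
    by rewrite in_setU1 => /orP[->//|/zS1].
  have only B : off_cut srcG tgtG S1 B ->
      [\/ B = finset.set0, B = [set: V]%SET, B = A | B = ~: A].
    move=> oB; have [B_f|nB_f] := boolP (crosses srcG tgtG B f); last first.
      by have [->|->] := crf B oB nB_f; [constructor 1|constructor 2].
    have [||h|h] := crf (symdiff B A).
    - move=> g; rewrite crosses_symdiff.
      by case: (boolP (crosses srcG tgtG B g)) => [/oB//|_ /oA].
    - by rewrite crosses_symdiff B_f A_f.
    - by constructor 3; exact: symdiff_eq0.
    constructor 4; apply/setP => v; have := in_symdiff B A v.
    by rewrite h finset.in_setT inE; case: (v \in A); case: (v \in B).
  have bA : (src b \in A) = (tgt b \in A).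
    by apply/eqP; apply: contraNT bS1 => /oA.
  have [sb|sb] := boolP (src b \in A).
    have [|S' [a' [cS' cf' va' J']]] := @split_semibreak S1 A a2 b _ va2.
      by split=> //; split=> //; rewrite -bA.
    by exists S', a'; rewrite cS' J' card1 J1.
  have [|S' [a' [cS' cf' va' J']]] := @split_semibreak S1 (~: A) a2 b _ va2.
    split=> //.
    - exact/off_cutC.
    - split; first by apply: contraNneq AT => h; rewrite -[A]finset.setCK h finset.setC0.
      by apply: contraNneq A0 => h; rewrite -[A]finset.setCK h finset.setCT.
    - move=> B /only[]->; [by constructor 1|by constructor 2|constructor 4|by constructor 3].
      by rewrite finset.setCK.
    - by split=> //; rewrite inE -?bA.
  by exists S', a'; rewrite cS' J' card1 J1.
have add_vert v a1 : chip_positions S a1 ->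
    exists S' a', [/\ #|S'| = #|S|.+1, cut_free srcG tgtG S', chip_positions S' a' &
      chips_Jac S' a' = chips_Jac S a1 + point_Jac (vert v)].
  move=> va1.
  (* If all edges at [v] were in [S], deleting [S] would isolate [v], so [v] would be the only
     vertex; but then [b], which is not in [S], is at [v]. *)
  have [f [fS fv]] : exists f, f \notin S /\ ((src f == v) || (tgt f == v)).
    apply: contrapT => no; have [e|h|h] := cf [set v]%SET.
    - rewrite /crosses !finset.in_set1 => ev; apply: contrapT => /negP eS; apply: no; exists e.
      by split=> //; move: ev; case: (src e == v); case: (tgt e == v).
    - by have := finset.set11 v; rewrite h finset.in_set0.
    apply: no; exists b; split=> //.
    by have := finset.in_setT (src b); rewrite -h finset.in_set1 => ->.
  have [t tI <-] := par_end a fv; exact: add_edge.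
have [[v ->]|[f [t [tI ->]]]] := model_cover G p; first exact: add_vert.
have [fS|fS] := boolP (f \in S); last by apply: add_edge => //; lra.
(* Two chips on [f] slide in opposite directions, keeping the sum of their positions, until one of
   them reaches an end of [f]. *)
have [a1 [v [va1 J1]]] : exists a1 v, chip_positions S a1 /\
    chips_Jac S a1 + point_Jac (vert v) = chips_Jac S a + point_Jac (par f t); last first.
  by have [S' [a' [? ? ? ?]]] := add_vert v a1 va1; exists S', a'; rewrite -J1.
have vaf := va f fS.
have J_move u s : 0 <= u <= len f -> 0 <= s <= len f -> u + s = a f + t ->
    chips_Jac S (fun g => if g == f then u else a g) + point_Jac (par f s) =
    chips_Jac S a + point_Jac (par f t).
  move=> uI sI us; rewrite /chips_Jac (big_setD1 f) //= [in RHS](big_setD1 f) //= eqxx.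
  rewrite addrAC [RHS]addrAC; congr (_ + _); last first.
    by apply: eq_bigr => g; rewrite !inE => /andP[/negPf->].
  have tI' : 0 <= t <= len f by lra.
  rewrite /point_Jac !(chain_Jac_kappa_par cP) // -!chain_JacD; congr chain_Jac.
  rewrite /edge_chain addrACA [RHS]addrACA.
  by congr (_ + _); rewrite -scalerDl -mulrDl us mulrDl scalerDl.
have v_move u : 0 <= u <= len f -> chip_positions S (fun g => if g == f then u else a g).
  by move=> uI g gS; case: eqP => [->//|_]; exact: va.
have [h|h] := lerP (a f + t) (len f).
  exists (fun g => if g == f then a f + t else a g), (src f); rewrite -par_src.
  by split; [apply: v_move|apply: J_move]; lra.
exists (fun g => if g == f then a f + t - len f else a g), (tgt f); rewrite -par_tgt.
by split; [apply: v_move|apply: J_move]; lra.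
Qed.

Lemma semibreak_exists d (x : 'I_d -> X) : (d <= genus G)%N ->
  exists S a, [/\ #|S| = d, cut_free srcG tgtG S, chip_positions S a &
    chips_Jac S a = \sum_i point_Jac (x i)].
Proof.
elim: d x => [|d IH] x dg.
  exists finset.set0, (fun=> 0); rewrite cards0 /chips_Jac big_set0 big_ord0.
  by split=> //; [exact: cut_free0|move=> e; rewrite finset.in_set0].
have [S [a [cS cf va J]]] := IH (fun i => x (widen_ord (leqnSn d) i)) (ltnW dg).
have [|S' [a' [cS' cf' va' J']]] := @semibreak_add S a (x ord_max) _ cf va.
  by rewrite cS.
by exists S', a'; rewrite cS' cS J' J big_ord_recr.
Qed.

End Semibreak.

(** * Generic divisors are rigid *)

Section Effective.
Context {R : realType} {X : metricType R}.
Implicit Types (D : {freeg X}) (p : X).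

Lemma effectiveP D : reflect (forall p, 0 <= coeff p D) (effective D).
Proof. exact: fgposP. Qed.

Lemma effectiveD D1 D2 : effective D1 -> effective D2 -> effective (D1 + D2).
Proof.
move=> /effectiveP h1 /effectiveP h2; apply/effectiveP => p.
by rewrite coeffD addr_ge0.
Qed.

Lemma fsum_ge0 (S : numDomainType) (f : X -> S) D :
  effective D -> (forall p, 0 <= f p) -> 0 <= fsum f D.
Proof.
by move=> /effectiveP D0 f0; apply: sumr_ge0 => p _; rewrite mulrz_ge0.
Qed.

Lemma effective_deg_eq0 D : effective D -> deg D = 0 -> D = 0.
Proof.
move=> /effectiveP D0; rewrite fsum_deg /fsum => /eqP.
rewrite psumr_eq0 => [/allP h|p _]; last by rewrite intz.
apply/eqP; rewrite -dom_eq0; apply/eqP; case: (dom D) (mem_dom D) h => // p s pD h.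
by have := pD p; rewrite mem_head; have /implyP/(_ isT) := h p (mem_head _ _); rewrite intz => ->.
Qed.

Lemma effective_points_sum d D : effective D -> deg D = d%:Z ->
  exists x : 'I_d -> X, D = \sum_i << x i >>.
Proof.
elim: d D => [|d IH] D D0 Dd.
  have x : 'I_0 -> X by case.
  by exists x; rewrite big_ord0; exact: effective_deg_eq0.
have [p pD] : exists p, p \in dom D.
  case E : (dom D) => [|p s]; last by exists p; rewrite mem_head.
  by move/eqP: E; rewrite dom_eq0 => /eqP D00; move: Dd; rewrite D00 deg0.
have [||x xE] := IH (D - << p >>).
- apply/effectiveP => y; rewrite coeffB coeffU mul1r.
  have /effectiveP/(_ y) := D0; case: eqVneq => [<-|_]; last by rewrite subr0.
  by move: pD; rewrite mem_dom subr_ge0 => h1 h2; rewrite -gtz0_ge1 lt_neqAle eq_sym h1.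
- by rewrite degB degU Dd -addn1 PoszD addrK.
exists (fun i => if unlift ord0 i is Some j then x j else p).
rewrite big_ord_recl unlift_none addrC -(subrK << p >> D) xE.
by congr (_ + _); apply: eq_bigr => i _; rewrite liftK.
Qed.

End Effective.

Section Rigidity.
Context {R : realType} {X : metricType R} (G : model X).
Local Notation E := 'I_(nedge G).
Local Notation V := 'I_(nvert G).
Local Notation srcG := (@src R X G).
Local Notation tgtG := (@tgt R X G).
Implicit Types (e : E) (v w : V) (D : {freeg X}).

Definition generic d (x : 'I_d -> X) : Prop := exists e : 'I_d -> E,
  [/\ injective e, cut_free srcG tgtG [set e i | i in 'I_d]%SET & forall i, inner (e i) (x i)].

Lemma ler_intM (a b : int) (y : R) : 0 < y -> a <= b -> a%:~R * y <= b%:~R * y.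
Proof. by move=> y0 ab; rewrite ler_wpM2r ?ler_int // ltW. Qed.

(** Removing one chip from the open edge leaves an effective divisor with none there, so [tsum] is
    the position of the removed chip. *)
Lemma effective_inner D e : effective D -> nsum e D = 1 ->
  exists2 p, inner e p & 0 < coeff p D /\ tsum e D = pos e p.
Proof.
move=> D0 n1; have /effectiveP D0' := D0.
have [p [ip cp]] : exists p, inner e p /\ 0 < coeff p D.
  apply: contrapT => no; suff h : nsum e D = 0 by rewrite h in n1.
  rewrite /nsum /fsum big1 // => p _; have [ip|ip] := boolP (inner e p); last by rewrite mul0rz.
  have [c0|c0] := ltrP 0 (coeff p D); first by case: no; exists p.
  have -> : coeff p D = 0 by apply/eqP; rewrite eq_le c0 D0'.
  by rewrite mulr0z.
exists p => //; split=> //; pose D' := D - << p >>.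
have D'0 : effective D'.
  apply/effectiveP => y; rewrite coeffB coeffU mul1r; have := D0' y.
  case: eqVneq => [<-|_]; last by rewrite subr0.
  by rewrite subr_ge0 -gtz0_ge1.
have /effectiveP D'0' := D'0.
have n0 : nsum e D' = 0 by rewrite /nsum fsumB fsumU ip -/(nsum e D) n1 subrr.
have t0 : tsum e D' = 0.
  rewrite /tsum /fsum big1_seq // => y /andP[_ yD].
  have [iy|iy] := boolP (inner e y); last by rewrite pos_out // mul0rz.
  move: n0; rewrite /nsum /fsum (bigD1_seq y) ?uniq_dom //= iy intz => /eqP.
  rewrite paddr_eq0 ?D'0' //; last first.
    by apply: sumr_ge0 => z _; rewrite mulrz_ge0 ?D'0'.
  by case/andP => /eqP ->; rewrite mulr0z.
by move: t0; rewrite /tsum fsumB fsumU => /eqP; rewrite subr_eq0 => /eqP.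
Qed.

(* Let A be the set of vertices where chi is maximal. On an edge outside S the
   function is convex, on an edge of S its slope drops once, by one, in the
   interior; so by integrality no edge leaves A with positive slope.  The vertex
   condition then makes all slopes at A vanish, whence the edges leaving A are in
   S and A contains all vertices. *)
Lemma max_rigid (v0 : V) (S : {set E}) (chi : V -> R) (m l n : E -> int)
    (a t : E -> R) (k : V -> int) :
  cut_free srcG tgtG S ->
  (forall f, 0 <= n f) -> (forall f, 0 <= t f <= (n f)%:~R * len f) ->
  (forall f, l f = m f - (f \in S)%:R + n f) ->
  (forall f, f \in S -> 0 < a f < len f) -> (forall f, f \notin S -> a f = 0) ->
  (forall f, chi (tgt f) = chi (src f) + (l f)%:~R * len f + (a f - t f)) ->
  (forall v, 0 <= k v) ->
  (forall v, - k v = \sum_(f | tgt f == v) l f - \sum_(f | src f == v) m f) ->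
  forall f, n f = (f \in S)%:R /\ t f = a f.
Proof.
move=> cf n0 tI lE aS anS chiE k0 kE.
(* Here [n], [t] and [k] are the chip counts, position sums and vertex coefficients of the effective
   divisor, [a] holds the positions of the generic chips, and [m], [l] are the slopes at the source
   and target of an edge. *)
have lS f : f \in S -> l f = m f - 1 + n f by rewrite lE => ->.
have lnS f : f \notin S -> l f = m f + n f by rewrite lE => /negPf->; rewrite subr0.
case: (@Order.TotalTheory.arg_maxP _ R _ v0 xpredT chi isT) => v1 _ max_v1.
have v1_max w : chi w <= chi v1 by exact: max_v1.
pose A := [set v | chi v == chi v1]%SET.
have inA v : v \in A -> chi v = chi v1 by rewrite inE => /eqP.
have leA v w : v \in A -> chi w <= chi v by move/inA->; exact: v1_max.
have leA' v w : v \in A -> chi v <= chi w -> w \in A.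
  by move=> /inA vA vw; rewrite inE eq_le v1_max // -vA.
(* With initial slope at least 1, the value at the target would exceed the maximum: a generic chip
   lowers the slope by one only after an interior point, and the other chips raise it. *)
have src_le f : src f \in A -> m f <= 0.
  move=> fA; rewrite leNgt gtz0_ge1; apply/negP => m1.
  have := leA _ (tgt f) fA; rewrite chiE => h; have := tI f.
  have [fS|fS] := boolP (f \in S).
    have /(ler_intM (len_gt0 f)) : n f <= l f by rewrite lS //; lra.
    by have := aS f fS; lra.
  have /(ler_intM (len_gt0 f)) : n f + 1 <= l f by rewrite lnS //; lra.
  by rewrite rmorphD /= (anS _ fS) in h *; have := len_gt0 f; lra.
have tgt_ge f : tgt f \in A -> 0 <= l f.
  move=> fA; rewrite leNgt; apply/negP => lneg.
  have /(ler_intM (len_gt0 f)) : l f <= -1 by move: lneg; rewrite -lezD1; lra.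
  rewrite rmorphN /= => h1; have := leA _ (src f) fA; rewrite chiE => h; have := tI f.
  have [fS|fS] := boolP (f \in S); first by have := aS f fS; lra.
  by rewrite (anS _ fS) in h; have := len_gt0 f; lra.
(* The vertex condition writes [- k v], which is at most zero, as a sum of nonnegative terms, so
   they all vanish. *)
have zero v : v \in A -> [/\ k v = 0, forall f, tgt f = v -> l f = 0
    & forall f, src f = v -> m f = 0].
  move=> vA; have := kE v.
  have L0 : 0 <= \sum_(f | tgt f == v) l f.
    by apply: sumr_ge0 => f /eqP fv; apply: tgt_ge; rewrite fv.
  have M0 : 0 <= \sum_(f | src f == v) - m f.
    by apply: sumr_ge0 => f /eqP fv; rewrite oppr_ge0; apply: src_le; rewrite fv.
  have kv := k0 v; rewrite -sumrN => eq0.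
  have L00 : \sum_(f | tgt f == v) l f = 0 by lra.
  have M00 : \sum_(f | src f == v) - m f = 0 by lra.
  split; first lra.
    move=> f fv; move/eqP: L00; rewrite psumr_eq0 => [/allP/(_ f (mem_index_enum _))|g /eqP gv].
      by rewrite fv eqxx => /eqP.
    by apply: tgt_ge; rewrite gv.
  move=> f fv; move/eqP: M00; rewrite psumr_eq0 => [/allP/(_ f (mem_index_enum _))|g /eqP gv].
    by rewrite fv eqxx oppr_eq0 => /eqP.
  by rewrite oppr_ge0; apply: src_le; rewrite gv.
have AT : A = [set: V]%SET.
  have [f fA|A0|//] := cf A; last first.
    by have := finset.in_set0 v1; rewrite -A0 inE eqxx.
  apply: contrapT => /negP fS; have := chiE f; rewrite (anS f fS) => chif.
  have := fA; rewrite /crosses.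
  have [sA|sA] := boolP (src f \in A).
    have [_ _ /(_ f erefl) m0] := zero _ sA.
    rewrite (leA' _ _ sA) //; move: chif; rewrite lnS // m0 add0r.
    by have := tI f; lra.
  have [tA|//] := boolP (tgt f \in A).
  have [_ /(_ f erefl) l0 _] := zero _ tA.
  suff : src f \in A by rewrite (negPf sA).
  by apply: (leA' _ _ tA); move: chif; rewrite l0 mul0r; have := tI f; lra.
have allA v : v \in A by rewrite AT finset.in_setT.
move=> f; have [_ /(_ f erefl) l0 _] := zero _ (allA (tgt f)).
have [_ _ /(_ f erefl) m0] := zero _ (allA (src f)).
split; first by move: (lE f); rewrite l0 m0; lra.
by have := chiE f; rewrite l0 (inA _ (allA (tgt f))) (inA _ (allA (src f))); lra.
Qed.

(** By [max_rigid] the two divisors have the same chip count and position sum on every open edge. A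
    single chip is determined by its position, so [D] minus the generic divisor is effective of
    degree zero. *)
Lemma generic_rigid (v0 : V) d (x : 'I_d -> X) D chi m : generic x -> effective D ->
  edge_data (G := G) (\sum_i << x i >> - D) chi m -> D = \sum_i << x i >>.
Proof.
move=> [e [e_inj cf ex]] D0 ed; have [chiE mE] := ed.
have /effectiveP D0' := D0.
pose S := [set e i | i in 'I_d]%SET.
set D1 := \sum_i << x i >> in ed chiE mE *.
have n1 f : nsum f D1 = (f \in S)%:R.
  rewrite /nsum fsum_bigU; have [/imsetP[i _ ->]|fS] := boolP (f \in S).
    have [_ xE] := innerP (ex i).
    rewrite (bigD1 i) //= ex big1 ?addr0 // => j ji.
    have [tj ->] := innerP (ex j); rewrite inner_par // (inj_eq e_inj).
    by rewrite eq_sym (negPf ji).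
  rewrite big1 // => j _; have [tj ->] := innerP (ex j); rewrite inner_par //.
  by case: eqP => // fj; rewrite fj imset_f in fS.
have t1S i : tsum (e i) D1 = pos (e i) (x i).
  rewrite /tsum fsum_bigU (bigD1 i) //= big1 ?addr0 // => j ji.
  rewrite pos_out //; have [tj ->] := innerP (ex j); rewrite inner_par //.
  by rewrite (inj_eq e_inj) eq_sym.
have chips f : nsum f D = (f \in S)%:R /\ tsum f D = tsum f D1.
  move: f; apply: (@max_rigid v0 S chi m (fun f => m f - nsum f (D1 - D))
    (fun f => nsum f D) (fun f => tsum f D1) _ (fun v => coeff (vert v) D)) => //.
  - by move=> f; apply: fsum_ge0 => // p; exact: ler0n.
  - move=> f; apply/andP; split.
      apply: fsum_ge0 => // p; have [/innerP[+ _]|/pos_out->//] := boolP (inner f p).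
      by case/andP => /ltW.
    rewrite -subr_ge0 -kinks_len; apply: fsum_ge0 => // p.
    by rewrite /kink; case: ifP => // _; rewrite le_max lexx orbT.
  - by move=> f; rewrite /nsum fsumB -/(nsum f D1) n1 opprB addrA addrAC.
  - by move=> f /imsetP[i _ ->]; rewrite t1S; have [ti _] := innerP (ex i).
  - move=> f fS; rewrite /tsum fsum_bigU big1 // => j _; rewrite pos_out //.
    have [tj ->] := innerP (ex j); rewrite inner_par //.
    by apply: contraNneq fS => ->; exact: imset_f.
  - by move=> f; rewrite chiE [tsum f (D1 - D)]fsumB.
  - move=> v; rewrite -mE coeffB [X in X - _]coeff_fsum fsum_bigU big1 ?sub0r // => j _.
    by case: eqP => // xv; have := ex j; rewrite xv inner_vert.
have coeff1 i : coeff (x i) D1 = 1.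
  rewrite coeff_fsum fsum_bigU (bigD1 i) //= eqxx big1 ?addr0 // => j ji.
  case: eqP => // xji; have [tj xjE] := innerP (ex j).
  have := ex i; rewrite -xji xjE inner_par // (inj_eq e_inj) => /eqP ij.
  by rewrite ij eqxx in ji.
apply: subr0_eq; apply: effective_deg_eq0; last first.
  by apply/eqP; rewrite degB -oppr_eq0 opprB -degB; apply/eqP; exact: edge_data_deg ed.
apply/effectiveP => p; rewrite coeffB subr_ge0.
have [[i ->]|nx] := pselect (exists i, p = x i); last first.
  rewrite [X in X <= _]coeff_fsum fsum_bigU big1 ?D0' // => i _.
  by case: eqP => // xp; case: nx; exists i.
have [|p' ip' [cp' tp']] := @effective_inner D (e i) D0; first by rewrite (chips _).1 imset_f.
suff xp' : p' = x i by rewrite coeff1 -xp' -gtz0_ge1.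
have [_ ->] := innerP ip'; have [_ ->] := innerP (ex i).
by rewrite -tp' (chips _).2 t1S; congr par; rewrite pos_par //; case: (innerP (ex i)).
Qed.

End Rigidity.

(** * Topology of the Jacobian *)

Section JacTopology.
Context {R : realType} {X : metricType R} (G : model X).
Local Notation E := 'I_(nedge G).
Local Notation V := 'I_(nvert G).
Local Notation chain := 'rV[R]_(nedge G).
Local Notation bd := (boundary_mx G).
Implicit Types (h k : H1 G) (al be : Jac G).

Definition H1_ball h (r : R) : set (H1 G) :=
  [set k | forall i, `|h1val h 0 i - h1val k 0 i| < r].

Lemma nbhs_H1 h (A : set (H1 G)) :
  nbhs h A <-> exists2 r, 0 < r & H1_ball h r `<=` A.
Proof.
split.
  rewrite nbhsE => -[B [[C oC <-] hB] BA].
  have /nbhs_ballP[r /= r0 rC] : nbhs (h1val h) C by apply: open_nbhs_nbhs.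
  exists r => // k hk; apply: BA; apply: rC; split=> // i j.
  by rewrite ord1; exact: hk.
move=> [r r0 rA]; apply: (filterS rA).
have nb : nbhs h (@h1val R X G @^-1` ball (h1val h) r).
  by apply: (@initial_continuous _ _ (@h1val R X G) h); exact: nbhsx_ballx.
by apply: filterS nb => k [_ hk] i; exact: hk.
Qed.

Lemma h1valD h k i : h1val (h + k) 0 i = h1val h 0 i + h1val k 0 i.
Proof. by rewrite -[h1val (h + k)]/(h1val h + h1val k) mxE. Qed.

Lemma h1valB h k i : h1val (h - k) 0 i = h1val h 0 i - h1val k 0 i.
Proof. by rewrite -[h1val (h - k)]/(h1val h - h1val k) !mxE. Qed.

Lemma h1valZ (a : R) h i : h1val (a *: h) 0 i = a * h1val h 0 i.
Proof. by rewrite -[h1val (a *: h)]/(a *: h1val h) mxE. Qed.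

Lemma pi_JacD h k : pi_Jac (h + k) = pi_Jac h + pi_Jac k.
Proof. exact: raddfD. Qed.

(** The projection to the torus is open: the preimage of the image [W] of a ball is a union of
    translates of that ball by the lattice. *)
Lemma nbhs_Jac h (U : set (Jac G)) :
  nbhs (pi_Jac h) U <-> exists2 r, 0 < r & forall k, H1_ball h r k -> U (pi_Jac k).
Proof.
split=> [/(@pi_continuous _ _ h)/nbhs_H1//|[r r0 rU]].
pose W : set (Jac G) := [set al | exists k, H1_ball h r k /\ al = pi_Jac k].
rewrite nbhsE; exists W; last by move=> al [k [/rU hk ->]].
split; last first.
  by exists h; split=> // i; rewrite subrr normr0.
suff : open (@pi_Jac R X G @^-1` W) by [].
rewrite openE => k [k' [hk' kk']].
have [d d0 dP] : exists2 d, 0 < d & forall i, d <= r - `|h1val h 0 i - h1val k' 0 i|.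
  by apply: min_len => i; rewrite subr_gt0.
apply/nbhs_H1; exists d => // u ku; exists (u - k + k'); split.
  move=> i; rewrite h1valD h1valB; have := ku i; have := dP i.
  set x := h1val h 0 i; set y := h1val k' 0 i; set a := h1val k 0 i; set b := h1val u 0 i.
  move=> h1 h2; have -> : x - (b - a + y) = (x - y) + (a - b) by lra.
  by apply: le_lt_trans (ler_normD _ _) _; lra.
by rewrite pi_JacD pi_JacB kk' subrK.
Qed.

Lemma int_gap (x : R) : x \isn't a Num.int ->
  exists2 e, 0 < e & forall n : int, e <= `|x - n%:~R|.
Proof.
move=> xZ; pose n := Num.floor x.
have n1 : n%:~R <= x := floor_le x; have n2 : x < (n + 1)%:~R := floorD1_gt x.
have n3 : n%:~R != x by apply: contraNneq xZ => <-; exact: intr_int.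
have n4 : n%:~R < x by rewrite lt_neqAle n3.
exists (Num.min (x - n%:~R) ((n + 1)%:~R - x)); first by rewrite lt_min; lra.
move=> m; have [mn|nm] := lerP m n.
  have : m%:~R <= n%:~R :> R by rewrite ler_int.
  move=> h; rewrite ger0_norm ?ge_min; last lra.
  by apply/orP; left; lra.
have : (n + 1)%:~R <= m%:~R :> R by rewrite ler_int lezD1.
move=> h; rewrite distrC ger0_norm ?ge_min; last lra.
by apply/orP; right; lra.
Qed.

(** Lifts of distinct classes differ by a non-integer in some coordinate. If that difference stays
    at least [e] away from the integers, the images of the balls of radius [e / 2] are disjoint. *)
Lemma Jac_hausdorff : hausdorff_space (Jac G).
Proof.
move=> al be; have [h ->] := pi_Jac_surj al; have [k ->] := pi_Jac_surj be => cl.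
apply: contrapT => hk.
have [i hki] : exists i, h1val (h - k) 0 i \isn't a Num.int.
  apply: contrapT => no; apply: hk; apply: subr0_eq; rewrite -pi_JacB.
  apply/pi_Jac_eq0/mxOverP => j i; rewrite ord1; apply: contrapT => /negP n.
  by apply: no; exists i.
have [e e0 eP] := int_gap hki.
pose W h : set (Jac G) := [set al | exists k, H1_ball h (e / 2) k /\ al = pi_Jac k].
have WP h' : nbhs (pi_Jac h') (W h').
  by apply/nbhs_Jac; exists (e / 2); [lra|move=> k' ?; exists k'].
have [_ [[h' [hh' ->]] [k' [kk' hk']]]] := cl _ _ (WP h) (WP k).
have : h' - k' \in H1Z (G := G) by apply/pi_Jac_eq0; rewrite pi_JacB hk' subrr.
move/mxOverP => /(_ 0 i); rewrite h1valB => /intrP[n nE].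
have := eP n; rewrite -nE h1valB; apply/negP; rewrite -ltNge.
have := hh' i; have := kk' i.
set x := h1val h 0 i; set y := h1val k 0 i; set a := h1val h' 0 i; set b := h1val k' 0 i.
move=> h1 h2; have -> : x - y - (a - b) = (x - a) - (y - b) by lra.
by apply: le_lt_trans (ler_normB _ _) _; lra.
Qed.

Lemma continuous_Jac_add (T : topologicalType) (f g : T -> Jac G) :
  continuous f -> continuous g -> continuous (fun x => f x + g x).
Proof.
move=> cf cg x; have [h fx] := pi_Jac_surj (f x); have [k gx] := pi_Jac_surj (g x).
move=> U; rewrite fx gx -pi_JacD => /nbhs_Jac[r r0 rU].
pose W h : set (Jac G) := [set al | exists k, H1_ball h (r / 2) k /\ al = pi_Jac k].
have WP h' : nbhs (pi_Jac h') (W h').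
  by apply/nbhs_Jac; exists (r / 2); [lra|move=> k' ?; exists k'].
have nf : \forall y \near x, W h (f y) by apply: cf; rewrite fx; exact: WP.
have ng : \forall y \near x, W k (g y) by apply: cg; rewrite gx; exact: WP.
suff : \forall y \near x, U (f y + g y) by [].
apply: filterS2 nf ng => y [h' [hh' ->]] [k' [kk' ->]] /=.
rewrite -pi_JacD; apply: rU => i; rewrite !h1valD opprD addrACA.
have := hh' i; have := kk' i => h1 h2.
by apply: le_lt_trans (ler_normD _ _) _; lra.
Qed.

Lemma continuous_Jac_sum (T : topologicalType) (I : finType) (f : I -> T -> Jac G) :
  (forall i, continuous (f i)) -> continuous (fun x => \sum_i f i x).
Proof.
move=> cf; elim: (index_enum I) => [|i s IH].
  by under eq_fun do rewrite big_nil; exact: cst_continuous.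
under eq_fun do rewrite big_cons.
exact: continuous_Jac_add.
Qed.

Lemma continuous_Jac_line h k : continuous (fun t : R => pi_Jac (h + t *: k)).
Proof.
move=> t U /nbhs_Jac[r r0 rU]; pose M : R := 1 + \sum_i `|h1val k 0 i|.
have M0 : 0 < M by rewrite ltr_pwDl // sumr_ge0.
have kM i : `|h1val k 0 i| <= M.
  rewrite /M (bigD1 i) //= -[leLHS]add0r lerD ?ler01 //.
  by rewrite lerDl sumr_ge0.
suff : \forall s \near t, U (pi_Jac (h + s *: k)) by [].
near=> s; apply: rU => i; rewrite !h1valD !h1valZ.
have st : `|t - s| < r / M.
  near: s; apply/nbhs_ballP; exists (r / M); first by rewrite /= divr_gt0.
  by move=> s.
rewrite opprD addrACA subrr add0r -mulrBl normrM.
apply: le_lt_trans (ler_wpM2l (normr_ge0 _) (kM i)) _.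
by rewrite -ltr_pdivlMr.
Unshelve. all: by end_near. Qed.

Variables (c : V -> chain) (b0 : 'rV[R]_(nvert G)).
Hypothesis cP : forall v, c v \is a mxOver Num.int /\ c v *m bd = delta_mx 0 v - b0.

Lemma point_Jac_par e t : 0 <= t <= len e ->
  point_Jac c (par e t) = pi_Jac (proj (c (src e)) + t *: ((len e)^-1 *: proj (delta_mx 0 e))).
Proof.
move=> tI; rewrite /point_Jac (chain_Jac_kappa_par cP) // /chain_Jac /edge_chain.
by congr pi_Jac; rewrite raddfD /= projZ scalerA.
Qed.

(** On a closed edge the map follows a line of the torus, so the preimage of a closed set is a
    finite union of vertices and compact pieces of edges. *)
Lemma point_Jac_continuous : continuous (point_Jac (G := G) c).
Proof.
apply/continuous_closedP => Z cZ.
pose f e t := pi_Jac (proj (c (src e)) + t *: ((len e)^-1 *: proj (delta_mx 0 e))).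
have -> : point_Jac (G := G) c @^-1` Z =
   (\bigcup_(v in [set v : V | Z (point_Jac c (vert v))]) [set vert v]) `|`
   \bigcup_(e in [set: E]) (par e @` (`[0, len e] `&` (f e @^-1` Z))).
  apply/seteqP; split=> p /=.
    have [[v ->]|[e [t [tI ->]]]] := model_cover G p => Zp; first by left; exists v.
    have tI' : 0 <= t <= len e by lra.
    right; exists e => //; exists t => //; split; first by rewrite /= in_itv.
    by rewrite /= /f -point_Jac_par.
  case=> [[v Zv ->]//|[e _ [t [tI Zt] <-]]].
  by rewrite point_Jac_par; move: tI; rewrite /= in_itv.
apply: closedU; apply: closed_bigcup; [exact: finite_finset| |exact: finite_finset|].
  move=> v _; apply: accessible_closed_set1; apply: hausdorff_accessible.
  exact: metric_hausdorff.
move=> e _; apply: compact_closed; first exact: metric_hausdorff.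
apply: compact_par; last by move=> t [].
apply: compact_closedI; first exact: segment_compact.
by apply: (continuous_closedP _).1 => //; exact: continuous_Jac_line.
Qed.

End JacTopology.

(** * Effective classes *)

Section EffectiveClasses.
Context {R : realType} {X : metricType R} (X_graph : metric_graph X).
Context (G : model X) (q : X) (d : nat).
Local Notation E := 'I_(nedge G).
Local Notation V := 'I_(nvert G).
Local Notation chain := 'rV[R]_(nedge G).
Local Notation bd := (boundary_mx G).
Local Notation srcG := (@src R X G).
Local Notation tgtG := (@tgt R X G).
Local Notation config := {ptws 'I_d -> X}.
Implicit Types (x y : 'I_d -> X).

Let conn : cut_connected G := @graph_cut_connected R X X_graph G.

Lemma graph_stars p : exists n r (c : 'I_n -> R -> X), star_chart p r c.
Proof. by case: X_graph. Qed.

Lemma lin_class_eqP (D1 D2 : {freeg X}) : lin_class D1 = lin_class D2 <-> lin_equiv D1 D2.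
Proof.
have LE := lin_equiv_AJ X_graph G q.
split=> [e|/LE[dE aE]].
  suff : lin_class D1 D1 by rewrite e.
  by apply/LE.
by apply/seteqP; split=> D /LE[d1 a1]; apply/LE; rewrite d1 a1.
Qed.

Lemma AJ_class (D : @Div R X d) : AJ G q d (div_class D) = AJ_div G q (val D).
Proof.
rewrite /AJ; case: xgetP => [D' _ [dD' eD']|/(_ (val D))[]].
  by have /lin_class_eqP/(lin_equiv_AJ X_graph G q)[_ ->] := eD'.
by split=> //; exact/eqP/(valP D).
Qed.

Lemma AJ_inj : injective (AJ G q d).
Proof.
move=> C1 C2; have /asboolP[D1 e1] := valP C1; have /asboolP[D2 e2] := valP C2.
have -> : C1 = div_class D1 by exact: val_inj.
have -> : C2 = div_class D2 by exact: val_inj.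
rewrite !AJ_class => aE; apply: val_inj => /=; apply/lin_class_eqP.
by apply/(lin_equiv_AJ X_graph G q); rewrite (eqP (valP D1)) (eqP (valP D2)).
Qed.

Lemma points_div_surj (D : @EffDiv R X d) : exists x, D = points_div x.
Proof.
have [|x xE] := @effective_points_sum R X d (val (val D)) (valP D).
  exact/eqP/(valP (val D)).
by exists x; do 2 apply: val_inj.
Qed.

(** Tuples with the same divisor contain every point equally often, so they differ by a permutation;
    genericity is a property of the divisor. *)
Lemma generic_perm x y : points_div x = points_div y -> generic G x -> generic G y.
Proof.
move=> /(congr1 (fun D : EffDiv d => val (val D))) /= xy [e [e_inj cf ex]].
have cnt (z : 'I_d -> X) p : (count_mem p [seq z i | i : 'I_d])%:Z = coeff p (\sum_i << z i >>).
  rewrite coeff_fsum fsum_bigU count_map -sum1_count big_enum_cond /=.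
  rewrite -natz natr_sum big_mkcond /=; apply: eq_bigr => i _.
  by case: (z i == p).
have : perm_eq [tuple x i | i < d] [tuple y i | i < d].
  apply/allP => p _ /=; apply/eqP.
  by have := cnt x p; rewrite xy -cnt => -[].
rewrite perm_sym => /tuple_permP[s sE].
have ys i : y i = x (s i).
  have : [tuple y i | i < d] = [tuple tnth [tuple x i | i < d] (s i) | i < d].
    exact: val_inj.
  by move=> /(congr1 (fun t => tnth t i)); rewrite !tnth_mktuple.
exists (e \o s); split=> [|B oB|i].
- by apply: inj_comp e_inj _; exact: perm_inj.
- apply: cf => f /oB /imsetP[i _ ->]; exact: imset_f.
- by rewrite ys; exact: ex.
Qed.

Lemma compact_config : compact [set: config].
Proof.
have cX : compact [set: X] by case: X_graph.
have := @tychonoff 'I_d (fun=> X) (fun=> [set: X]) (fun=> cX).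
by congr compact; apply/seteqP; split.
Qed.

Lemma eval_continuous (i : 'I_d) : continuous (fun x : config => x i).
Proof. exact: (@proj_continuous 'I_d (fun=> X) i). Qed.

Lemma generic_open : open (generic G (d := d) : set config).
Proof.
rewrite openE => x [e [e_inj cf ex]].
have FF : Filter (nbhs (x : config)) by exact: nbhs_filter.
have : \forall y \near (x : config), forall i, inner (e i) (y i).
  apply: (@filter_forall config 'I_d (fun i y => inner (e i) (y i)) (nbhs (x : config)) FF) => i.
  suff ni : nbhs (x i) [set p | inner (e i) p] by exact: (@eval_continuous i x _ ni).
  apply: open_nbhs_nbhs; split; last exact: ex.
  have -> : [set p | inner (e i) p] = [set p | exists t, 0 < t < len (e i) /\ p = par (e i) t].
    by apply/seteqP; split=> p /asboolP.
  exact: open_edge_interior.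
by apply: filterS => y ey; exists e.
Qed.

Variables (c : V -> chain) (b0 : 'rV[R]_(nvert G)).
Hypothesis cP : forall v, c v \is a mxOver Num.int /\ c v *m bd = delta_mx 0 v - b0.

(** The map from [X^d] to the torus induced by [S_map] (see [AJ_points]). It is closed, being
    continuous from a compact space to a Hausdorff one. *)
Definition config_Jac x : Jac G :=
  \sum_i point_Jac c (x i) + - (point_Jac c q *~ d%:Z).

Lemma AJ_points x : AJ G q d (S_map G q d (points_div x)) = config_Jac x.
Proof.
rewrite /S_map AJ_class (AJ_divE conn cP) /config_Jac.
have /eqP -> := deg_points x.
by congr (_ - _); rewrite fsum_bigU [LHS]raddf_sum.
Qed.

Lemma config_Jac_continuous : continuous (config_Jac : config -> Jac G).
Proof.
apply: continuous_Jac_add; last exact: cst_continuous.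
apply: continuous_Jac_sum => i y; apply: continuous_comp; first exact: eval_continuous.
exact: (point_Jac_continuous cP).
Qed.

Lemma closed_config_Jac (Z : set config) : closed Z -> closed (config_Jac @` Z).
Proof.
move=> cZ; apply: compact_closed; first exact: Jac_hausdorff.
apply: continuous_compact.
  exact: continuous_subspaceT config_Jac_continuous.
exact: (subclosed_compact cZ compact_config).
Qed.

(** Abel's theorem turns equal images into linear equivalence, to which [generic_rigid] applies. *)
Lemma config_Jac_rigid x y : generic G x -> config_Jac x = config_Jac y ->
  points_div x = points_div y.
Proof.
move=> gx xy; have [v0 _] := vertex_exists G q.
have : lin_equiv (\sum_i << x i >>) (\sum_i << y i >> : {freeg X}).
  apply/(lin_equiv_AJ X_graph G q).
  rewrite (eqP (deg_points x)) (eqP (deg_points y)); split=> //.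
  by have := AJ_points x; have := AJ_points y; rewrite -xy => <-; rewrite /S_map !AJ_class.
move/(lin_equivP G graph_stars) => [chi [m ed]].
have := generic_rigid v0 gx (effective_points y) ed => e.
by do 2 apply: val_inj.
Qed.

Lemma semibreak_config x : (d <= genus G)%N -> exists (e : 'I_d -> E) (a : E -> R),
  [/\ injective e, cut_free srcG tgtG [set e i | i in 'I_d]%SET,
      forall i, 0 <= a (e i) <= len (e i) &
      config_Jac (fun i => par (e i) (a (e i))) = config_Jac x].
Proof.
move=> dg; have [S [a [cS cf va J]]] := semibreak_exists conn cP x dg.
pose e (i : 'I_d) : E := enum_val (cast_ord (esym cS) i).
have e_inj : injective e by move=> i j /enum_val_inj/cast_ord_inj.
have eS : [set e i | i in 'I_d]%SET = S.
  apply/eqP; rewrite eqEcard card_imset // card_ord cS leqnn andbT.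
  by apply/fintype.subsetP => f /imsetP[i _ ->]; exact: enum_valP.
exists e, a; rewrite eS; split=> // [i|]; first by apply: va; exact: enum_valP.
rewrite /config_Jac -J /chips_Jac -eS big_imset //=.
by move=> i j _ _; exact: e_inj.
Qed.

Lemma config_Jac_edges (e : 'I_d -> E) (a k : 'I_d -> R) :
  exists h1 h2 : H1 G, forall s,
    (forall i, 0 <= a i + s * k i <= len (e i)) ->
    config_Jac (fun i => par (e i) (a i + s * k i)) =
    pi_Jac (h1 + s *: h2) + - (point_Jac c q *~ d%:Z).
Proof.
pose B i : H1 G := (len (e i))^-1 *: proj (delta_mx 0 (e i)).
exists (\sum_i (proj (c (src (e i))) + a i *: B i)), (\sum_i k i *: B i) => s sI.
rewrite /config_Jac; congr (_ + _); rewrite scaler_sumr -big_split /= raddf_sum.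
apply: eq_bigr => i _; rewrite (point_Jac_par cP) //; congr pi_Jac.
by rewrite -/(B i) scalerDl scalerA addrA.
Qed.

Lemma generic_dense x (N : set (Jac G)) : (d <= genus G)%N ->
  nbhs (config_Jac x) N -> exists y, generic G y /\ N (config_Jac y).
Proof.
move=> dg; have [e [a [e_inj cf aI <-]]] := semibreak_config x dg.
(* Velocities bringing each chip of the semibreak divisor to the midpoint of its edge at time 1; at
   every time in []0, 1]] the divisor is generic. *)
pose k i := len (e i) / 2 - a (e i).
have [h1 [h2 hE]] := config_Jac_edges e (fun i => a (e i)) k.
have inI s i : 0 < s <= 1 -> 0 < a (e i) + s * k i < len (e i).
  move=> sI; have := aI i; have l0 := len_gt0 (e i) => ai.
  have -> : a (e i) + s * k i = (1 - s) * a (e i) + s * (len (e i) / 2) by rewrite /k; lra.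
  have s1 : 0 <= (1 - s) * a (e i) by apply: mulr_ge0; lra.
  have s2 : 0 <= (1 - s) * (len (e i) - a (e i)) by apply: mulr_ge0; lra.
  have s3 : 0 < s * (len (e i) / 2) by apply: mulr_gt0; lra.
  lra.
pose line s := pi_Jac (h1 + s *: h2) + - (point_Jac c q *~ d%:Z).
have cl : continuous line.
  by apply: continuous_Jac_add; [exact: continuous_Jac_line|exact: cst_continuous].
have l0 : config_Jac (fun i => par (e i) (a (e i))) = line 0.
  rewrite /line -hE; last by move=> i; rewrite mul0r addr0.
  by congr config_Jac; apply/funext => i; rewrite mul0r addr0.
rewrite l0 => /(cl 0)/nbhs_ballP[r /= r0 rN].
pose s := Num.min (r / 2) 1.
have s0 : 0 < s by rewrite lt_min; lra.
have s1 : s <= 1 by rewrite ge_min lexx orbT.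
have s2 : s <= r / 2 by rewrite ge_min lexx.
exists (fun i => par (e i) (a (e i) + s * k i)); split.
  exists e; split=> // i; rewrite inner_par //.
  by apply: inI; rewrite s0.
rewrite hE => [|i]; last by have := inI s i; rewrite s0 s1 => /(_ isT); lra.
by apply: (rN s); rewrite /ball /= sub0r normrN gtr0_norm //; lra.
Qed.

Definition generic_classes : set (PicTop G q d) :=
  [set C | exists x, generic G x /\ C = S_map G q d (points_div x)].

Lemma generic_classes_open_dense : (d <= genus G)%N ->
  open_dense_in generic_classes (Wd G q d).
Proof.
move=> dg; split.
  (* By rigidity no generic class comes from a non-generic tuple, so within [Wd] the generic classes
     are the complement of the closed image of the non-generic tuples. *)
  exists (AJ G q d @^-1` (~` (config_Jac @` (~` (generic G (d := d) : set config))))).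
    have := @initial_continuous _ _ (AJ G q d); move/continuousP; apply.
    apply: closed_openC; apply: closed_config_Jac; apply: open_closedC.
    exact: generic_open.
  apply/seteqP; split=> C.
    move=> [x [gx ->]]; split; first by exists (points_div x).
    rewrite /= AJ_points => -[y ngy /esym /(config_Jac_rigid gx)/generic_perm].
    by move=> /(_ gx).
  move=> [[D _ <-]]; have [x ->] := points_div_surj D => /= nx.
  exists x; split=> //; apply: contrapT => ngx; apply: nx.
  by rewrite AJ_points; exists x.
move=> _ [D _ <-]; have [x ->] := points_div_surj D => N.
rewrite nbhsE => -[_ [[N' oN' <-] xN'] sN].
have [|y [gy yN']] := @generic_dense x N' dg.
  by rewrite -AJ_points; exact: open_nbhs_nbhs.
exists (S_map G q d (points_div y)); split; first by exists y.
by apply: sN; rewrite /= AJ_points.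
Qed.

Lemma S_map_continuous : continuous (S_map G q d).
Proof.
apply/continuousP => _ [N oN <-].
have oN' : open ((config_Jac : config -> Jac G) @^-1` N).
  by have /continuousP := config_Jac_continuous; apply.
suff -> : S_map G q d @^-1` (AJ G q d @^-1` N) =
    [set D | exists2 x, D = points_div x & N (config_Jac x)].
  rewrite /open /= /EffDiv_open.
  have -> // : @points_div R X d @^-1` [set D | exists2 x, D = points_div x & N (config_Jac x)] =
      (config_Jac : config -> Jac G) @^-1` N.
  apply/seteqP; split=> x /=; last by exists x.
  by case=> y xy; rewrite -!AJ_points xy.
apply/seteqP; split=> D /=.
  by have [x ->] := points_div_surj D; rewrite AJ_points; exists x.
by case=> x ->; rewrite AJ_points.
Qed.

Lemma generic_classes_homeomorphism :
  homeomorphism_on (S_map G q d) (S_map G q d @^-1` generic_classes) generic_classes.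
Proof.
(* Outside the image of [S_map] the inverse takes an arbitrary value, [d] chips at [q]. *)
pose g (C : PicTop G q d) : EffDiv d :=
  xget (points_div (fun=> q)) [set D | S_map G q d D = C].
have gK (C : PicTop G q d) : generic_classes C -> S_map G q d (g C) = C.
  by move=> [x [_ ->]]; rewrite /g; case: xgetP => [D _ //|/(_ (points_div x))[]].
have uniqS (C : PicTop G q d) D D' : generic_classes C -> S_map G q d D = C -> S_map G q d D' = C -> D = D'.
  have [y ->] := points_div_surj D; have [z ->] := points_div_surj D'.
  move=> [x [gx ->]] /(congr1 (AJ G q d)) e1 /(congr1 (AJ G q d)) e2.
  move: e1 e2; rewrite !AJ_points => /esym/(config_Jac_rigid gx) <-.
  by move=> /esym/(config_Jac_rigid gx) <-.
exists g; split.
- by move=> D UD; split=> //; exact: (uniqS _ _ _ UD (gK _ UD) erefl).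
- by move=> C UC; rewrite /preimage /= gK.
- by apply: continuous_subspaceT; exact: S_map_continuous.
apply/subspace_continuousP => C UC A; rewrite nbhsE => -[B [oB gB] BA].
rewrite /nbhs /= /within /=.
(* The tuples whose divisor is not in [B] form a closed set with closed image. That image misses
   [C], whose only effective representative [g C] lies in [B]. *)
pose Z := ~` (@points_div R X d @^-1` B : set config).
have cZ : closed (config_Jac @` Z) by apply: closed_config_Jac; exact: open_closedC.
have : nbhs C (AJ G q d @^-1` (~` (config_Jac @` Z))).
  apply: (@initial_continuous _ _ (AJ G q d) C); apply: open_nbhs_nbhs; split.
    exact: closed_openC.
  case=> y yZ; rewrite -AJ_points => /AJ_inj yC.
  by apply: yZ; rewrite /= (uniqS C _ (g C) UC yC (gK C UC)).
apply: filterS => C' /= nC' UC'; apply: BA; apply: contrapT => nB; apply: nC'.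
have [y yE] := points_div_surj (g C'); exists y; first by rewrite /Z /= -yE.
by rewrite -AJ_points -yE gK.
Qed.

(** The rank is tested with [s > 0] chips at a vertex [p]. A representative of the remainder, with
    these chips added back, would be the unique effective divisor of the class, but a generic
    divisor has no chip at a vertex. *)
Lemma generic_classes_rank (D : @Div R X d) :
  generic_classes (div_class D) -> div_rank (val D) = 0.
Proof.
case=> x [gx /(congr1 (AJ G q d))]; rewrite AJ_points AJ_class => Dx.
have LE := lin_equiv_AJ X_graph G q.
have dD : deg (val D) = d%:Z by exact/eqP/(valP D).
have xD : lin_equiv (\sum_i << x i >>) (val D).
  apply/LE; rewrite dD (eqP (deg_points x)); split=> //.
  by rewrite Dx -AJ_points /S_map AJ_class.
rewrite /div_rank asboolT; last first.
  by exists (\sum_i << x i >>); split=> //; exact: effective_points.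
congr Posz; apply/eqP; rewrite -leqn0; apply/bigmax_leqP => -[s /= sd] /asboolP rk.
rewrite leqn0; apply: contraT => s0.
have [v0 _] := vertex_exists G q; pose p : X := vert v0.
have [||D' [D'0 /LE[dD' aD']]] := rk (<< p >> *+ s).
- apply/effectiveP => y; rewrite coeffMn coeffU mul1r mulrn_wge0 //.
- by rewrite degMn degU -natz.
have [||y yE] := @effective_points_sum R X d (D' + << p >> *+ s).
- apply: effectiveD => //; apply/effectiveP => y; rewrite coeffMn coeffU mul1r mulrn_wge0 //.
- by rewrite degD dD' degB dD subrK.
have /(congr1 (fun D : EffDiv d => val (val D))) /= xy : points_div x = points_div y.
  apply: config_Jac_rigid => //; rewrite -[RHS]AJ_points /S_map AJ_class /= -yE.
  by rewrite AJ_divD aD' AJ_divB subrK.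
have /effectiveP/(_ p) c0 := D'0.
have := congr1 (coeff p) yE; rewrite -xy coeffD coeffMn coeffU mul1r eqxx.
have [e [_ _ ex]] := gx.
rewrite [RHS]coeff_fsum fsum_bigU big1 => [/eqP|i _]; last first.
  by case: eqP => // xp; have := ex i; rewrite xp inner_vert.
by rewrite paddr_eq0 ?mulrn_wge0 // => /andP[_]; rewrite pnatr_eq0 (negPf s0).
Qed.

End EffectiveClasses.

(** * Polyhedral structure *)

Lemma sum_enum_val (I : finType) (M : nmodType) (S : {set I}) d (cS : #|S| = d)
  (f : I -> M) : \sum_(i < d) f (enum_val (cast_ord (esym cS) i)) = \sum_(e in S) f e.
Proof.
by subst d; rewrite [RHS]big_enum_val; apply: eq_bigr => i _; rewrite cast_ord_id.
Qed.

Section Cells.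
Context {R : realType} {X : metricType R} (G : model X).
Local Notation E := 'I_(nedge G).
Local Notation V := 'I_(nvert G).
Local Notation chain := 'rV[R]_(nedge G).
Local Notation bd := (boundary_mx G).
Local Notation srcG := (@src R X G).
Local Notation tgtG := (@tgt R X G).
Implicit Types (S B : {set E}).

Definition cube_vertex (w : H1 G) (u : E -> H1 G) S B : H1 G :=
  w + \sum_(e in S) ((e \in B)%:R : R) *: u e.

(** A polytope is the hull of a family indexed by an ordinal successor, so the corners of a cube are
    numbered through all subsets of [E], with repetitions. *)
Definition ord_set (i : 'I_(#|{set E}|.-1.+1)) : {set E} :=
  nth finset.set0 (enum {set E}) i.

Lemma card_sets : #|{set E}|.-1.+1 = #|{set E}|.
Proof. by rewrite prednK //; apply/card_gt0P; exists finset.set0. Qed.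

Lemma ord_setK B : exists i, ord_set i = B.
Proof.
have lt : (index B (enum {set E}) < #|{set E}|.-1.+1)%N.
  by rewrite card_sets cardE index_mem mem_enum.
by exists (Ordinal lt); rewrite /ord_set /= nth_index // mem_enum.
Qed.

Lemma sum_ord_set (M : nmodType) (F : {set E} -> M) :
  \sum_i F (ord_set i) = \sum_B F B.
Proof.
rewrite -[RHS]big_enum (big_nth finset.set0) -cardE.
by rewrite -[in RHS]card_sets big_mkord.
Qed.

(* The barycentric weights of a point with coordinates s in the unit cube are
   the products of the s e and 1 - s e. *)
Lemma cube_hull (w : H1 G) (u : E -> H1 G) S :
  convex_hull (fun i => cube_vertex w u S (ord_set i)) =
  [set x | exists s : E -> R, (forall e, 0 <= s e <= 1) /\
     x = w + \sum_(e in S) s e *: u e].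
Proof.
have comb (a : {set E} -> R) : \sum_B a B = 1 ->
    \sum_B a B *: cube_vertex w u S B =
    w + \sum_(e in S) (\sum_(B : {set E} | e \in B) a B) *: u e.
  move=> a1; under eq_bigr do rewrite scalerDr.
  rewrite big_split -scaler_suml a1 scale1r; congr (_ + _).
  under eq_bigr do rewrite scaler_sumr.
  rewrite exchange_big; apply: eq_bigr => e _.
  rewrite [in RHS]big_mkcond scaler_suml; apply: eq_bigr => B _ /=.
  by rewrite scalerA; case: (e \in B); rewrite ?mulr1 ?mulr0.
apply/seteqP; split=> x.
  move=> [a [a0 a1 ->]].
  have [b bE] : exists b : {set E} -> R, forall i, b (ord_set i) = a i.
    have uq : injective ord_set.
      have lt (i : 'I_(#|{set E}|.-1.+1)) : (i < size (enum {set E}))%N.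
        by rewrite -cardE -[X in (_ < X)%N]card_sets.
      by move=> i j /eqP; rewrite nth_uniq ?enum_uniq // => /eqP; exact: val_inj.
    have [h hK] := choice ord_setK; exists (a \o h) => i /=; congr a.
    by apply: uq; rewrite hK.
  have b0 B : 0 <= b B by have [i <-] := ord_setK B; rewrite bE.
  have b1 : \sum_B b B = 1 by rewrite -sum_ord_set -a1; apply: eq_bigr => i _.
  exists (fun e => \sum_(B : {set E} | e \in B) b B); split.
    move=> e; rewrite sumr_ge0 //= -b1 [leRHS](bigID (fun B : {set E} => e \in B)) /=.
    by rewrite lerDl sumr_ge0.
  rewrite -comb // -[RHS]sum_ord_set; apply: eq_bigr => i _.
  by rewrite bE.
move=> [s [sI ->]].
have distr (F1 F2 : E -> R) : \prod_e (F1 e + F2 e) =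
    \sum_(B : {set E}) \prod_e (if e \in B then F1 e else F2 e).
  exact: (@bigA_distr R 0 1 *%R +%R E F1 F2).
pose wt B : R := \prod_e (if e \in B then s e else 1 - s e).
have wt1 : \sum_B wt B = 1.
  have := distr s (fun e => 1 - s e).
  by rewrite big1 => [<-//|e _]; rewrite addrC subrK.
(* Replacing the factor [1 - s e] by 0 in the expansion keeps exactly the terms with [e] in [B],
   while the product becomes [s e]. *)
have wtE e : \sum_(B : {set E} | e \in B) wt B = s e.
  have := distr s (fun f => if f == e then 0 else 1 - s f).
  rewrite (bigD1 e) //= eqxx addr0 big1 ?mulr1 => [->|f /negPf->]; last by rewrite addrC subrK.
  rewrite [LHS]big_mkcond; apply: eq_bigr => B _; case: ifP => eB.
    by apply: eq_bigr => f _; case: ifP => //; case: eqP => // ->; rewrite eB.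
  by rewrite (bigD1 e) //= eB eqxx mul0r.
exists (fun i => wt (ord_set i)); split.
- by move=> i; apply: prodr_ge0 => e _; have := sI e; case: ifP => _; lra.
- by rewrite (sum_ord_set wt).
rewrite (sum_ord_set (fun B => wt B *: cube_vertex w u S B)) comb //.
by congr (_ + _); apply: eq_bigr => e _; rewrite wtE.
Qed.

(** A relation is the coboundary of a [chi] that is constant along all edges outside [S]. Deleting
    [S] leaves the graph connected, so [chi] is constant and the relation is trivial. *)
Lemma proj_delta_free S : cut_free srcG tgtG S -> forall y : E -> R,
  \sum_(e in S) y e *: proj (delta_mx 0 e : chain) = 0 -> forall e, e \in S -> y e = 0.
Proof.
move=> cf y y0 e eS; pose x : chain := \sum_(f in S) y f *: delta_mx 0 f.
have xE f : x 0 f = if f \in S then y f else 0.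
  rewrite summxE; have [fS|fS] := boolP (f \in S).
    rewrite (bigD1 f) //= !mxE !eqxx mulr1 big1 ?addr0 // => g /andP[_ /negPf gf].
    by rewrite !mxE [f == g]eq_sym gf mulr0.
  rewrite big1 // => g gS; rewrite !mxE eqxx /=; case: eqP => [fg|]; last by rewrite mulr0.
  by rewrite fg gS in fS.
have /proj_eq0[chi chiE] : proj x = 0.
  by rewrite raddf_sum -[RHS]y0; apply: eq_bigr => f _ /=; rewrite projZ.
have [f cr|A0|AT] := cf [set v | chi v == chi (src e)]%SET.
- apply: contrapT => /negP fS; have := chiE f; rewrite xE (negPf fS) mulr0 => /esym/eqP.
  rewrite subr_eq0 => /eqP ft; move: cr; rewrite /crosses !inE ft eqxx //.
- by have := finset.in_set0 (src e); rewrite -A0 inE eqxx.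
have : tgt e \in [set v | chi v == chi (src e)]%SET by rewrite AT finset.in_setT.
rewrite inE => /eqP te; have := chiE e; rewrite te subrr xE eS => /eqP.
by rewrite mulf_eq0 gt_eqF ?len_gt0 //= => /eqP.
Qed.

Lemma cube_affine_dim w S : cut_free srcG tgtG S ->
  affine_dim (fun i => cube_vertex w (fun e => proj (delta_mx 0 e)) S (ord_set i)) = #|S|.
Proof.
move=> cf; pose u e : H1 G := proj (delta_mx 0 e).
pose Q : 'M[R]_(#|S|, nedge G) := \matrix_(j < #|S|) h1val (u (enum_val j)).
rewrite /affine_dim; set M := \matrix_i _.
pose B0 := ord_set ord0.
have rowM i : row i M = \sum_(e in S) ((e \in ord_set i)%:R - (e \in B0)%:R) *: h1val (u e).
  rewrite rowK /cube_vertex opprD addrACA subrr add0r -sumrB.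
  rewrite (big_morph (@h1val R X G) (id1 := 0) (op1 := +%R)) //.
  by apply: eq_bigr => e _; rewrite -scalerBl.
have rowQ e : e \in S -> (h1val (u e) <= Q)%MS.
  move=> eS; apply: (@eq_row_sub _ _ _ _ _ (enum_rank_in eS e)).
  by rewrite rowK enum_rankK_in.
suff -> : \rank M = \rank Q.
  apply/eqP/inj_row_free => y yQ.
  pose z e := if [pick j | enum_val j == e :> E] is Some j then y 0 j else 0 : R.
  have zE j : z (enum_val j) = y 0 j.
    rewrite /z; case: pickP => [k /eqP/enum_val_inj->//|/(_ j)].
    by rewrite eqxx.
  have z0 : \sum_(e in S) z e *: u e = 0.
    apply: val_inj => /=; rewrite (big_morph (@h1val R X G) (id1 := 0) (op1 := +%R)) //.
    rewrite big_enum_val -[RHS]yQ mulmx_sum_row; apply: eq_bigr => j _.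
    by rewrite zE rowK.
  apply/rowP => j; rewrite -zE mxE; apply: (proj_delta_free cf z0).
  exact: enum_valP.
apply/eqmx_rank/andP; split; apply/row_subP => i.
  rewrite rowM; apply: summx_sub => e eS; apply: scalemx_sub; exact: rowQ.
rewrite rowK; set e := enum_val i; have eS : e \in S by exact: enum_valP.
(* Flipping the membership of [e] in the base corner [B0] gives a corner that differs from it by
   [u e] up to sign. *)
have [j jE] := ord_setK (symdiff B0 [set e]%SET).
have -> : h1val (u e) = (1 - 2 * (e \in B0)%:R) *: row j M.
  rewrite rowM (bigD1 e) //= big1 ?addr0 => [|f /andP[_ fe]]; last first.
    by rewrite jE in_symdiff finset.in_set1 (negPf fe) addbF subrr scale0r.
  rewrite jE in_symdiff finset.in_set1 eqxx addbT scalerA.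
  by case: (e \in B0) => /=; rewrite -[LHS]scale1r; congr (_ *: _); lra.
by apply: scalemx_sub; exact: row_sub.
Qed.

End Cells.

Section Polyhedral.
Context {R : realType} {X : metricType R} (X_graph : metric_graph X).
Context (G : model X) (q : X) (d : nat).
Local Notation E := 'I_(nedge G).
Local Notation chain := 'rV[R]_(nedge G).
Local Notation srcG := (@src R X G).
Local Notation tgtG := (@tgt R X G).

Lemma Wd_polyhedral : (d <= genus G)%N ->
  purely_polyhedral d (AJ G q d @` Wd G q d).
Proof.
move=> dg; have conn := @graph_cut_connected R X X_graph G.
have [c [b0 cP]] := base_chains conn.
pose u e : H1 G := proj (delta_mx 0 e : chain).
(* The corner of the cube of [S] at which every chip sits at the source of its edge, shifted by [d]
   times the base point. *)
pose w (S : {set E}) : H1 G := \sum_(e in S) proj (c (src e)) - proj (kappa c q) *~ d%:Z.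
pose T := [set S : {set E} | (#|S| == d) && `[< cut_free srcG tgtG S >]]%SET.
pose P (j : 'I_#|T|) := convex_hull (fun i => cube_vertex (w (enum_val j)) u (enum_val j) (ord_set i)).
have TP (j : 'I_#|T|) : #|enum_val j| = d /\ cut_free srcG tgtG (enum_val j).
  by have := enum_valP j; rewrite inE => /andP[/eqP ? /asboolP].
have cell S (a : E -> R) : chip_positions S a ->
    chips_Jac c S a + - (point_Jac c q *~ d%:Z) =
    pi_Jac (w S + \sum_(e in S) (a e / len e) *: u e).
  move=> va; rewrite /w addrAC pi_JacB; congr (_ - _); last by rewrite raddfMz.
  rewrite -big_split raddf_sum; apply: eq_bigr => e eS.
  by rewrite (point_Jac_par cP) ?va //= scalerA.
exists #|T|, P; split=> [j|].
  have [cS cf] := TP j.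
  exists #|{set E}|.-1, (fun i => cube_vertex (w (enum_val j)) u (enum_val j) (ord_set i)).
  by split=> //; rewrite cube_affine_dim.
apply/seteqP; split=> al.
  move=> [C [D _ <-] <-]; have [x ->] := points_div_surj D.
  rewrite (AJ_points X_graph q cP).
  have [S [a [cS cf va J]]] := semibreak_exists conn cP x dg.
  have ST : S \in T by rewrite inE cS eqxx; apply/asboolP.
  exists (enum_rank_in ST S) => //; rewrite /P enum_rankK_in // cube_hull.
  exists (w S + \sum_(e in S) (a e / len e) *: u e); last by rewrite -cell // J.
  (* [cube_hull] asks for all coordinates in the unit interval; those outside [S], which do not
     enter the sum, are set to 0. *)
  exists (fun e => if e \in S then a e / len e else 0); split.
    move=> e; case: ifP => [eS|]; last by rewrite lexx ler01.
    have := va e eS; have l0 := len_gt0 e => /andP[a0 al'].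
    by rewrite divr_ge0 ?(ltW l0) //= ler_pdivrMr ?mul1r.
  by congr (_ + _); apply: eq_bigr => e ->.
move=> [j _]; have [cS cf] := TP j; rewrite /P cube_hull => -[_ [s [sI ->]] <-].
set S := enum_val j in cS cf *.
pose a e := s e * len e.
have va : chip_positions S a.
  move=> e _; have := sI e; have l0 := len_gt0 e => /andP[s0 s1].
  by rewrite mulr_ge0 ?(ltW l0) //= ler_piMl ?(ltW l0).
pose x (i : 'I_d) : X := let e := enum_val (cast_ord (esym cS) i) in par e (a e).
exists (S_map G q d (points_div x)); first by exists (points_div x).
rewrite (AJ_points X_graph q cP) /config_Jac.
have -> : \sum_(e in S) s e *: u e = \sum_(e in S) (a e / len e) *: u e.
  by apply: eq_bigr => e _; rewrite /a mulfK // gt_eqF // len_gt0.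
rewrite -cell //; congr (_ + _).
exact: (sum_enum_val cS (fun e => point_Jac c (par e (a e)))).
Qed.

End Polyhedral.

Theorem theoremE (R : realType) (X : metricType R) (X_graph : metric_graph X)
    (X_not_point : ~ is_point X) (X_not_circle : ~ is_circle X)
    (G : model X) (q : X) (d : nat) (d_le_genus : (d <= genus G)%N) :
  [/\ purely_polyhedral d (AJ G q d @` Wd G q d),
      exists U : set (PicTop G q d), open_dense_in U (Wd G q d) /\
        homeomorphism_on (S_map G q d) (S_map G q d @^-1` U) U
    & exists U : set (PicTop G q d), open_dense_in U (Wd G q d) /\
        forall D : @Div R X d, U (div_class D) -> div_rank (val D) = 0].
Proof.
have conn := @graph_cut_connected R X X_graph G.
have [c [b0 cP]] := base_chains conn.
split; first exact: Wd_polyhedral.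
  exists (@generic_classes R X G q d); split.
    exact: (generic_classes_open_dense X_graph q cP).
  exact: (generic_classes_homeomorphism X_graph q d cP).
exists (@generic_classes R X G q d); split.
  exact: (generic_classes_open_dense X_graph q cP).
move=> D; exact: (generic_classes_rank X_graph cP).
Qed.
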